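(* For all $d\ge 3$ there is a $U_d<\infty$ such that for all $u\ge U_d$, $$T_c^+(u,d)=T_c^-(u,d).$$ Denoting this common value by $T_c=T_c(u,d)$, $\mathcal{FI}^{u,T}$ percolates almost surely for all $T>T_c$, and does not percolate almost surely for all $T<T_c$ (with $T>0$).
   Context: $\mathbb{L}^d=\{\{x,y\}: x,y\in\mathbb{Z}^d,\ |x-y|_2=1\}$ is the set of undirected nearest-neighbor edges of $\mathbb{Z}^d$ ($|\cdot|_2$ is the Euclidean norm). For $T\in(0,\infty)$ and $x\in\mathbb{Z}^d$, $P_x^{(T)}$ is the law of the simple random walk on $\mathbb{Z}^d$ started at $x$ and killed with probability $\frac1{T+1}$ at each step: the number of steps $N$ (the length of the path) satisfies $P(N=k)=\left(\frac{T}{T+1}\right)^k\frac{1}{T+1}$ for $k=0,1,2,\dots$ (mean $T$) and is independent of the underlying simple random walk. $P_x^{(T)}$ is regarded as a measure on the set $W^{[0,\infty)}$ of finite nearest-neighbor paths in $\mathbb{Z}^d$. For $0<u,T<\infty$, the finitary random interlacement $\mathcal{FI}^{u,T}$ is the Poisson point process on $W^{[0,\infty)}$ with intensity measure $u\sum_{x\in\mathbb{Z}^d}\frac{2d}{T+1}P_x^{(T)}$. Equivalently, with $\{N_x\}_{x\in\mathbb{Z}^d}$ i.i.d. Poisson of parameter $\frac{2du}{T+1}$, one starts $N_x$ independent killed walks of law $P_x^{(T)}$ from each $x\in\mathbb{Z}^d$, and $\mathcal{FI}^{u,T}$ is the point measure consisting of all these trajectories. It is also regarded as a bond percolation model: an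 edge $e\in\mathbb{L}^d$ is open iff some path in $\mathcal{FI}^{u,T}$ traverses $e$. $\mathcal{FI}^{u,T}$ percolates iff there is an infinite connected cluster composed of open edges. Critical values, for $u>0$ and $d\ge3$: $T_c^-(u,d)=\sup\{T_0>0:\ \forall\, 0<T<T_0,\ \mathcal{FI}^{u,T}\text{ a.s. does not percolate}\}$ and $T_c^+(u,d)=\inf\{T_0>0:\ \forall\, T>T_0,\ \mathcal{FI}^{u,T}\text{ a.s. percolates}\}$. It is known that $0<T_c^-(u,d)\le T_c^+(u,d)<\infty$. *)

(* Defs.v *)
From mathcomp Require Import all_boot all_order all_algebra.
From mathcomp Require Import all_classical all_reals all_analysis.
From mathcomp Require Import measurable_realfun.
From Stdlib Require Import Relation_Operators.

Set Implicit Arguments.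
Unset Strict Implicit.
Unset Printing Implicit Defensive.

Import Order.TTheory GRing.Theory Num.Theory.

Local Open Scope classical_set_scope.
Local Open Scope ring_scope.

(* Point processes live on a countable space E in which every subset is
   measurable. A point measure is given by its multiplicities m : E -> nat. *)
Section PoissonPointProcess.
Context (R : realType) (E : countType).

Definition point_count (m : E -> nat) (A : set E) : \bar R :=
  \esum_(e in A) ((m e)%:R)%:E.

(* poisson_prob lam k is the Poisson(lam) law; its argument k is a dummy.
   For lam = 0 it is the Dirac mass at 0. *)
Definition poisson_point_process (mu : set E -> \bar R)
    (disp : measure_display) (Omega : measurableType disp)
    (P : probability Omega R) (N : Omega -> E -> nat) : Prop :=
  [/\ forall e, measurable_fun setT (fun omega => N omega e),
      forall (A : set E) (lam : R), mu A = lam%:E -> forall k : nat,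
        P [set omega | point_count (N omega) A = (k%:R)%:E] =
        poisson_prob lam k [set k],
      forall A : set E, mu A = +oo%E ->
        P [set omega | point_count (N omega) A = +oo%E] = 1%E
    & forall (n : nat) (A : 'I_n -> set E) (B : 'I_n -> set (\bar R)),
        trivIset setT A -> (forall i, measurable (B i)) ->
        P [set omega | forall i, B i (point_count (N omega) (A i))] =
        (\prod_(i < n) P [set omega | B i (point_count (N omega) (A i))])%E].

End PoissonPointProcess.

Notation lattice d := 'rV[int]_d.

Section Lattice.
Context (d : nat).

(* |x - y|_2 = 1, i.e. |x - y|_2 ^ 2 = 1, which is a condition on integers *)
Definition adj (x y : lattice d) : bool :=
  \sum_(i < d) (x ord0 i - y ord0 i) ^+ 2 == 1.

(* A finite nearest-neighbour path: its starting point and the sequence of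
   vertices visited afterwards. *)
Definition walk : Type :=
  {p : lattice d * seq (lattice d) | path adj p.1 p.2}.

Definition wstart (w : walk) : lattice d := (val w).1.
Definition wlength (w : walk) : nat := size (val w).2.
Definition wvertex (w : walk) (i : nat) : lattice d :=
  nth (wstart w) (wstart w :: (val w).2) i.

(* An undirected edge {x, y} is represented by either of its orientations;
   the relations below are symmetric in x and y. *)
Definition traverses (w : walk) (x y : lattice d) : Prop :=
  exists2 i : nat, (i < wlength w)%N &
    (wvertex w i = x /\ wvertex w i.+1 = y) \/
    (wvertex w i = y /\ wvertex w i.+1 = x).

Definition open_edge (m : walk -> nat) (x y : lattice d) : Prop :=
  exists2 w : walk, (0 < m w)%N & traverses w x y.

Definition cluster (m : walk -> nat) (x : lattice d) : set (lattice d) :=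
  [set y | clos_refl_trans (lattice d) (open_edge m) x y].

Definition percolates (m : walk -> nat) : Prop :=
  exists x : lattice d, infinite_set (cluster m x).

End Lattice.

Section FinitaryInterlacements.
Context (R : realType) (d : nat).

Definition srw_step (x y : lattice d) : R :=
  if adj x y then ((2 * d)%:R)^-1 else 0.

Definition length_pmf (T : R) (k : nat) : R :=
  (T / (T + 1)) ^+ k * (T + 1)^-1.

(* P_x^(T)({w}): since the length N is independent of the simple random walk
   (X_i), this is P(N = k) P(X_0 = w_0, ..., X_k = w_k | X_0 = x) with k the
   length of w. *)
Definition killed_walk_pmf (T : R) (x : lattice d) (w : walk d) : R :=
  (wstart w == x)%:R * length_pmf T (wlength w) *
  \prod_(i < wlength w) srw_step (wvertex w i) (wvertex w i.+1).

Definition killed_walk (T : R) (x : lattice d) (A : set (walk d)) : \bar R :=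
  \esum_(w in A) (killed_walk_pmf T x w)%:E.

Definition FI_intensity (u T : R) (A : set (walk d)) : \bar R :=
  (u%:E * \esum_(x in [set: lattice d])
            (((2 * d)%:R / (T + 1))%:E * killed_walk T x A))%E.

(* FI is a realization of the finitary random interlacement FI^{u,T}. *)
Definition finitary_interlacement (u T : R) (disp : measure_display)
    (Omega : measurableType disp) (P : probability Omega R)
    (FI : Omega -> walk d -> nat) : Prop :=
  poisson_point_process (FI_intensity u T) P FI.

(* Almost sure properties depend only on the law of FI^{u,T}; they are
   required of every realization, on every probability space. *)
Definition FI_as_percolates (u T : R) : Prop :=
  forall (disp : measure_display) (Omega : measurableType disp)
    (P : probability Omega R) (FI : Omega -> walk d -> nat),
    finitary_interlacement u T P FI ->
    {ae P, forall omega, percolates (FI omega)}.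

Definition FI_as_not_percolates (u T : R) : Prop :=
  forall (disp : measure_display) (Omega : measurableType disp)
    (P : probability Omega R) (FI : Omega -> walk d -> nat),
    finitary_interlacement u T P FI ->
    {ae P, forall omega, ~ percolates (FI omega)}.

Definition Tc_minus (u : R) : \bar R :=
  ereal_sup [set T0%:E | T0 in [set T0 : R | 0 < T0 /\
    forall T : R, 0 < T -> T < T0 -> FI_as_not_percolates u T]].

Definition Tc_plus (u : R) : \bar R :=
  ereal_inf [set T0%:E | T0 in [set T0 : R | 0 < T0 /\
    forall T : R, T0 < T -> FI_as_percolates u T]].

End FinitaryInterlacements.

(* Main.v *)
(* Up to walks of length 0, which open no edge, FI^{u,T} is a field of independent
   occupation variables indexed by the countably many walks. Percolation is insensitive to
   finitely many of them, hence has probability 0 or 1. The intensity of a walk of length k is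
   proportional to T^k / (T+1)^(k+2), which for every k >= 1 increases in T on (0, 1/2]; so
   percolation is monotone in T there, and it is enough to show that for large u percolation
   occurs for every T >= 1/2.
   For this, consider edges in a quadrant of a coordinate plane. If there is no percolation,
   closed edges form chains around arbitrarily large boxes. Such a chain, at scale 16^n,
   contains one of at most C^(2^n) families of 2^n edges that are spread out like a dyadic tree.
   By transience, the walks crossing two distant edges are few, so the second moment method
   bounds below by c u 2^n the intensity of the walks crossing such a family, uniformly in
   T >= 1/2. Hence all its edges are closed with probability at most exp(- c u 2^n), which beats
   the entropy C^(2^n) when u is large. *)

From Pilot Require Import Defs.
From mathcomp Require Import all_boot all_order all_algebra.
From mathcomp Require Import all_classical all_reals all_analysis.
From mathcomp Require Import measurable_realfun.
From mathcomp Require Import ring lra zify.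
From Stdlib Require Import Relation_Operators Operators_Properties.
Import Pilot.Defs.

Set Implicit Arguments.
Unset Strict Implicit.
Unset Printing Implicit Defensive.

Import Order.TTheory GRing.Theory Num.Theory.
Import numFieldNormedType.Exports.

Local Open Scope ring_scope.

(** * Heat kernel and Green function of simple random walk *)

(** Two points lie behind the last parts of the proof. The almost sure statements quantify over all
    realizations and would hold vacuously if there were none: hence the construction of Poisson
    point processes and of a coupling from a uniform variable. And [Tc_minus] is the supremum of a
    set that has to be shown nonempty, for otherwise it would be [-oo]: hence a separate proof that
    small T does not percolate, by counting chains of walks according to their total length.

    Working in a quadrant instead of the plane makes a contour start on an axis, so that scale n
    leaves at most 16^(n+1) choices for its first edge. The number 16 comes from the Green function:
    the bound used is of order r^(-1/2), which is 4^(-n) at distance r = 16^n. The 4^n pairs of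
    edges between the two halves of a dyadic family then contribute a bounded amount, and the sum
    over all pairs grows only like the number of edges. *)

Section CentralBinomial.
Local Open Scope nat_scope.

Lemma bin_le_succ m j : j.*2.+1 <= m -> 'C(m, j) <= 'C(m, j.+1).
Proof.
move=> jm; have := mul_bin_left m j.
have : 0 < j.+1 by [].
have : j.+1 <= m - j by lia.
nia.
Qed.

Lemma bin_le_half m j : 'C(m, j) <= 'C(m, m./2).
Proof.
have H a : a <= m./2 -> 'C(m, a) <= 'C(m, m./2).
  elim: (m./2 - a) {-2}a (erefl (m./2 - a)) => [|n IH] b e bm.
    by have -> : b = m./2 by lia.
  apply: leq_trans (bin_le_succ _) (IH b.+1 _ _); lia.
have [jm|jm] := leqP j m./2; first exact: H.
have [mj|mj] := ltnP m j; first by rewrite bin_small.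
rewrite -bin_sub //; apply: H; lia.
Qed.

(** This is ['C(2n, n) / 4^n <= (2n+1)^(-1/2)] without square roots. The induction step rests on
    [(n+1) 'C(2n+2, n+1) = 2 (2n+1) 'C(2n, n)] and [(2n+1) (2n+3) <= 4 (n+1)^2]. *)
Lemma bin_central_even n : 'C(n.*2, n) ^ 2 * n.*2.+1 <= 4 ^ n.*2.
Proof.
elim: n => [|n IH]; first by [].
have e1 : n.+1 * 'C(n.+1.*2, n.+1) = (n.*2.+1).*2 * 'C(n.*2, n).
  have h := mul_bin_diag n.*2.+1 n; rewrite /= in h.
  have h' : 'C(n.*2.+1, n.+1) = 'C(n.*2.+1, n).
    by rewrite -bin_sub; [congr 'C(_, _)|]; lia.
  by rewrite doubleS binS h'; rewrite h' in h; lia.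
have : (n.+1 * 'C(n.+1.*2, n.+1)) ^ 2 * n.+1.*2.+1 <= n.+1 ^ 2 * 4 ^ n.+1.*2.
  rewrite e1 doubleS !expnS; move: IH.
  set C := 'C(_, _); set q := 4 ^ _ => IH.
  have : 4 * ((n.*2.+1) * n.*2.+3) <= 4 * (4 * (n.+1 * n.+1)) by nia.
  nia.
rewrite expnMn -mulnA leq_pmul2l //.
Qed.

Lemma bin_sqr_bound m j : 'C(m, j) ^ 2 * m.+1 <= 4 ^ m.
Proof.
apply: (@leq_trans ('C(m, m./2) ^ 2 * m.+1)).
  by rewrite leq_mul2r leq_exp2r // bin_le_half orbT.
have e := odd_double_half m; case: (odd m) e => /= e; last first.
  by rewrite -{1 3 4}e add0n bin_central_even.
set n := m./2 in e *.
(* For odd [m = 2n+1] the middle coefficient is half of the central one of row [m+1]. *)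
have h := bin_central_even n.+1.
have e2 : 'C(n.+1.*2, n.+1) = 2 * 'C(m, n).
  rewrite -e doubleS /= add1n binS.
  have -> : 'C(n.*2.+1, n.+1) = 'C(n.*2.+1, n) by rewrite -bin_sub; [congr 'C(_, _)|]; lia.
  by rewrite mul2n addnn.
move: h; rewrite e2 -e doubleS add1n !expnS !expn0; nia.
Qed.
End CentralBinomial.

Section SimpleRandomWalkOnZ.
Variable R : rcfType.

Fixpoint srw1_pmf (m : nat) (a : int) : R :=
  if m is m'.+1 then (srw1_pmf m' (a - 1) + srw1_pmf m' (a + 1)) / 2
  else (a == 0)%:R.

Lemma srw1_pmf_bin m a : srw1_pmf m a = 
  (if (a + m%:Z)%R is Posz n then (if odd n then 0 else 'C(m, n./2))%N else 0%N)%:R / 2 ^+ m.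
Proof.
elim: m a => [|m IH] a /=.
  rewrite addr0 expr0 divr1; case: a => [[|[|n]]|n] //=.
  by rewrite negbK; case: ifP.
rewrite !IH exprS invfM -mulrDl -natrD -mulrA [_ / 2]mulrC; congr (_ * _).
have -> : a - 1 + m%:Z = a + m.+1%:Z - 2%:Z by lia.
have -> : a + 1 + m%:Z = a + m.+1%:Z by lia.
congr (_ %:R); case: (a + _) => [[|[|n]]|n]; rewrite ?bin0 //=.
rewrite !subSS subn0.
by rewrite negbK; case: ifP => // _; rewrite binS addnC.
Qed.

Lemma srw1_pmf_ge0 m a : 0 <= srw1_pmf m a.
Proof. by elim: m a => [|m IH] a /=; rewrite ?ler0n // divr_ge0 // addr_ge0. Qed.

Lemma srw1_pmf_sqr m a : srw1_pmf m a ^+ 2 <= (m.+1%:R)^-1.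
Proof.
rewrite srw1_pmf_bin; set t := (X in X%:R).
have H : (t ^ 2 * m.+1 <= 4 ^ m)%N.
  by rewrite /t; case: (a + _) => [n|n] //; case: ifP => // _; exact: bin_sqr_bound.
rewrite expr_div_n -exprM mulnC exprM ler_pdivrMr ?exprn_gt0 // ler_pdivlMl ?ltr0n //.
have -> : (2 : R) ^+ 2 = 4%:R by rewrite expr2 -natrM.
by rewrite -!natrX -natrM ler_nat mulnC.
Qed.

Lemma srw1_pmf_le1 m a : srw1_pmf m a ^+ 2 <= 1.
Proof. by apply: le_trans (srw1_pmf_sqr m a) _; rewrite invf_le1 ?ler1n ?ltr0n. Qed.

End SimpleRandomWalkOnZ.

Section MultinomialSum.
Variables (R : rcfType) (d : nat).
Implicit Types (c : {ffun 'I_d -> nat}) (g h : {ffun 'I_d -> nat} -> R).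

Definition inc_at (j : 'I_d) c : {ffun 'I_d -> nat} := [ffun i => c i + (i == j)]%N.
Definition dec_at (j : 'I_d) c : {ffun 'I_d -> nat} := [ffun i => c i - (i == j)]%N.

(* The sum of [g] over the letter counts of all words of length [k] in [d] letters. *)
Fixpoint word_sum (k : nat) g : R :=
  if k is k'.+1 then \sum_j word_sum k' (fun c => g (inc_at j c)) else g [ffun => 0%N].

Lemma eq_word_sum k g h : g =1 h -> word_sum k g = word_sum k h.
Proof. by elim: k g h => [|k IH] g h gh //=; apply: eq_bigr => j _; apply: IH => c. Qed.

Lemma word_sumD k g h : word_sum k (fun c => g c + h c) = word_sum k g + word_sum k h.
Proof. by elim: k g h => [|k IH] g h //=; rewrite -big_split; apply: eq_bigr => j _; exact: IH. Qed.

Lemma word_sumZ k a g : word_sum k (fun c => a * g c) = a * word_sum k g.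
Proof. by elim: k g => [|k IH] g //=; rewrite mulr_sumr; apply: eq_bigr => j _; exact: IH. Qed.

Lemma le_word_sum k g h : (forall c, g c <= h c) -> word_sum k g <= word_sum k h.
Proof. by elim: k g h => [|k IH] g h gh //=; apply: ler_sum => j _; apply: IH => c. Qed.

Lemma word_sum_const k a : word_sum k (fun=> a) = d%:R ^+ k * a.
Proof.
elim: k => [|k IH] /=; first by rewrite expr0 mul1r.
by rewrite IH sumr_const card_ord -[LHS]mulr_natl mulrA -exprS.
Qed.

(* Both sides count words of length [k.+1] with a marked occurrence of the letter [i]. *)
Lemma word_sum_insert k i g :
  k.+1%:R * word_sum k g = word_sum k.+1 (fun c => (c i)%:R * g (dec_at i c)).
Proof.
have decinc c : dec_at i (inc_at i c) = c by apply/ffunP => j; rewrite !ffunE addnK.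
elim: k g => [|k IH] g.
  rewrite /= mul1r (bigD1 i) //= big1 => [|j ji]; last first.
    by rewrite !ffunE eq_sym (negbTE ji) mul0r.
  by rewrite decinc !ffunE eqxx mul1r addr0.
rewrite -[RHS]/(\sum_j word_sum k.+1 (fun c => (inc_at j c i)%:R * g (dec_at i (inc_at j c)))).
have -> : k.+2%:R * word_sum k.+1 g =
    word_sum k.+1 g + \sum_j k.+1%:R * word_sum k (fun c => g (inc_at j c)).
  by rewrite -mulr_sumr mulrSr mulrDl mul1r addrC.
rewrite [RHS](bigD1 i) //= [X in _ + X](bigD1 i) //= addrA; congr (_ + _).
  rewrite IH /= -big_split /=; apply: eq_bigr => j _; rewrite -word_sumD; apply: eq_word_sum => c.
  rewrite decinc; have -> : inc_at i (inc_at j c) i = (inc_at j c i + 1)%N by rewrite [LHS]ffunE eqxx.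
  rewrite natrD mulrDl mul1r addrC; congr (_ + _).
  have [->|c0] := eqVneq (inc_at j c i) 0%N; first by rewrite !mul0r.
  congr (_ * g _); apply/ffunP => l; rewrite !ffunE.
  by case: (eqVneq l i) => [->|_]; rewrite ?subn0 ?addn0 // subnK // lt0n; rewrite ffunE in c0.
apply: eq_bigr => j ji; rewrite IH /=; apply: eq_bigr => l _; apply: eq_word_sum => c.
have ij : (i == j) = false by rewrite eq_sym; apply/negbTE.
rewrite !ffunE ij addn0; have [->|c0] := posnP (c i + (i == l))%N; first by rewrite !mul0r.
congr (_ * g _); apply/ffunP => b; rewrite !ffunE.
by case: (eqVneq b i) => [->|bi]; rewrite ?ij ?subn0 ?addn0.
Qed.

(** By [word_sum_insert] the factor [(c i).+1] cancels against the number of marked occurrences of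
    [i]; only the words of length [k.+1] without [i] are lost, whence an inequality. *)
Lemma word_sum_div k i h : (forall c, 0 <= h c) -> (forall c, h (dec_at i c) = h c) ->
  word_sum k (fun c => h c / (c i).+1%:R) <= word_sum k.+1 h / k.+1%:R.
Proof.
move=> h0 hi; rewrite ler_pdivlMr ?ltr0n // mulrC (word_sum_insert k i).
apply: le_word_sum => c; rewrite hi ffunE eqxx.
case: (c i) => [|m]; first by rewrite mul0r.
by rewrite subn1 /= mulrCA divff ?mulr1 // pnatr_eq0.
Qed.

(** Each of the three letters gains a factor [d / (k+1)]; this is where dimension three enters the
    heat kernel bound. *)
Lemma word_sum_div3 k (i1 i2 i3 : 'I_d) : uniq [:: i1; i2; i3] ->
  word_sum k (fun c => (c i1).+1%:R^-1 / (c i2).+1%:R / (c i3).+1%:R) <=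
  d%:R ^+ (k + 3) / k.+1%:R ^+ 3.
Proof.
rewrite /= !inE negb_or andbT => /andP[/andP[n12 n13] n23].
have dec_neq (i j : 'I_d) c : j != i -> dec_at i c j = c j.
  by move=> ji; rewrite ffunE (negbTE ji) subn0.
apply: le_trans (word_sum_div _ _ _) _.
- by move=> c; rewrite mulr_ge0 ?invr_ge0.
- by move=> c; rewrite !dec_neq.
have kle (j : nat) : (k.+1%:R : R) <= (k.+1 + j)%:R by rewrite ler_nat leq_addr.
have k0 (j : nat) : (0 : R) < (j.+1)%:R by rewrite ltr0n.
have step (x y : R) j : 0 <= y -> x <= y / (k.+1 + j)%:R -> x <= y / k.+1%:R.
  move=> y0 /le_trans; apply; rewrite ler_wpM2l // lef_pV2 ?kle // posrE ?ltr0n //.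
rewrite [_ ^+ 3]exprS invfM [k.+1%:R^-1 * _]mulrC mulrA ler_wpM2r ?invr_ge0 //.
have H1 : word_sum k.+1 (fun c => (c i1).+1%:R^-1 / (c i2).+1%:R) <=
    word_sum k.+2 (fun c => (c i1).+1%:R^-1) / k.+1%:R.
  apply: (step _ _ 1%N).
    by rewrite -(mulr0 (d%:R ^+ k.+2)) -word_sum_const; apply: le_word_sum => c; rewrite invr_ge0.
  by rewrite addn1; apply: word_sum_div => c; rewrite ?invr_ge0 // !dec_neq.
apply: le_trans H1 _; rewrite [_ ^+ 2]exprS expr1 invfM [k.+1%:R^-1 * _]mulrC mulrA ler_wpM2r ?invr_ge0 //.
apply: (step _ _ 2%N); first by rewrite exprn_ge0.
have -> : word_sum k.+2 (fun c => (c i1).+1%:R^-1) = word_sum k.+2 (fun c => 1 / (c i1).+1%:R).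
  by apply: eq_word_sum => c; rewrite mul1r.
apply: le_trans (word_sum_div _ _ _) _ => //.
by rewrite word_sum_const mulr1 addn2 addn3.
Qed.
End MultinomialSum.

Section HeatKernel.
Variables (R : rcfType) (d : nat).

Definition unit_step (i : 'I_d) : 'rV[int]_d := delta_mx ord0 i.

Fixpoint srw_pmf (l : nat) (z : 'rV[int]_d) : R :=
  if l is l'.+1 then
    (\sum_i (srw_pmf l' (z - unit_step i) + srw_pmf l' (z + unit_step i))) / (2 * d)%:R
  else (z == 0)%:R.

Lemma srw_pmf_ge0 l z : 0 <= srw_pmf l z.
Proof.
elim: l z => [|l IH] z /=; first exact: ler0n.
by rewrite mulr_ge0 ?invr_ge0 // sumr_ge0 // => i _; rewrite addr_ge0.
Qed.

Lemma srw_pmf_support l (z : 'rV[int]_d) i : (l < `|z ord0 i|)%N -> srw_pmf l z = 0.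
Proof.
elim: l z => [|l IH] z h /=; first by case: eqP => // e; rewrite e mxE in h.
rewrite big1 ?mul0r // => j _; rewrite !IH ?addr0 // !mxE;
  case: (_ && _) => /=; lia.
Qed.

(* The word of a path records the coordinate direction of each step; given the word, the
   coordinates are independent walks on Z. *)
Lemma srw_pmf_word_sum l (z : 'rV[int]_d) : (0 < d)%N ->
  d%:R ^+ l * srw_pmf l z = word_sum l (fun c => \prod_i srw1_pmf R (c i) (z ord0 i)).
Proof.
move=> d0; have dN0 : (d%:R : R) != 0 by rewrite pnatr_eq0 -lt0n.
elim: l z => [|l IH] z.
  rewrite /= expr0 mul1r; under eq_bigr do rewrite ffunE /=.
  rewrite -natr_prod; congr _%:R; case: eqP => [->|zn0].
    by rewrite big1 // => i _; rewrite mxE.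
  have [i zi] : exists i, z ord0 i != 0.
    apply/existsP; rewrite -negb_forall; apply: contra_notN zn0 => /forallP h.
    by apply/rowP => i; rewrite mxE; apply/eqP.
  by rewrite (bigD1 i) //= (negbTE zi).
rewrite [srw_pmf _ _]/= [word_sum _ _]/= exprS natrM invfM.
have -> : d%:R * d%:R ^+ l * ((\sum_i (srw_pmf l (z - unit_step i) + srw_pmf l (z + unit_step i))) *
     (2^-1 / d%:R)) = \sum_i (d%:R ^+ l * srw_pmf l (z - unit_step i) +
       d%:R ^+ l * srw_pmf l (z + unit_step i)) / 2.
  under [RHS]eq_bigr do rewrite -mulrDr -mulrA.
  by rewrite -mulr_sumr -mulr_suml; field.
apply: eq_bigr => j _; rewrite !IH -word_sumD mulrC -word_sumZ; apply: eq_word_sum => c.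
rewrite (bigD1 j) //= [X in _ + X](bigD1 j) //= [RHS](bigD1 j) //=.
have E (s : int) : \prod_(i < d | i != j) srw1_pmf R (c i) ((z + s *: unit_step j) ord0 i) =
     \prod_(i < d | i != j) srw1_pmf R (inc_at j c i) (z ord0 i).
  apply: eq_bigr => i ij; rewrite ffunE (negbTE ij) addn0 !mxE (negbTE ij) andbF.
  by rewrite mulr0 addr0.
have := E 1; have := E (-1); rewrite scaleN1r scale1r => -> ->.
rewrite -mulrDl mulrA; congr (_ * _).
by rewrite ffunE eqxx addn1 /= !mxE !eqxx mulrC.
Qed.

Definition heat_const : R := (1 + d%:R ^+ 3) / 2.

Lemma heat_const_gt0 : 0 < heat_const.
Proof. by rewrite divr_gt0 // ltr_pwDl // exprn_ge0. Qed.

(** Given the word, the probability [Q c] is a product over coordinates; keeping three of them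
    bounds [Q c ^+ 2] by inverse letter counts, whose average [word_sum_div3] controls. The AM-GM
    inequality with weight [s = (l+1)^(3/2)] passes from the average of [Q ^+ 2], at most
    [d^3 / s^2], to that of [Q]; hence the constant [(1 + d^3) / 2]. *)
Lemma srw_pmf_bound l z : (3 <= d)%N ->
  srw_pmf l z <= heat_const / (l.+1%:R * Num.sqrt l.+1%:R).
Proof.
move=> d3; have d0 : (0 : R) < d%:R by rewrite ltr0n; lia.
have i1 := Ordinal (leq_trans (isT : 0 < 3)%N d3).
set j1 : 'I_d := Ordinal (leq_trans (isT : 0 < 3)%N d3).
set j2 : 'I_d := Ordinal (leq_trans (isT : 1 < 3)%N d3).
set j3 : 'I_d := Ordinal (leq_trans (isT : 2 < 3)%N d3).
have uj : uniq [:: j1; j2; j3] by [].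
set s := l.+1%:R * Num.sqrt l.+1%:R.
have s0 : 0 < s by rewrite mulr_gt0 ?sqrtr_gt0 ?ltr0n.
have s2 : s ^+ 2 = l.+1%:R ^+ 3 by rewrite exprMn sqr_sqrtr ?ler0n // -exprSr.
set Q := fun c : {ffun 'I_d -> nat} => \prod_i srw1_pmf R (c i) (z ord0 i).
have Q0 c : 0 <= Q c by apply: prodr_ge0 => i _; exact: srw1_pmf_ge0.
have Q2 c : Q c ^+ 2 <= (c j1).+1%:R^-1 / (c j2).+1%:R / (c j3).+1%:R.
  have key (a b e p x y t : R) : 0 <= a -> 0 <= b -> 0 <= e -> 0 <= p -> a <= x -> b <= y ->
      e <= t -> p <= 1 -> a * (b * (e * p)) <= x * y * t.
    move=> a0 b0 e0 p0 ax by_ et p1; rewrite mulrA; apply: ler_pM; rewrite ?mulr_ge0 //.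
      exact: ler_pM.
    by rewrite -[leRHS]mulr1 ler_pM.
  rewrite /Q -prodrXl (bigD1 j1) //= (bigD1 j2) //= (bigD1 j3) //=.
  apply: key; rewrite ?sqr_ge0 ?srw1_pmf_sqr //.
    by apply: prodr_ge0 => i _; rewrite sqr_ge0.
  by apply: prodr_ile1 => i _; rewrite sqr_ge0 srw1_pmf_le1.
have amgm c : Q c <= (s^-1 + s * Q c ^+ 2) / 2.
  have : 0 <= (1 - s * Q c) ^+ 2 / (2 * s) by rewrite divr_ge0 ?sqr_ge0 // mulr_ge0 // ltW.
  have -> : (1 - s * Q c) ^+ 2 / (2 * s) = (s^-1 + s * Q c ^+ 2) / 2 - Q c.
    by field; rewrite gt_eqF.
  by rewrite subr_ge0.
have B := word_sum_div3 R l uj.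
have A : word_sum l Q <= (d%:R ^+ l / s + s * (d%:R ^+ (l + 3) / s ^+ 2)) / 2.
  apply: le_trans (le_word_sum _ amgm) _.
  have -> : word_sum l (fun c => (s^-1 + s * Q c ^+ 2) / 2) =
      (d%:R ^+ l / s + s * word_sum l (fun c => Q c ^+ 2)) / 2.
    rewrite -word_sum_const -word_sumZ -word_sumD mulrC -word_sumZ.
    by apply: eq_word_sum => c; rewrite mulrC.
  rewrite ler_wpM2r ?invr_ge0 // lerD2l ler_wpM2l ?(ltW s0) //.
  by rewrite s2; apply: le_trans B; exact: le_word_sum.
rewrite -(ler_pM2l (exprn_gt0 l d0)) srw_pmf_word_sum ?(leq_trans _ d3) //.
apply: le_trans A _; rewrite le_eqVlt; apply/orP; left; apply/eqP.
by rewrite exprD /heat_const; field; rewrite gt_eqF.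
Qed.

(** Comparison with the telescoping sum of [2 / sqrt m - 2 / sqrt (m+1)]. *)
Lemma sum_inv_pow32 (r n : nat) : (0 < r)%N ->
  \sum_(r <= m < n) (m.+1%:R * Num.sqrt m.+1%:R)^-1 <= 2 / Num.sqrt r%:R :> R.
Proof.
move=> r0; have [nr|rn] := leqP n r; first by rewrite big_geq // divr_ge0 // sqrtr_ge0.
suff: \sum_(r <= m < n) (m.+1%:R * Num.sqrt m.+1%:R)^-1 <=
   2 / Num.sqrt r%:R - 2 / Num.sqrt n%:R :> R.
  by move/le_trans; apply; rewrite lerBlDr lerDl divr_ge0 // sqrtr_ge0.
have -> : 2 / Num.sqrt r%:R - 2 / Num.sqrt n%:R =
   \sum_(r <= m < n) (2 / Num.sqrt m%:R - 2 / Num.sqrt m.+1%:R) :> R.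
  rewrite -[LHS]opprB -(telescope_sumr (fun m : nat => 2 / Num.sqrt m%:R : R)) 1?ltnW //.
  by rewrite -sumrN; apply: eq_bigr => m _; rewrite opprB.
rewrite !big_nat; apply: ler_sum => m /andP[rm _].
have m0 : (0 : R) < m%:R by rewrite ltr0n; lia.
set a := Num.sqrt (m%:R : R); set b := Num.sqrt (m.+1%:R : R).
have a0 : 0 < a by rewrite sqrtr_gt0.
have ab : a <= b by rewrite ler_sqrt ?ler_nat ?ler0n.
have b0 : 0 < b := lt_le_trans a0 ab.
have a2 : a ^+ 2 = m%:R by rewrite sqr_sqrtr ?ler0n.
have b2 : b ^+ 2 = m.+1%:R by rewrite sqr_sqrtr ?ler0n.
have ba : (b - a) * (b + a) = 1.
  by rewrite -subr_sqr a2 b2 -natrB ?subSnn.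
rewrite -b2; have -> : 2 / a - 2 / b = 2 * (b - a) / (a * b).
  by field; rewrite !gt_eqF.
rewrite ler_pdivlMr ?mulr_gt0 // ler_pdivrMl ?mulr_gt0 ?exprn_gt0 //.
have h1 : 1 <= 2 * b * (b - a) by rewrite -ba; have := sqr_ge0 (b - a); nra.
apply: (@le_trans _ _ (b * b)); first by rewrite ler_pM2r.
have -> : b ^+ 2 * b * (2 * (b - a)) = b * b * (2 * b * (b - a)) by ring.
by rewrite -[leLHS]mulr1 ler_wpM2l ?mulr_ge0 // ltW.
Qed.

(** One [heat_const] for time 0 and two for the tail, bounded by [sum_inv_pow32] with [r = 1]. *)
Definition green_const : R := 3 * heat_const.

Lemma green_bound n z : (3 <= d)%N -> \sum_(0 <= m < n) srw_pmf m z <= green_const.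
Proof.
move=> d3; have h0 : 0 < heat_const := heat_const_gt0; case: n => [|n]; first by rewrite big_geq // mulr_ge0 // ltW.
have -> : green_const = heat_const / (1%:R * Num.sqrt 1%:R) + heat_const * (2 / Num.sqrt 1%:R).
  by rewrite sqrtr1 /green_const; field.
rewrite big_nat_recl //; apply: lerD; first exact: (srw_pmf_bound 0 z d3).
apply: le_trans (_ : heat_const * \sum_(1 <= m < n.+1) (m.+1%:R * Num.sqrt m.+1%:R)^-1 <= _).
  rewrite mulr_sumr big_add1 /=; apply: ler_sum => i _; exact: (srw_pmf_bound i.+1 z d3).
by rewrite ler_wpM2l ?(ltW h0) // sum_inv_pow32.
Qed.

(** The only input besides the heat kernel bound is that [r] steps are needed to travel a distance
    [r]. The resulting rate [r^(-1/2)] is weaker than the true one but suffices for families of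
    scale ratio 16. *)
Lemma green_decay n (z : 'rV[int]_d) i r : (3 <= d)%N -> (0 < r)%N -> (r <= `|z ord0 i|)%N ->
  \sum_(0 <= m < n) srw_pmf m z <= green_const / Num.sqrt r%:R.
Proof.
move=> d3 r0 rz; have h0 := heat_const_gt0.
apply: le_trans (_ : heat_const * \sum_(r <= m < n) (m.+1%:R * Num.sqrt m.+1%:R)^-1 <= _); last first.
  apply: le_trans (ler_wpM2l (ltW h0) (sum_inv_pow32 _ r0)) _.
  rewrite mulrA ler_wpM2r ?invr_ge0 ?sqrtr_ge0 // /green_const; lra.
have [nr|rn] := leqP n r.
  rewrite [X in _ * X]big_geq // mulr0 big_nat big1 // => m /andP[_ mn].
  by rewrite (@srw_pmf_support _ _ i) // (leq_trans _ rz) // (leq_trans mn).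
rewrite (big_cat_nat (n := r)) //= 1?ltnW // big_nat big1 ?add0r; last first.
  by move=> m /andP[_ mr]; rewrite (@srw_pmf_support _ _ i) // (leq_trans mr).
by rewrite mulr_sumr; apply: ler_sum => m _; exact: srw_pmf_bound.
Qed.
End HeatKernel.

(** * Walks crossing a given family of edges *)

Section StepWords.
Variable d : nat.
Implicit Types (x y z : lattice d).

Definition steps : seq (lattice d) :=
  [seq unit_step i | i <- enum 'I_d] ++ [seq - unit_step i | i <- enum 'I_d].

Lemma size_steps : size steps = (2 * d)%N.
Proof.
have H (f : 'I_d -> lattice d) : size [seq f i | i <- enum 'I_d] = d.
  by rewrite size_map size_enum_ord.
by rewrite /steps size_cat !H mul2n addnn.
Qed.

Lemma unit_step_inj : injective (@unit_step d).
Proof.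
move=> i j /rowP/(_ i); rewrite !mxE eqxx /= => /eqP.
by case: (eqVneq i j) => [-> //|_]; rewrite oner_eq0.
Qed.

Lemma uniq_steps : uniq steps.
Proof.
have u (f : 'I_d -> lattice d) : injective f -> uniq [seq f i | i <- enum 'I_d].
  by move=> fi; rewrite map_inj_uniq // enum_uniq.
rewrite cat_uniq (u _ unit_step_inj) (u (fun i => - unit_step i)) ?andbT /=.
  apply/hasPn => x /mapP[i _ ->]; apply/negP => /mapP[j _] /rowP/(_ i).
  by rewrite !mxE !eqxx /=; case: (_ == _).
by move=> i j /oppr_inj; exact: unit_step_inj.
Qed.

Lemma adj_sym x y : adj x y = adj y x.
Proof. by rewrite /adj; congr (_ == _); apply: eq_bigr => i _; rewrite -sqrrN opprB. Qed.

Lemma adj_steps x y : adj x y = (y - x \in steps).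
Proof.
rewrite adj_sym /adj.
have -> : \sum_(i < d) (y ord0 i - x ord0 i) ^+ 2 = \sum_(i < d) (y - x) ord0 i ^+ 2.
  by apply: eq_bigr => i _; rewrite !mxE.
move: (y - x) => z; apply/eqP/idP => [h|].
  have [i zi] : exists i, z ord0 i != 0.
    apply/existsP; rewrite -negb_forall; apply/negP => /forallP z0; move: h.
    by rewrite big1 // => i _; rewrite (eqP (z0 i)).
  have r0 : 0 <= \sum_(j < d | j != i) z ord0 j ^+ 2 by apply: sumr_ge0 => j _; exact: sqr_ge0.
  have zi2 : 1 <= z ord0 i ^+ 2 by rewrite -gtz0_ge1 lt0r sqrf_eq0 zi sqr_ge0.
  move: h; rewrite (bigD1 i) //= => h.
  have e0 : \sum_(j < d | j != i) z ord0 j ^+ 2 = 0.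
    by move: r0 zi2 h; move: (\sum_(j < d | j != i) _) (z ord0 i ^+ 2) => A B; lia.
  have ei : z ord0 i ^+ 2 = 1 by rewrite e0 addr0 in h.
  have zj j : j != i -> z ord0 j = 0.
    move=> ji; apply/eqP; rewrite -sqrf_eq0; apply/eqP.
    by apply: (psumr_eq0P _ e0) => // l _; exact: sqr_ge0.
  rewrite mem_cat; move/eqP: ei; rewrite sqrf_eq1 => /orP[]/eqP ei; apply/orP.
    left; apply/mapP; exists i; rewrite ?mem_enum //; apply/rowP => j; rewrite !mxE /=.
    by case: eqVneq => [->|/zj].
  right; apply/mapP; exists i; rewrite ?mem_enum //; apply/rowP => j; rewrite !mxE /=.
  by case: eqVneq => [->|/zj ->].
have H i : \sum_(j < d) (unit_step i ord0 j) ^+ 2 = 1 :> int.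
  by rewrite (bigD1 i) //= big1 => [|j ji]; rewrite mxE ?eqxx ?addr0 //= (negbTE ji).
rewrite mem_cat => /orP[]/mapP[i _ ->]; first exact: H.
by rewrite -[RHS](H i); apply: eq_bigr => j _; rewrite mxE sqrrN.
Qed.

Fixpoint words (k : nat) : seq (seq (lattice d)) :=
  if k is k'.+1 then [seq s :: t | s <- steps, t <- words k'] else [:: [::]].

Lemma size_words k : size (words k) = ((2 * d) ^ k)%N.
Proof. by elim: k => //= k IH; rewrite size_allpairs IH size_steps expnS. Qed.

Lemma uniq_words k : uniq (words k).
Proof.
elim: k => //= k IH; apply: allpairs_uniq => //; first exact: uniq_steps.
by move=> [a s] [b t] _ _ [-> ->].
Qed.

Lemma words_size k s : s \in words k -> size s = k.
Proof. by elim: k s => [|k IH] s; [rewrite inE => /eqP-> | move=> /allpairsP[p [_ /IH <- ->]]]. Qed.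

Lemma words_path k s x : s \in words k -> path (@adj d) x (scanl +%R x s).
Proof.
elim: k s x => [|k IH] s x; first by rewrite inE => /eqP->.
move=> /allpairsP[[a t] /= [a1 t1 ->]] /=; rewrite (IH t) // andbT.
by rewrite adj_steps addrAC subrr add0r.
Qed.

Lemma scanl_inj x : injective (scanl +%R x : seq (lattice d) -> seq (lattice d)).
Proof.
move=> s; elim: s x => [|a s IH] x [|b t] //= [/addrI ab]; rewrite ab => /IH -> //.
Qed.

Variable R : rcfType.

Lemma sum_words_visit n l x y : (l <= n)%N -> (0 < d)%N ->
  \sum_(s <- words n) (nth x (x :: scanl +%R x s) l == y)%:R =
  (2 * d)%:R ^+ n * srw_pmf R l (y - x).
Proof.
move=> ln d0; have H x' m : \sum_(s <- words m) (x' == y)%:R = (2 * d)%:R ^+ m * (y - x' == 0)%:R :> R.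
  rewrite big_const_seq count_predT iter_addr_0 size_words -[LHS]mulr_natl natrX.
  by rewrite subr_eq0 eq_sym.
have nthE (v : lattice d) s i x' : (i <= size s)%N ->
    nth v (x' :: scanl +%R x' s) i = nth x' (x' :: scanl +%R x' s) i.
  by move=> h; apply: set_nth_default; rewrite /= size_scanl.
elim: n l x ln => [|n IH] [|l] x ln //; try exact: H.
rewrite [words _]/= big_allpairs_dep /=.
under eq_bigr => a _.
  rewrite big_seq (eq_bigr (fun s => (nth (x + a) (x + a :: scanl +%R (x + a) s) l == y)%:R)).
    by rewrite -big_seq IH //; over.
  by move=> s /words_size sn; rewrite nthE ?sn.
have d2 : (2 * d)%:R != 0 :> R by rewrite pnatr_eq0; lia.
rewrite -mulr_sumr exprS -mulrA [in RHS]mulrCA; congr (_ * _); rewrite [in RHS]mulrC mulfVK //.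
rewrite big_cat (big_map (@unit_step d)) (big_map (fun i => - unit_step i)) !big_enum /=.
rewrite -big_split; apply: eq_bigr => i _ /=.
by rewrite !opprD !addrA opprK.
Qed.

End StepWords.

Lemma sum_undup (R : realDomainType) (T : eqType) (r : seq T) (F : T -> R) :
  \sum_(t <- r) F t = \sum_(t <- undup r) (count_mem t r)%:R * F t.
Proof.
rewrite -big_undup_iterop_count; apply: eq_bigr => t _.
by rewrite Monoid.iteropE iter_addr_0 mulr_natl.
Qed.

(* Second moment method: [1 >= 1 - (1 - a c)^2] for the size [c] of a fibre of [phi]. *)
Lemma size_undup_map (R : realDomainType) (I : Type) (T : eqType) (r : seq I) (phi : I -> T) (a : R) :
  \sum_(m <- r) (2 * a - a ^+ 2 * (count_mem (phi m) (map phi r))%:R) <=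
  (size (undup (map phi r)))%:R.
Proof.
rewrite -(big_map phi xpredT (fun t => 2 * a - a ^+ 2 * (count_mem t (map phi r))%:R)).
rewrite sum_undup -sum1_size natr_sum; apply: ler_sum => t _.
set c := _%:R; rewrite -subr_ge0.
have -> : 1 - c * (2 * a - a ^+ 2 * c) = (1 - a * c) ^+ 2 by ring.
exact: sqr_ge0.
Qed.

Section MarkedWalks.
Variable d : nat.
Hypothesis d0 : (0 < d)%N.
Variable R : rcfType.
Notation edge := (lattice d * lattice d)%type.
Implicit Types (e f : edge) (s t : seq (lattice d)).

(* The vertices of a walk crossing [e], given by its steps after [e], and its steps before [e]
   in reversed time. *)
Definition marked_vertices (m : edge * (seq (lattice d) * seq (lattice d))) : seq (lattice d) :=
  let: (e, (s, t)) := m in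
  rev (e.1 :: scanl +%R e.1 s) ++ e.2 :: scanl +%R e.2 t.

(** One entry for each edge, crossing position [i] and pair of step words, so that a walk is listed
    once per crossing. This multiplicity is what the second moment has to control. *)
Definition marks (K : seq edge) (k : nat) :=
  [seq (e, st) | e <- K, st <- flatten [seq [seq (s, t) | s <- words d i, t <- words d (k.-1 - i)] | i <- iota 0 k]].

Lemma big_marks K k (F : edge * (seq (lattice d) * seq (lattice d)) -> R) :
  \sum_(m <- marks K k) F m = \sum_(e <- K) \sum_(0 <= i < k)
    \sum_(s <- words d i) \sum_(t <- words d (k.-1 - i)) F (e, (s, t)).
Proof.
rewrite big_allpairs_dep; apply: eq_bigr => e _ /=.
rewrite big_flatten big_map /index_iota subn0; apply: eq_bigr => i _.
by rewrite big_allpairs_dep.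
Qed.

Lemma size_marks K k : ((size (marks K k))%:R : R) = (size K)%:R * k%:R * (2 * d)%:R ^+ k.-1.
Proof.
rewrite -sum1_size natr_sum big_marks.
have -> : \sum_(e <- K) \sum_(0 <= i < k) \sum_(s <- words d i) \sum_(t <- words d (k.-1 - i)) 1%:R =
    \sum_(e <- K) \sum_(0 <= i < k) (2 * d)%:R ^+ k.-1 :> R.
  apply: eq_bigr => e _; rewrite !big_nat; apply: eq_bigr => i /andP[_ ik].
  rewrite -!natr_sum !big_const_seq !count_predT !iter_addn_0 !size_words mul1n -expnD natrX.
  by rewrite subnK //; lia.
rewrite big_const_seq count_predT iter_addr_0 sumr_const_nat subn0 -[_ *+ k]mulr_natl.
by rewrite -[LHS]mulr_natl mulrA.
Qed.

Lemma size_marked e s t : size (marked_vertices (e, (s, t))) = (size s + size t).+2.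
Proof. by rewrite size_cat size_rev /= !size_scanl addnS. Qed.

Lemma nth_marked_before v e s t l : (l <= size s)%N ->
  nth v (marked_vertices (e, (s, t))) (size s - l) = nth e.1 (e.1 :: scanl +%R e.1 s) l.
Proof.
move=> ls; rewrite nth_cat size_rev /= size_scanl ltnS leq_subr nth_rev /= size_scanl; last first.
  by rewrite ltnS leq_subr.
rewrite subSS subKn //; apply: set_nth_default; rewrite /= size_scanl; lia.
Qed.

Lemma nth_marked_after v e s t l : (l <= size t)%N ->
  nth v (marked_vertices (e, (s, t))) ((size s).+1 + l) = nth e.2 (e.2 :: scanl +%R e.2 t) l.
Proof.
move=> lt; rewrite nth_cat size_rev /= size_scanl ltnNge leq_addr /= addKn.
by apply: set_nth_default; rewrite /= size_scanl; lia.
Qed.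

Lemma marked_inj e e' s s' t t' : size s = size s' ->
  marked_vertices (e, (s, t)) = marked_vertices (e', (s', t')) -> (s, t) = (s', t').
Proof.
move=> ss /eqP; rewrite eqseq_cat ?size_rev /= ?size_scanl ?ss // => /andP[/eqP h1 /eqP[h2 h3]].
move/(congr1 rev): h1; rewrite !revK => -[h4 h5]; rewrite -h4 in h5; rewrite -h2 in h3.
by rewrite (scanl_inj h5) (scanl_inj h3).
Qed.

(* [pair_weight k e f] bounds, up to the factor [(2 d) ^ (k - 1)], the number of walks of
   length [k] crossing both [e] and [f], for a given position of [e]. *)
Definition pair_weight (k : nat) (e f : edge) : R :=
  (e == f)%:R + \sum_(0 <= l < k) srw_pmf R l (f.1 - e.2) + \sum_(0 <= l < k) srw_pmf R l (f.2 - e.1).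

Lemma count_le_has (T : eqType) (p : pred T) (r : seq T) : uniq r ->
  {in r &, forall x y, p x -> p y -> x = y} -> (count p r <= has p r)%N.
Proof.
move=> ur pr; rewrite has_count -size_filter; have uf : uniq (seq.filter p r) by apply: filter_uniq.
have : {in seq.filter p r &, forall x y, x = y}.
  by move=> x y; rewrite !mem_filter => /andP[px xr] /andP[py yr]; apply: pr.
case: (seq.filter p r) uf => [|x [|y l]] //= + H.
by rewrite (H x y) ?inE ?eqxx ?orbT.
Qed.

Lemma natr_count (T : Type) (p : pred T) (r : seq T) :
  (count p r)%:R = \sum_(x <- r) (p x)%:R :> R.
Proof. by rewrite -sum1_count natr_sum big_mkcond; apply: eq_bigr => x _; case: (p x). Qed.

Definition crosses_at (V : seq (lattice d)) f j : R :=
  ((nth 0 V j == f.1) && (nth 0 V j.+1 == f.2))%:R.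

Lemma crosses_at_mark e s t : crosses_at (marked_vertices (e, (s, t))) e (size s) = 1.
Proof.
rewrite /crosses_at; have := @nth_marked_before 0 e s t 0 (leq0n _); rewrite subn0 => -> /=.
by have := @nth_marked_after 0 e s t 0 (leq0n _); rewrite addn0 => -> /=; rewrite !eqxx.
Qed.

(** Once the edge and the position of its crossing are fixed, [marked_inj] leaves at most one pair
    of step words for [V]. *)
Lemma fibre_bound K k V : (count_mem V (map marked_vertices (marks K k)))%:R <=
  \sum_(f <- K) \sum_(0 <= j < k) crosses_at V f j.
Proof.
rewrite count_map natr_count big_marks; apply: ler_sum => f _.
rewrite !big_nat; apply: ler_sum => j /andP[_ jk].
set r := [seq (s, t) | s <- words d j, t <- words d (k.-1 - j)].
set p := fun st : seq (lattice d) * seq (lattice d) => marked_vertices (f, st) == V.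
rewrite (_ : (\sum_(s <- _) _) = (count p r)%:R); last first.
  by rewrite natr_count big_allpairs_dep.
have ur : uniq r by apply: allpairs_uniq; rewrite ?uniq_words // => -[? ?] [? ?] _ _ [-> ->].
apply: (@le_trans _ _ (has p r)%:R).
  rewrite ler_nat; apply: count_le_has => // x y /allpairsP[[s t] [/= s1 t1 ->]].
  move=> /allpairsP[[s' t'] [/= s2 t2 ->]] /eqP e1 /eqP e2.
  by apply: (@marked_inj f f); rewrite ?e1 ?e2 ?(words_size s1) ?(words_size s2).
case: hasP => [[st /allpairsP[[s t] [/= s1 t1 ->]] /eqP <-]|_]; last by rewrite /crosses_at ler0n.
by rewrite -(words_size s1) crosses_at_mark.
Qed.

(** The position [size s] carries [e] itself. A later crossing of [f] makes the forward walk from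
    [e.2] visit [f.1]; an earlier one, read backwards in time, makes the walk from [e.1] visit
    [f.2]. *)
Lemma sum_crosses e f s t k : (size s + size t).+1 = k ->
  \sum_(0 <= j < k) crosses_at (marked_vertices (e, (s, t))) f j <= (e == f)%:R +
   \sum_(0 <= l < size t) (nth e.2 (e.2 :: scanl +%R e.2 t) l == f.1)%:R +
   \sum_(0 <= l < size s) (nth e.1 (e.1 :: scanl +%R e.1 s) l == f.2)%:R.
Proof.
move=> <-; set n := (size s + size t).+1; set F := crosses_at _ _.
have sn : (size s < n)%N by rewrite ltnS leq_addr.
have -> : \sum_(0 <= j < n) F j =
    F (size s) + \sum_((size s).+1 <= j < n) F j + \sum_(0 <= j < size s) F j.
  by rewrite (big_cat_nat (n := size s)) //= 1?ltnW // (big_ltn sn) addrC.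
rewrite lerD //; last first.
  rewrite big_nat_rev add0n !big_nat; apply: ler_sum => l /andP[_ ls].
  rewrite /F /crosses_at -subSn // subSS (@nth_marked_before 0 e s t l) 1?ltnW //.
  by rewrite ler_nat; case: (_ == f.1).
rewrite lerD //.
  rewrite /F /crosses_at; have := @nth_marked_before 0 e s t 0 (leq0n _); rewrite subn0 => -> /=.
  by have := @nth_marked_after 0 e s t 0 (leq0n _); rewrite addn0 => -> /=.
rewrite -{1}[(size s).+1]add0n big_addn /n -addSn addnC addnK !big_nat.
apply: ler_sum => l /andP[_ lt]; rewrite /F /crosses_at addnC (@nth_marked_after 0 e s t l) 1?ltnW //.
by rewrite ler_nat; case: (_ == f.1); rewrite //= leq_b1.
Qed.

Lemma sum_fibre (K : seq edge) (k : nat) :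
  \sum_(m <- marks K k) (count_mem (marked_vertices m) (map marked_vertices (marks K k)))%:R <=
  k%:R * (2 * d)%:R ^+ k.-1 * \sum_(e <- K) \sum_(f <- K) pair_weight k e f.
Proof.
apply: (@le_trans _ _ (\sum_(m <- marks K k) \sum_(f <- K) \sum_(0 <= j < k)
    crosses_at (marked_vertices m) f j)).
  by apply: ler_sum => m _; exact: fibre_bound.
rewrite big_marks mulr_sumr; apply: ler_sum => e _.
have -> : k%:R * (2 * d)%:R ^+ k.-1 * \sum_(f <- K) pair_weight k e f =
    \sum_(0 <= i < k) \sum_(f <- K) (2 * d)%:R ^+ k.-1 * pair_weight k e f.
  by rewrite sumr_const_nat subn0 -mulr_sumr -[RHS]mulr_natl mulrA.
rewrite !big_nat; apply: ler_sum => i /andP[_ ik].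
rewrite (eq_bigr _ (fun s _ => exchange_big _ _ _ _ _ _)) exchange_big /=.
apply: ler_sum => f _.
set Q : R := (2 * d)%:R; have Q0 : 0 <= Q by rewrite ler0n.
pose A t := \sum_(0 <= l < k.-1 - i) (nth e.2 (e.2 :: scanl +%R e.2 t) l == f.1)%:R : R.
pose B s := \sum_(0 <= l < i) (nth e.1 (e.1 :: scanl +%R e.1 s) l == f.2)%:R : R.
apply: (@le_trans _ _ (\sum_(s <- words d i) \sum_(t <- words d (k.-1 - i))
   ((e == f)%:R + A t + B s))).
  rewrite big_seq [leRHS]big_seq; apply: ler_sum => s si.
  rewrite big_seq [leRHS]big_seq; apply: ler_sum => t ti.
  have := @sum_crosses e f s t k; rewrite (words_size si) (words_size ti); apply; lia.
have W n (x : R) : \sum_(s <- words d n) x = Q ^+ n * x.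
  by rewrite big_const_seq count_predT iter_addr_0 size_words -[LHS]mulr_natl natrX.
have visit n m x y : (m <= n)%N -> (m <= k)%N ->
    \sum_(s <- words d n) \sum_(0 <= l < m) (nth x (x :: scanl +%R x s) l == y)%:R <=
    Q ^+ n * \sum_(0 <= l < k) srw_pmf R l (y - x).
  move=> mn mk.
  rewrite exchange_big /= mulr_sumr (big_cat_nat (n := m) (p := k)) //=.
  rewrite -[leLHS]addr0 lerD //; last by apply: sumr_ge0 => l _; rewrite mulr_ge0 ?exprn_ge0 ?srw_pmf_ge0.
  rewrite !big_nat; apply: ler_sum => l /andP[_ lm].
  by rewrite sum_words_visit // ltnW // (leq_trans lm).
under eq_bigr => s _.
  rewrite !big_split /= !W; over.
rewrite !big_split /= !W -!mulr_sumr.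
have -> : Q ^+ k.-1 = Q ^+ i * Q ^+ (k.-1 - i) by rewrite -exprD; congr (_ ^+ _); lia.
rewrite /pair_weight !mulrDr -!mulrA !lerD // /A /B.
  by rewrite ler_wpM2l ?exprn_ge0 // visit //; lia.
by rewrite [leRHS]mulrCA ler_wpM2l ?exprn_ge0 // visit //; lia.
Qed.

(** There are [M = |K| k (2d)^(k-1)] marks, and their fibre sizes sum to at most [c M]. In
    [size_undup_map] the choice [a = 1/c] gives at least [2M/c - M/c = M/c] distinct walks. *)
Lemma size_marked_walks (K : seq edge) (k : nat) (c : R) : 0 < c ->
  \sum_(e <- K) \sum_(f <- K) pair_weight k e f <= c * (size K)%:R ->
  (size K)%:R * k%:R * (2 * d)%:R ^+ k.-1 / c <= (size (undup (map marked_vertices (marks K k))))%:R.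
Proof.
move=> c0 hc; apply: le_trans (size_undup_map (marks K k) marked_vertices c^-1).
set z := fun m => (count_mem (marked_vertices m) (map marked_vertices (marks K k)))%:R : R.
have hS : \sum_(m <- marks K k) z m <= k%:R * (2 * d)%:R ^+ k.-1 * (c * (size K)%:R).
  by apply: le_trans (sum_fibre K k) _; rewrite ler_wpM2l ?mulr_ge0 ?exprn_ge0.
set S := \sum_(m <- _) z m in hS.
have -> : \sum_(m <- marks K k) (2 / c - c^-1 ^+ 2 * z m) =
    2 / c * (size (marks K k))%:R - c^-1 ^+ 2 * S.
  rewrite sumrB [in RHS]mulr_sumr; congr (_ - _).
  by rewrite big_const_seq count_predT iter_addr_0 -[LHS]mulr_natr.
rewrite size_marks lerBrDr.
have h2 : c^-1 ^+ 2 * S <= c^-1 ^+ 2 * (k%:R * (2 * d)%:R ^+ k.-1 * (c * (size K)%:R)).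
  rewrite ler_wpM2l ?exprn_ge0 ?invr_ge0 ?(ltW c0) //.
apply: le_trans (lerD (lexx _) h2) _; rewrite le_eqVlt; apply/orP; left; apply/eqP.
by field; rewrite gt_eqF.
Qed.

Lemma marked_walk e s t k i : adj e.1 e.2 -> (i < k)%N -> s \in words d i -> t \in words d (k.-1 - i) ->
  exists w : walk d, [/\ wstart w :: (val w).2 = marked_vertices (e, (s, t)), wlength w = k &
    traverses w e.1 e.2].
Proof.
move=> ae ik si ti; set V := marked_vertices _.
have szV : size V = k.+1 by rewrite size_marked (words_size si) (words_size ti); lia.
have pV : path (@adj d) (head 0 V) (behead V).
  rewrite /V /=; have := words_path e.1 si; set b := scanl _ _ _ => pb.
  have : sorted (@adj d) (rev (e.1 :: b)).
    rewrite rev_sorted /= (eq_path (e' := @adj d)) // => x y; exact: adj_sym.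
  have : last 0 (rev (e.1 :: b)) = e.1 by rewrite rev_cons last_rcons.
  have := size_rev (e.1 :: b); case: (rev (e.1 :: b)) => [//|x r] _ /= lr pr.
  by rewrite cat_path pr /= lr ae (words_path _ ti).
exists (exist _ (head 0 V, behead V) pV).
have eV : head 0 V :: behead V = V by case: (V) szV.
split; rewrite /wlength /wstart /= ?size_behead ?szV //.
exists i; first by rewrite /wlength /= size_behead szV.
left; set w := exist _ _ _.
have vE j : wvertex w j = nth (head 0 V) V j by rewrite -{2}eV.
rewrite !vE.
have := @nth_marked_before (head 0 V) e s t 0 (leq0n _); rewrite subn0 (words_size si) => ->.
by have := @nth_marked_after (head 0 V) e s t 0 (leq0n _); rewrite addn0 (words_size si) => ->.
Qed.

Lemma many_crossing_walks (K : seq edge) (k : nat) (c : R) : 0 < c ->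
  (forall e, e \in K -> adj e.1 e.2) ->
  \sum_(e <- K) \sum_(f <- K) pair_weight k e f <= c * (size K)%:R ->
  exists s : seq (walk d), [/\ uniq s,
    forall w, w \in s -> wlength w = k /\ exists2 e, e \in K & traverses w e.1 e.2 &
    (size K)%:R * k%:R * (2 * d)%:R ^+ k.-1 / c <= (size s)%:R].
Proof.
move=> c0 aK hc; set VV := undup (map marked_vertices (marks K k)).
have H V : V \in VV -> exists w : walk d, [/\ wstart w :: (val w).2 = V, wlength w = k &
    exists2 e, e \in K & traverses w e.1 e.2].
  rewrite mem_undup => /mapP[m /allpairsP[[e st] [/= eK + ->]] ->].
  move=> /flatten_mapP[i]; rewrite mem_iota add0n /= => ik /allpairsP[[s t] [/= si ti ->]].
  have [w [h1 h2 h3]] := marked_walk (aK _ eK) ik si ti.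
  by exists w; split => //; exists e.
have [g gP] : exists g : seq (lattice d) -> walk d, forall V, V \in VV ->
    [/\ wstart (g V) :: (val (g V)).2 = V, wlength (g V) = k &
    exists2 e, e \in K & traverses (g V) e.1 e.2].
  have w0 : walk d by exists (0, [::]).
  have /choice[g gP] : forall V, exists w : walk d, V \in VV -> [/\ wstart w :: (val w).2 = V,
      wlength w = k & exists2 e, e \in K & traverses w e.1 e.2].
    by move=> V; have [/H[w hw]|//] := boolP (V \in VV); [exists w|exists w0].
  by exists g.
exists (map g VV); split.
- rewrite map_inj_in_uniq ?undup_uniq // => V V' /gP[h _ _] /gP[h' _ _] e.
  by rewrite -h -h' e.
- by move=> w /mapP[V /gP[_ h1 h2] ->].
- by rewrite size_map; exact: size_marked_walks.
Qed.

End MarkedWalks.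

(** * Closed contours in the quadrant *)

(* Edges of the quadrant N^2: [(true, (a, b))] joins (a, b) to (a+1, b), and
   [(false, (a, b))] joins (a, b) to (a, b+1). *)
Notation qedge := (bool * (nat * nat))%type.

Definition nat_dist (m n : nat) : nat := (m - n + (n - m))%N.

(** The maximum distance of the base points. Orientations are ignored, so this is only a
    pseudometric: the two edges based at one vertex are at distance 0, and any two of the four edges
    of a face are within distance 1. *)
Definition qdist (e f : qedge) : nat :=
  maxn (nat_dist e.2.1 f.2.1) (nat_dist e.2.2 f.2.2).

Lemma qdist_sym e f : qdist e f = qdist f e.
Proof. rewrite /qdist /nat_dist; lia. Qed.

Lemma qdist_triangle f e g : (qdist e g <= qdist e f + qdist f g)%N.
Proof. rewrite /qdist /nat_dist; lia. Qed.

Lemma qdistxx e : qdist e e = 0%N.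
Proof. rewrite /qdist /nat_dist; lia. Qed.

Section ClosedChains.
Variable closed : qedge -> Prop.

Definition closed_adj (e f : qedge) : Prop :=
  [/\ closed e, closed f & (qdist e f <= 1)%N].

Definition closed_chain := clos_refl_trans qedge closed_adj.

Lemma closed_chain_sym e f : closed_chain e f -> closed_chain f e.
Proof.
elim=> [x y [cx cy xy]|x|x y z _ h1 _ h2].
- by apply: rt_step; split; rewrite // qdist_sym.
- exact: rt_refl.
- exact: rt_trans h2 h1.
Qed.

(** A discrete intermediate value argument: one step of the chain changes the distance to [e] by at
    most 1. *)
Lemma closed_chain_hit e f r : closed e -> closed_chain e f -> (r <= qdist e f)%N ->
  exists g, [/\ closed g, closed_chain e g & qdist e g = r].
Proof.
move=> ce /(clos_rt_rtn1 _ _ _ _) ef; elim: ef r => [|y z [cy cz yz] ey IH] r.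
  by rewrite qdistxx leqn0 => /eqP ->; exists e; split=> //; [exact: rt_refl|exact: qdistxx].
have [ry _|yr rz] := leqP r (qdist e y); first exact: IH.
exists z; split=> //.
  by apply: rt_trans (clos_rtn1_rt _ _ _ _ ey) _; apply: rt_step.
have := qdist_triangle y e z; lia.
Qed.

End ClosedChains.

Section Contour.
Variables (C : nat -> nat -> bool) (M N : nat).

Definition qends (e : qedge) : bool * bool :=
  let: (h, (a, b)) := e in (C a b, if h then C a.+1 b else C a b.+1).

Definition qboundary (e : qedge) : bool := (qends e).1 (+) (qends e).2.

Hypothesis Cbound : forall a b, C a b -> (a < M)%N && (b < M)%N.
Hypothesis Cbox : forall a b, (a <= N)%N -> (b <= N)%N -> C a b.
(** Connectedness of [C], in the dual form in which it is applied to [potential w]. *)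
Hypothesis Cconn : forall phi : nat -> nat -> bool,
  (forall a b, C a b -> C a.+1 b -> phi a b = phi a.+1 b) ->
  (forall a b, C a b -> C a b.+1 -> phi a b = phi a b.+1) ->
  forall a b, C a b -> phi a b = phi 0%N 0%N.

Section Potential.
(* A Z/2-valued 1-form on the edges and its path integral, along the first axis and then
   along the second. *)
Variable w : qedge -> bool.

Fixpoint potential0 (a : nat) : bool :=
  if a is a'.+1 then potential0 a' (+) w (true, (a', 0%N)) else false.

Fixpoint potential (a b : nat) : bool :=
  if b is b'.+1 then potential a b' (+) w (false, (a, b')) else potential0 a.

Hypothesis w_closed : forall a b,
  w (true, (a, b)) (+) w (false, (a.+1, b)) = w (false, (a, b)) (+) w (true, (a, b.+1)).

Lemma potentialS a b : potential a.+1 b = potential a b (+) w (true, (a, b)).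
Proof.
elim: b => [|b IH] //=; rewrite IH -addbA w_closed addbA; by [].
Qed.
End Potential.

(* Otherwise the indicator of the boundary edges linked to [H(a, 0)] would be a closed, hence
   exact, Z/2-valued 1-form; its potential is constant on [C] and also along the way from
   [(0, 0)] up the second axis and around [C] to [(a + 1, 0)], yet jumps across [H(a, 0)]. *)
Lemma contour_chain : exists a t, (N <= a)%N /\
  closed_chain qboundary (true, (a, 0%N)) (false, (0%N, t)).
Proof.
have exP : exists a, C a 0 by exists 0%N; apply: Cbox.
have ubP i : C i 0 -> (i <= M)%N by move/Cbound/andP => [/ltnW].
case: (ex_maxnP exP ubP) => a Ca amax.
have Na : (N <= a)%N by apply: amax; apply: Cbox.
have aM : (a < M)%N by case/andP: (Cbound Ca).
have Cout i : (a < i)%N -> C i 0 = false.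
  by move=> ai; apply: contraTF ai => /amax; rewrite -leqNgt.
have CMl i j : (M <= i)%N -> C i j = false.
  by move=> Mi; apply: contraTF Mi => /Cbound/andP[? _]; rewrite -ltnNge.
have CMr i j : (M <= j)%N -> C i j = false.
  by move=> Mi; apply: contraTF Mi => /Cbound/andP[_ ?]; rewrite -ltnNge.
set e0 : qedge := (true, (a, 0%N)).
have be0 : qboundary e0 by rewrite /qboundary /= Ca Cout.
pose w e := qboundary e && `[< closed_chain qboundary e0 e >].
have wb e : ~~ qboundary e -> w e = false by rewrite /w => /negbTE ->.
have w_near e f : (qdist e f <= 1)%N -> w e -> w f = qboundary f.
  move=> ef /andP[be /asboolP ce]; rewrite /w; case bf : (qboundary f) => //=.
  by apply/asboolP; apply: rt_trans ce _; apply: rt_step.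
(* Around a face the number of boundary edges is even, and these edges are pairwise within distance
   1, so the chain from [e0] reaches all of them or none. *)
have w_closed i j :
    w (true, (i, j)) (+) w (false, (i.+1, j)) = w (false, (i, j)) (+) w (true, (i, j.+1)).
  have bd : qboundary (true, (i, j)) (+) qboundary (false, (i.+1, j)) =
      qboundary (false, (i, j)) (+) qboundary (true, (i, j.+1)).
    by rewrite /qboundary /=; do 4 case: (C _ _).
  set s := [:: (true, (i, j)); (false, (i.+1, j)); (false, (i, j)); (true, (i, j.+1))] : seq qedge.
  have [hs|hs] := boolP (has w s); last first.
    by move: hs; rewrite /= !negb_or => /and5P[/negbTE-> /negbTE-> /negbTE-> /negbTE-> _].
  case/hasP: hs => e es we.
  have all_s f : f \in s -> w f = qboundary f.
    move=> fs; apply: (w_near e) => //; move: es fs; rewrite !inE.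
    by move=> /or4P[]/eqP-> /or4P[]/eqP->; rewrite /qdist /nat_dist /=; lia.
  by rewrite !all_s ?inE ?eqxx ?orbT.
have [//|nt] := pselect (exists t, w (false, (0%N, t))).
  by move=> [t /andP[_ /asboolP ct]]; exists a, t.
have wt t : w (false, (0%N, t)) = false by apply/negbTE/negP => h; apply: nt; exists t.
have p0 t : potential w 0 t = false by elim: t => //= t ->; rewrite wt.
(* Row [M] and column [M] lie outside [C], hence carry no boundary edge and leave the potential
   unchanged. *)
have pM i : potential w i M = false.
  by elim: i => [|i IH]; rewrite ?p0 // potentialS // IH wb // /qboundary /= !CMr.
have pM' j : (j <= M)%N -> potential w M (M - j) = false.
  elim: j => [|j IH] jM; first by rewrite subn0 pM.
  have := IH (ltnW jM); have -> : (M - j = (M - j.+1).+1)%N by lia.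
  by rewrite /= [w _]wb ?addbF // /qboundary /= !CMl.
have pout j : (a < M - j)%N -> potential w (M - j) 0 = false.
  elim: j => [|j IH] aj; first by rewrite subn0; have := pM' M (leqnn M); rewrite subnn.
  have aj' : (a < M - j)%N by lia.
  have := IH aj'; have -> : (M - j = (M - j.+1).+1)%N by lia.
  by rewrite potentialS // [w _]wb ?addbF // /qboundary /= !Cout //; lia.
have pa1 : potential w a.+1 0 = false.
  by have := pout (M - a.+1)%N; rewrite subKn //; apply.
have pa0 : potential w a 0 = false.
  have -> // := Cconn (phi := potential w) _ _ Ca.
  - by move=> i j Ci Ci1; rewrite potentialS // wb ?addbF // /qboundary /= Ci Ci1.
  - by move=> i j Ci Ci1; rewrite /= wb ?addbF // /qboundary /= Ci Ci1.
move: pa1; rewrite potentialS // pa0 /= /w be0 /=.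
by move/asboolP; case; exact: rt_refl.
Qed.

End Contour.

(** * Dyadic families of well separated edges *)

Section SpreadFamilies.
Variable ell : nat.
Hypothesis ell16 : (16 <= ell)%N.

Definition qsphere (r : nat) (e : qedge) : seq qedge :=
  [seq f <- [seq (h, ab) | h <- [:: true; false],
      ab <- [seq (a, b) | a <- iota (e.2.1 - r) r.*2.+1, b <- iota (e.2.2 - r) r.*2.+1]]
   | qdist e f == r].

Lemma mem_qsphere r e f : (f \in qsphere r e) = (qdist e f == r).
Proof.
rewrite mem_filter andb_idr // => /eqP er.
case: f er => h [a b] er; apply/allpairsP; exists (h, (a, b)); split=> //.
  by case: h {er}.
apply/allpairsP; exists (a, b); split=> //; rewrite mem_iota; move: er;
  rewrite /qdist /nat_dist /=; lia.
Qed.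

Let ell0 : (0 < ell)%N. Proof. exact: leq_trans ell16. Qed.

(** The enclosing square carries at most [2 (2r+1)^2] edges, and [2r+1 <= 3r]. *)
Lemma size_qsphere r e : (0 < r)%N -> (size (qsphere r e) <= 18 * r ^ 2)%N.
Proof.
move=> r0; rewrite size_filter (leq_trans (count_size _ _)) //.
rewrite !size_allpairs !size_iota /=; nia.
Qed.

(* Families of [2 ^ n] edges spread out like a dyadic tree of scale ratio [ell], such that a
   chain from [e] to distance [ell ^ n] contains one of them. *)
Fixpoint spread (n : nat) (e : qedge) : seq (seq qedge) :=
  if n is n'.+1 then
    flatten [seq [seq K1 ++ K2 | K1 <- spread n' e, K2 <- spread n' f] | f <- qsphere (ell ^ n) e]
  else [:: [:: e]].

Lemma spreadP n e K : reflect
  (exists f K1 K2, [/\ qdist e f = (ell ^ n.+1)%N, K1 \in spread n e, K2 \in spread n f &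
     K = K1 ++ K2]) (K \in spread n.+1 e).
Proof.
apply: (iffP flatten_mapP).
  move=> [f]; rewrite mem_qsphere => /eqP ef /allpairsP[[K1 K2] [/= h1 h2 h3]].
  by exists f, K1, K2.
move=> [f [K1 [K2 [ef h1 h2 ->]]]]; exists f; first by rewrite mem_qsphere ef.
by apply/allpairsP; exists (K1, K2).
Qed.

(** The chain meets an edge [g] at distance exactly [ell ^ n.+1]. Followed from [e], and backwards
    from [g], it goes at least as far as [ell ^ n], so each of these two ends yields one half of the
    family. *)
Lemma spread_chain (closed : qedge -> Prop) n e f : closed e -> closed_chain closed e f ->
  (ell ^ n <= qdist e f)%N -> exists2 K, K \in spread n e & forall g, g \in K -> closed g.
Proof.
elim: n e f => [|n IH] e f ce ef nf.
  by exists [:: e]; rewrite ?inE // => g; rewrite inE => /eqP ->.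
have [g [cg eg dg]] := closed_chain_hit ce ef nf.
have le16 : (ell ^ n <= ell ^ n.+1)%N by rewrite leq_pexp2l.
have [K1 K1e cK1] : exists2 K, K \in spread n e & forall g, g \in K -> closed g.
  by apply: IH ce eg _; rewrite dg.
have [K2 K2e cK2] : exists2 K, K \in spread n g & forall g, g \in K -> closed g.
  by apply: IH cg (closed_chain_sym eg) _; rewrite qdist_sym dg.
exists (K1 ++ K2); first by apply/spreadP; exists g, K1, K2.
by move=> h; rewrite mem_cat => /orP[/cK1|/cK2].
Qed.

(** Let [s n] bound the size and [b n = 18 ell^(2n+4)]. The recursion
    [s (n+1) <= 18 ell^(2n+2) (s n)^2] and the identity [18 ell^(2n+2) b (n+1) = (b n)^2] show that
    the product of [b n] and [s n] at most squares at each level. The prefactor also provides the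
    summability in [percolates_large]. *)
Lemma size_spread n e :
  (18 * ell ^ (2 * n.+2) * size (spread n e) <= (18 * ell ^ 4) ^ (2 ^ n))%N.
Proof.
elim: n e => [|n IH] e; first by rewrite muln1 expn0 expn1.
set A := (18 * ell ^ 4)%N in IH *; set s := fun n e => size (spread n e).
have H f : (s n e * s n f * (18 * ell ^ (2 * n.+2)) ^ 2 <= A ^ (2 ^ n.+1))%N.
  have -> : (s n e * s n f * (18 * ell ^ (2 * n.+2)) ^ 2 =
    (18 * ell ^ (2 * n.+2) * s n e) * (18 * ell ^ (2 * n.+2) * s n f))%N by ring.
  have -> : (A ^ 2 ^ n.+1 = A ^ 2 ^ n * A ^ 2 ^ n)%N by rewrite expnS mul2n -addnn expnD.
  by apply: leq_mul; apply: IH.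
have S : (size (spread n.+1 e) * (18 * ell ^ (2 * n.+2)) ^ 2 <=
     18 * (ell ^ n.+1) ^ 2 * A ^ (2 ^ n.+1))%N.
  rewrite [spread _ _]/= size_flatten /shape -map_comp sumnE big_map big_distrl /=.
  apply: (@leq_trans (\sum_(f <- qsphere (ell ^ n.+1) e) A ^ (2 ^ n.+1))).
    by apply: leq_sum => f _; rewrite size_allpairs; apply: H.
  rewrite big_const_seq count_predT iter_addn_0 mulnC leq_mul2r; apply/orP; right.
  by apply: size_qsphere; rewrite expn_gt0 ell0.
have e1 : ((18 * ell ^ (2 * n.+2)) ^ 2 = 18 * ell ^ (2 * n.+3) * (18 * (ell ^ n.+1) ^ 2))%N.
  rewrite expnMn -!expnM -[(18 ^ 2)%N]/(18 * 18)%N.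
  have -> : (2 * n.+2 * 2 = 2 * n.+3 + n.+1 * 2)%N by lia.
  by rewrite expnD; ring.
rewrite e1 in S.
have q0 : (0 < 18 * (ell ^ n.+1) ^ 2)%N by rewrite muln_gt0 !expn_gt0 ell0.
rewrite -(leq_pmul2l q0); apply: leq_trans S; rewrite leq_eqVlt; apply/orP; left.
apply/eqP; ring.
Qed.

Lemma spread_size n e K : K \in spread n e -> size K = (2 ^ n)%N.
Proof.
elim: n e K => [|n IH] e K; first by rewrite inE => /eqP ->.
by move=> /spreadP[f [K1 [K2 [_ h1 h2 ->]]]]; rewrite size_cat (IH _ _ h1) (IH _ _ h2) expnS; lia.
Qed.

Lemma spread_near n e K f : K \in spread n e -> f \in K -> (qdist e f <= 2 * ell ^ n)%N.
Proof.
elim: n e K f => [|n IH] e K f; first by rewrite inE => /eqP ->; rewrite inE => /eqP ->; rewrite qdistxx.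
move=> /spreadP[g [K1 [K2 [eg h1 h2 ->]]]]; rewrite mem_cat expnS => /orP[/(IH _ _ _ h1)|/(IH _ _ _ h2)].
  by nia.
by have := qdist_triangle g e f; rewrite eg expnS; nia.
Qed.

(** The two halves of a family are at distance at least [ell ^ n.+1 - 4 ell ^ n >= 12 ell ^ n], so
    each of the two cross sums has [4 ^ n] terms of size at most [c / 4 ^ n]. From one level to the
    next the sum thus doubles and gains at most [2 c], which the term [- 2 c] in the induction
    absorbs. *)
Lemma sum_spread (R : realFieldType) (W : qedge -> qedge -> R) (c : R) : 0 <= c ->
  (forall f g, W f g <= c) ->
  (forall n f g, (12 * ell ^ n <= qdist f g)%N -> W f g <= c / 4 ^+ n) ->
  forall n e K, K \in spread n e -> \sum_(f <- K) \sum_(g <- K) W f g <= 3 * c * 2 ^+ n.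
Proof.
move=> c0 Wc Wdec n e K Ke.
suff: \sum_(f <- K) \sum_(g <- K) W f g <= 3 * c * 2 ^+ n - 2 * c by lra.
elim: n e K Ke => [|n IH] e K.
  by rewrite inE => /eqP ->; rewrite !big_seq1; have := Wc e e; rewrite expr0; lra.
move=> /spreadP[g [K1 [K2 [eg h1 h2 ->]]]].
have cross (L1 L2 : seq qedge) : size L1 = (2 ^ n)%N -> size L2 = (2 ^ n)%N ->
    (forall f1 f2, f1 \in L1 -> f2 \in L2 -> (12 * ell ^ n <= qdist f1 f2)%N) ->
    \sum_(f <- L1) \sum_(g <- L2) W f g <= c.
  move=> s1 s2 far.
  apply: (@le_trans _ _ (\sum_(f <- L1) \sum_(g <- L2) c / 4 ^+ n)).
    rewrite big_seq [leRHS]big_seq; apply: ler_sum => f1 f1L.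
    by rewrite big_seq [leRHS]big_seq; apply: ler_sum => f2 f2L; exact/Wdec/far.
  rewrite !big_const_seq !count_predT !iter_addr_0 s1 s2 -mulrnA -[leLHS]mulr_natr.
  rewrite natrM !natrX -exprMn -[2 * 2]natrM mulfVK // expf_neq0 // pnatr_eq0 //.
have far f1 f2 : f1 \in K1 -> f2 \in K2 -> (12 * ell ^ n <= qdist f1 f2)%N.
  move=> /(spread_near h1) d1 /(spread_near h2) d2.
  have := qdist_triangle f1 e g; have := qdist_triangle f2 f1 g.
  by rewrite eg [qdist f2 g]qdist_sym expnS; nia.
have := IH _ _ h1; have := IH _ _ h2.
have := cross _ _ (spread_size h1) (spread_size h2) far.
have := cross _ _ (spread_size h2) (spread_size h1)
  (fun f1 f2 h h' => eq_ind _ (fun m => (_ <= m)%N) (far _ _ h' h) _ (qdist_sym _ _)).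
rewrite !big_cat /=.
under [X in _ -> _ -> _ -> _ -> X + _ <= _]eq_bigr do rewrite big_cat /=.
under [X in _ -> _ -> _ -> _ -> _ + X <= _]eq_bigr do rewrite big_cat /=.
rewrite !big_split /= exprS; lra.
Qed.

End SpreadFamilies.

Local Open Scope classical_set_scope.
Local Open Scope ring_scope.

(** * Bernoulli fields on a countable set *)

Section CountableMeasurability.
Context (disp : measure_display) (T : measurableType disp) (I : countType).

Lemma measurable_exists (A : I -> T -> Prop) : (forall i, measurable [set t | A i t]) ->
  measurable [set t | exists i, A i t].
Proof.
move=> mA; rewrite (_ : [set t | _] = \bigcup_i [set t | A i t]); last first.
  by apply/seteqP; split=> t [i]; [exists i|move=> _; exists i].
by apply: countable_bigcupT_measurable => //; exact: countableP.
Qed.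

Lemma measurable_forall (A : I -> T -> Prop) : (forall i, measurable [set t | A i t]) ->
  measurable [set t | forall i, A i t].
Proof.
move=> mA; rewrite -[X in measurable X]setCK; apply: measurableC.
rewrite (_ : ~` _ = [set t | exists i, ~ A i t]).
  by apply: measurable_exists => i; exact: measurableC (mA i).
by apply/seteqP; split=> t /= /existsNP.
Qed.

Lemma measurable_conj (A B : T -> Prop) : measurable [set t | A t] -> measurable [set t | B t] ->
  measurable [set t | A t /\ B t].
Proof. exact: measurableI. Qed.

Lemma measurable_const (p : Prop) : measurable [set t : T | p].
Proof.
have [hp|hp] := pselect p.
  by rewrite (_ : [set t | p] = setT) //; apply/seteqP; split.
by rewrite (_ : [set t | p] = set0) //; apply/seteqP; split.
Qed.
End CountableMeasurability.

Section OccupancyFields.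
Context (R : realType) (W : countType).

Definition cylinder (s : seq W) : set (W -> bool) := [set o : W -> bool | all o s].
Definition cylinders : set (set (W -> bool)) := range cylinder.

Lemma setI_closed_cylinders : setI_closed cylinders.
Proof.
move=> _ _ [s _ <-] [t _ <-]; exists (s ++ t) => //.
by apply/seteqP; split=> o; rewrite /cylinder /= all_cat => /andP.
Qed.

Notation event := (<<s cylinders >>).

Section Preimage.
Context (disp : measure_display) (T : measurableType disp) (o : T -> W -> bool).
Hypothesis mo : forall w, measurable [set t | o t w].

Lemma measurable_cylinder s : measurable [set t | cylinder s (o t)].
Proof.
rewrite /cylinder /=; elim: s => [|w s IH] /=; first exact: measurable_const.
by rewrite (_ : mkset _ = [set t | o t w] `&` [set t | all (o t) s]);
  [exact: measurableI|apply/seteqP; split=> t /= /andP].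
Qed.

Lemma measurable_event F : event F -> measurable [set t | F (o t)].
Proof.
apply: (smallest_sub (X := [set F | measurable [set t | F (o t)]])); last first.
  by move=> _ [s _ <-]; exact: measurable_cylinder.
split => /=.
- exact: measurable_const.
- move=> A mA; rewrite (_ : mkset _ = ~` [set t | A (o t)]); first exact: measurableC.
  by apply/seteqP; split=> t /=; rewrite /setD /=; [case|].
- by move=> A mA; exact: bigcupT_measurable.
Qed.
End Preimage.

(** Dynkin's theorem for the pi-system of cylinders. It is stated for finite measures so that it can
    compare the restriction of [P] to an event with a multiple of [P], which is how independence is
    proved below. *)
Lemma occupancy_law_unique (disp disp' : measure_display) (T : measurableType disp)
    (T' : measurableType disp') (mu : {measure set T -> \bar R}) (nu : {measure set T' -> \bar R})
    (o : T -> W -> bool) (o' : T' -> W -> bool) :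
  (mu setT < +oo)%E ->
  (forall w, measurable [set t | o t w]) -> (forall w, measurable [set t | o' t w]) ->
  (forall s, mu [set t | cylinder s (o t)] = nu [set t | cylinder s (o' t)]) ->
  forall F, event F -> mu [set t | F (o t)] = nu [set t | F (o' t)].
Proof.
move=> muoo mo mo' munu.
have munuT : mu setT = nu setT.
  have e (S : Type) (p : S -> W -> bool) : [set t | cylinder [::] (p t)] = setT.
    by apply/seteqP; split.
  by have := munu [::]; rewrite !e.
have nuoo : (nu setT < +oo)%E by have := muoo; rewrite munuT.
rewrite -(setI_closed_g_dynkin_g_sigma_algebra setI_closed_cylinders).
pose X := [set F | [/\ measurable [set t | F (o t)], measurable [set t | F (o' t)] &
  mu [set t | F (o t)] = nu [set t | F (o' t)]]].
suff XF : <<d cylinders >> `<=` X by move=> F /XF[].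
apply: smallest_sub; last first.
  by move=> _ [s _ <-]; split; rewrite ?munu //; exact: measurable_cylinder.
split.
- by split; [exact: measurable_const|exact: measurable_const|exact: munuT].
- move=> A [mA mA' e]; split.
  + exact: measurableC mA.
  + exact: measurableC mA'.
  + have D (d : measure_display) (S : measurableType d) (m : {measure set S -> \bar R}) B :
        (m setT < +oo)%E -> measurable B -> m (~` B) = (m setT - m B)%E.
      by move=> moo mB; rewrite -setTD measureD // setTI.
    by rewrite [LHS](D _ _ mu [set t | A (o t)]) // [RHS](D _ _ nu [set t | A (o' t)]) // munuT e.
- move=> A tA XA; split.
  + by apply: (@bigcupT_measurable _ _ (fun n => [set t | A n (o t)])) => n; case: (XA n).
  + by apply: (@bigcupT_measurable _ _ (fun n => [set t | A n (o' t)])) => n; case: (XA n).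
  + rewrite -[LHS]/(mu (\bigcup_n [set t | A n (o t)])).
    rewrite -[RHS]/(nu (\bigcup_n [set t | A n (o' t)])).
    have tr (S : Type) (p : S -> W -> bool) : trivIset setT (fun n => [set t | A n (p t)]).
      by move=> i j _ _ [t [/= h1 h2]]; apply: (tA i j) => //; exists (p t).
    rewrite !measure_semi_bigcup //; try by move=> i; case: (XA i).
    * by apply: eq_eseriesr => i _; case: (XA i).
    * by apply: bigcupT_measurable => i; case: (XA i).
    * by apply: bigcupT_measurable => i; case: (XA i).
Qed.

(** Independent occupation variables. Prescribing the joint occupation of finite sets determines the
    law, since these events form a pi-system. *)
Definition bernoulli_field (disp : measure_display) (T : measurableType disp)
    (P : probability T R) (o : T -> W -> bool) (p : W -> R) : Prop :=
  (forall w, measurable [set t | o t w]) /\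
  forall s, uniq s -> P [set t | cylinder s (o t)] = (\prod_(w <- s) p w)%:E.

Lemma cylinder_undup s o : cylinder (undup s) o <-> cylinder s o.
Proof. by rewrite /cylinder /= (eq_all_r (mem_undup s)). Qed.

Lemma set_cylinder_undup (T : Type) s (o : T -> W -> bool) :
  [set t | cylinder (undup s) (o t)] = [set t | cylinder s (o t)].
Proof. by apply/seteqP; split=> t /= /cylinder_undup. Qed.

Lemma bernoulli_field_law (disp disp' : measure_display) (T : measurableType disp)
    (T' : measurableType disp') (P : probability T R) (P' : probability T' R) o o' p :
  bernoulli_field P o p -> bernoulli_field P' o' p ->
  forall F, event F -> P [set t | F (o t)] = P' [set t | F (o' t)].
Proof.
move=> [mo Po] [mo' Po']; apply: occupancy_law_unique => //.
  by apply: le_lt_trans (probability_le1 P measurableT) (ltry _).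
move=> s; rewrite -(set_cylinder_undup s o) -(set_cylinder_undup s o').
exact: etrans (Po _ (undup_uniq s)) (esym (Po' _ (undup_uniq s))).
Qed.

(* Kolmogorov's 0-1 law: an event insensitive to finitely many coordinates is independent of
   every cylinder, hence of itself. *)
Lemma bernoulli_field_01 (disp : measure_display) (T : measurableType disp)
    (P : probability T R) o p F :
  bernoulli_field P o p -> event F ->
  (forall (s : seq W) (q : W -> bool), F q <-> F (fun w => q w && (w \notin s))) ->
  P [set t | F (o t)] = 0%E \/ P [set t | F (o t)] = 1%E.
Proof.
move=> [mo Po] eF tailF; set E := [set t | F (o t)].
have mE : measurable E by exact: measurable_event.
have indep s : P (E `&` [set t | cylinder s (o t)]) = (P [set t | cylinder s (o t)] * P E)%E.
  rewrite -set_cylinder_undup; have : uniq (undup s) by exact: undup_uniq.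
  move: (undup s) => {}s us.
  set C := [set t | cylinder s (o t)]; have mC : measurable C by exact: measurable_cylinder.
  have pC : P C = (fine (P C))%:E by rewrite fineK // fin_num_measure.
  have pC0 : 0 <= fine (P C) by rewrite fine_ge0.
  (* The field with the coordinates in [s] switched off: [F] does not see the change, and the new
     field is independent of [C]. *)
  pose os t w := o t w && (w \notin s).
  have mos w : measurable [set t | os t w].
    rewrite /os; case: (w \notin s); last by rewrite (_ : mkset _ = set0) //;
      apply/seteqP; split=> // t /=; rewrite andbF.
    by rewrite (_ : mkset _ = [set t | o t w]) //; apply/seteqP; split=> t /=; rewrite andbT.
  have eE : [set t | F (os t)] = E.
    by apply/seteqP; split=> t; have [h1 h2] := tailF s (o t); [exact: h2|exact: h1].
  suff : P ([set t | F (os t)] `&` C) = ((fine (P C))%:E * P [set t | F (os t)])%E.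
    by rewrite eE -pC.
  apply: (@occupancy_law_unique _ _ _ _ (mrestr P mC) (mscale (NngNum pC0) P) os os _ mos mos _ F eF).
    by apply: le_lt_trans (probability_le1 P (measurableI _ _ measurableT mC)) (ltry _).
  move=> t; rewrite -set_cylinder_undup.
  have : uniq (undup t) by exact: undup_uniq.
  move: (undup t) => {}t ut.
  suff : P ([set x | cylinder t (os x)] `&` C) = ((fine (P C))%:E * P [set x | cylinder t (os x)])%E by [].
  rewrite -pC; have [st|st] := boolP (has (fun w => w \in s) t).
    rewrite (_ : [set x | cylinder t (os x)] = set0) ?set0I ?measure0 ?mule0 //.
    apply/seteqP; split=> // x /allP h; case/hasP: st => w wt ws.
    by have := h w wt; rewrite /os ws andbF.
  have e1 : [set x | cylinder t (os x)] = [set x | cylinder t (o x)].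
    apply/seteqP; split=> x /= /allP h; apply/allP => w wt; have := h w wt; rewrite /os.
      by case/andP.
    by move=> -> /=; apply: contra st => ws; apply/hasP; exists w.
  have e2 : [set x | cylinder t (o x)] `&` C = [set x | cylinder (s ++ t) (o x)].
    by apply/seteqP; split=> x; rewrite /C /cylinder /= all_cat; [case=> -> ->|case/andP].
  rewrite e1 e2 /C !Po ?cat_uniq ?us ?ut ?st //.
  by rewrite big_cat EFinM.
have pE : P E = (fine (P E))%:E by rewrite fineK // fin_num_measure.
have pE0 : 0 <= fine (P E) by rewrite fine_ge0.
have : P (E `&` E) = ((fine (P E))%:E * P E)%E.
  apply: (@occupancy_law_unique _ _ _ _ (mrestr P mE) (mscale (NngNum pE0) P) o o _ mo mo _ F eF).
    by apply: le_lt_trans (probability_le1 P (measurableI _ _ measurableT mE)) (ltry _).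
  move=> s.
  suff : P ([set x | cylinder s (o x)] `&` E) = ((fine (P E))%:E * P [set x | cylinder s (o x)])%E by [].
  by rewrite -pE setIC indep muleC.
rewrite setIid.
rewrite pE -EFinM => -[]; set x := fine _ => /eqP.
rewrite -subr_eq0 -{1}[x]mulr1 -mulrBr mulf_eq0 subr_eq0.
by case/orP => /eqP e; [left|right]; rewrite ?e // -e.
Qed.

End OccupancyFields.

(** * Finitary interlacements as Bernoulli fields *)

Section Percolation.
Variable d : nat.
Notation W := (walk d).

Definition percolation_event : set (W -> bool) := [set o | percolates (fun w => o w : nat)].

(** The intensity of walks of length 0 decreases in [T]; they are discarded, as they open no edge,
    so that the fields can be ordered in [T]. *)
Definition occupied (m : W -> nat) (w : W) : bool := (0 < m w)%N && (0 < wlength w)%N.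

Lemma traverses_wlength (w : W) x y : traverses w x y -> (0 < wlength w)%N.
Proof. by move=> [i iw _]; apply: leq_trans iw. Qed.

Lemma open_edge_occupied m : open_edge (fun w => occupied m w : nat) = open_edge m.
Proof.
apply/funext => x; apply/funext => y; apply/propext; split=> -[w h1 h2]; exists w => //.
  by move: h1; rewrite /occupied lt0b => /andP[].
by rewrite /occupied lt0b h1 (traverses_wlength h2).
Qed.

Lemma percolates_occupied m : percolates m <-> percolation_event (occupied m).
Proof. by rewrite /percolation_event /percolates /cluster /= open_edge_occupied. Qed.

Lemma set_percolates (T : Type) (N : T -> W -> nat) :
  [set t | percolates (N t)] = [set t | percolation_event (occupied (N t))].
Proof.
apply/seteqP; split=> t h; [exact: (percolates_occupied (N t)).1|exact: (percolates_occupied (N t)).2].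
Qed.

Lemma percolates_mono (m m' : W -> nat) :
  (forall w, (0 < m w)%N -> (0 < wlength w)%N -> (0 < m' w)%N) -> percolates m -> percolates m'.
Proof.
move=> mm' [x hx]; exists x; apply: sub_infinite_set hx => y; rewrite /cluster /=.
elim=> [a b [w mw tw]|a|a b c _ h1 _ h2]; [|exact: rt_refl|exact: rt_trans h1 h2].
by apply: rt_step; exists w => //; apply: mm' => //; exact: traverses_wlength tw.
Qed.

(** The number of steps is recorded so that connection becomes a countable union of events. *)
Fixpoint reach (m : W -> nat) (n : nat) (x y : lattice d) : Prop :=
  if n is n'.+1 then exists z, open_edge m x z /\ reach m n' z y else x = y.

Lemma cluster_reach m x y : cluster m x y <-> exists n, reach m n x y.
Proof.
split=> [/(clos_rt_rt1n _ _ _ _)|[n]].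
  elim=> [a|a b c ab _ [n h]]; first by exists 0%N.
  by exists n.+1, b.
elim: n x => [x ->|n IH x [z [xz /IH zy]]]; first exact: rt_refl.
by apply: rt_trans zy; exact: rt_step.
Qed.

Lemma infinite_set_seq (T : choiceType) (A : set T) :
  infinite_set A <-> forall s : seq T, exists x, A x /\ x \notin s.
Proof.
split=> [iA s|h].
  apply/not_existsP => H; apply: iA; apply: (@sub_finite_set _ A [set` s]).
    by move=> x Ax /=; apply/negPn/negP => xs; apply: (H x).
  exact: finite_seq.
by move/finite_seqP => [s As]; have [x []] := h s; rewrite As /= => ->.
Qed.

Lemma percolation_event_measurable : (<<s @cylinders W >>) percolation_event.
Proof.
set G := @cylinders W; suff : measurable (percolation_event : set (g_sigma_algebraType G)) by [].
have mw w : measurable ([set o | o w] : set (g_sigma_algebraType G)).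
  apply: sub_sigma_algebra; exists [:: w] => //.
  by apply/seteqP; split=> o; rewrite /cylinder /= andbT.
have mo x y : measurable ([set o | open_edge (fun w => o w : nat) x y] : set (g_sigma_algebraType G)).
  have e : [set o : W -> bool | open_edge (fun w => o w : nat) x y] =
      [set o | exists w : W, o w /\ traverses w x y].
    by apply/seteqP; split=> o /=; [case=> w; rewrite lt0b; exists w|case=> w [h1 h2]; exists w; rewrite ?lt0b].
  apply: (eq_ind_r (fun S : set (g_sigma_algebraType G) => measurable S) _ e).
  apply: measurable_exists => w.
  exact: (measurable_conj (mw w) (@measurable_const _ (g_sigma_algebraType G) (traverses w x y))).
have mr n x y : measurable ([set o | reach (fun w => o w : nat) n x y] : set (g_sigma_algebraType G)).
  elim: n x => [|n IH] x; first exact: (@measurable_const _ (g_sigma_algebraType G) (x = y)).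
  by apply: measurable_exists => z; exact: (measurable_conj (mo x z) (IH z)).
(* Only countable quantifiers are left: over vertices, finite lists of vertices and numbers of
   steps. *)
have e : percolation_event = [set o : W -> bool | exists x, forall s : seq (lattice d), exists y,
    (exists n, reach (fun w => o w : nat) n x y) /\ y \notin s].
  apply/seteqP; split=> o [x].
    move/infinite_set_seq => h; exists x => s; have [y [/cluster_reach h1 h2]] := h s.
    by exists y.
  move=> h; exists x; apply/infinite_set_seq => s; have [y [/cluster_reach h1 h2]] := h s.
  by exists y.
apply: (eq_ind_r (fun S : set (g_sigma_algebraType G) => measurable S) _ e).
apply: measurable_exists => x; apply: measurable_forall => s; apply: measurable_exists => y.
exact: (measurable_conj (measurable_exists (fun n => mr n x y))
  (@measurable_const _ (g_sigma_algebraType G) (y \notin s))).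
Qed.

Definition wvertices (w : W) : seq (lattice d) := wstart w :: (val w).2.

Lemma wvertex_mem w i : (i <= wlength w)%N -> wvertex w i \in wvertices w.
Proof. by move=> h; apply: mem_nth. Qed.

(* Removing finitely many walks leaves an infinite cluster: up to the last step through a
   removed walk [w], a path ends at a vertex of [w]. *)
Lemma percolates_cofinite (m m' : W -> nat) (s : seq W) :
  (forall w, w \notin s -> (0 < m w)%N -> (0 < m' w)%N) -> percolates m -> percolates m'.
Proof.
move=> mm' [x hx]; apply: contrapT => np; apply: hx.
pose V := x :: flatten [seq wvertices w | w <- s].
apply: (@sub_finite_set _ _ (\bigcup_(v in [set` V]) cluster m' v)).
  move=> y /(clos_rt_rtn1 _ _ _ _); elim=> [|a b [w mw tw] _ [v vV va]].
    by exists x; [rewrite /= inE eqxx|exact: rt_refl].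
  have [ws|ws] := boolP (w \in s).
    exists b; last exact: rt_refl.
    rewrite /= inE; apply/orP; right; apply/flatten_mapP; exists w => //.
    by case: tw => i iw [[_ <-]|[<- _]]; apply: wvertex_mem => //; exact: ltnW.
  by exists v => //; apply: rt_trans va _; apply: rt_step; exists w => //; exact: mm'.
apply: bigcup_finite; first exact: finite_seq.
by move=> v _; apply: contrapT => hv; apply: np; exists v.
Qed.

Lemma percolation_event_tail (s : seq W) (o : W -> bool) :
  percolation_event o <-> percolation_event (fun w => o w && (w \notin s)).
Proof.
split; apply: (@percolates_cofinite _ _ s) => w ws; rewrite !lt0b ?ws ?andbT //.
Qed.

End Percolation.

Lemma esumZl (R : realType) (S : choiceType) (B : set S) (c : R) (f : S -> \bar R) :
  0 <= c -> (forall s, 0 <= f s)%E ->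
  (\esum_(s in B) (c%:E * f s) = c%:E * \esum_(s in B) f s)%E.
Proof.
move=> c0 f0.
have le (b : R) (g : S -> \bar R) : 0 <= b -> (forall s, 0 <= g s)%E ->
    (\esum_(s in B) (b%:E * g s) <= b%:E * \esum_(s in B) g s)%E.
  move=> b0 g0; apply: ge_ereal_sup => _ [X [fX XB] <-].
  rewrite -ge0_mule_fsumr //; apply: lee_wpmul2l; first by rewrite lee_fin.
  by apply: ereal_sup_ubound; exists X.
apply/eqP; rewrite eq_le le //=; have [->|cn0] := eqVneq c 0.
  by rewrite mul0e; apply: esum_ge0 => s _; rewrite mul0e.
have c1 : 0 < c by rewrite lt0r cn0.
rewrite -(@lee_pmul2l _ c^-1%:E) ?fin_numE // ?lte_fin ?invr_gt0 //.
rewrite muleA -EFinM mulVf // mul1e.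
apply: le_trans (le c^-1 (fun s => c%:E * f s)%E _ _); rewrite ?invr_ge0 //.
  by apply: le_esum => s _; rewrite muleA -EFinM mulVf // mul1e.
by move=> s; rewrite mule_ge0 // lee_fin.
Qed.

Section Intensity.
Variables (R : realType) (d : nat).
Hypothesis d0 : (0 < d)%N.
Notation W := (walk d).

(** The intensity of a single walk. Beside one factor [T + 1] per step, a further one comes from the
    killing and another from the number of walks started at a vertex. *)
Definition walk_rate (u T : R) (w : W) : R :=
  u * (2 * d)%:R * T ^+ wlength w / (T + 1) ^+ (wlength w).+2 / (2 * d)%:R ^+ wlength w.

Lemma walk_rate_ge0 (u T : R) (w : W) : 0 <= u -> 0 <= T -> 0 <= walk_rate u T w.
Proof. by move=> u0 T0; rewrite !mulr_ge0 ?invr_ge0 ?exprn_ge0 // addr_ge0. Qed.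

Lemma srw_steps_prod (w : W) :
  \prod_(i < wlength w) srw_step R (wvertex w i) (wvertex w i.+1) = ((2 * d)%:R ^+ wlength w)^-1.
Proof.
rewrite (eq_bigr (fun=> ((2 * d)%:R)^-1)).
  by rewrite prodr_const card_ord exprVn.
move=> i _; rewrite /srw_step.
have /pathP/(_ i (ltn_ord i)) : path (@adj d) (wstart w) (val w).2 by exact: (valP w).
by move=> h; rewrite ifT //; exact: h.
Qed.

Lemma killed_walk_pmfE (T : R) (x : lattice d) (w : W) :
  killed_walk_pmf T x w = (wstart w == x)%:R * (length_pmf T (wlength w) / (2 * d)%:R ^+ wlength w).
Proof. by rewrite /killed_walk_pmf srw_steps_prod mulrA. Qed.

Lemma FI_intensityE (u T : R) (A : set W) : 0 <= u -> 0 < T ->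
  FI_intensity u T A = \esum_(w in A) (walk_rate u T w)%:E.
Proof.
move=> u0 T0; have T1 : 0 < T + 1 by rewrite addr_gt0.
rewrite /FI_intensity /killed_walk.
pose r (w : W) : R := length_pmf T (wlength w) / (2 * d)%:R ^+ wlength w.
have r0 w : 0 <= r w.
  by rewrite /r /length_pmf !mulr_ge0 ?invr_ge0 ?exprn_ge0 ?divr_ge0 // ltW.
transitivity (\esum_(x in [set: lattice d]) \esum_(w in A `&` [set w | wstart w = x])
    (u * ((2 * d)%:R / (T + 1)) * r w)%:E).
  rewrite -esumZl // => [|x]; last first.
    by rewrite mule_ge0 // ?lee_fin ?divr_ge0 ?(ltW T1) //; apply: esum_ge0 => w _;
      rewrite lee_fin killed_walk_pmfE mulr_ge0 ?r0.
  apply: eq_esum => x _; rewrite esum_mkcondr -esumZl; last first.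
  - by move=> w; rewrite lee_fin killed_walk_pmfE mulr_ge0 ?r0.
  - by rewrite divr_ge0 // ltW.
  rewrite -esumZl //; last first.
    by move=> w; rewrite mule_ge0 ?lee_fin ?divr_ge0 ?(ltW T1) // killed_walk_pmfE mulr_ge0 ?r0.
  apply: eq_esum => w _; rewrite killed_walk_pmfE -/(r w) -!EFinM.
  case: ifPn; rewrite ?in_setE /=.
    by move=> <-; rewrite eqxx mul1r mulrA.
  by rewrite notin_setE /= => /eqP/negbTE ->; rewrite mul0r !mulr0.
pose J (x : lattice d) := A `&` [set w : W | wstart w = x].
rewrite (esum_esum (J := J) (a := fun _ w => (u * ((2 * d)%:R / (T + 1)) * r w)%:E)); last first.
  by move=> x w _ _; rewrite lee_fin mulr_ge0 ?r0 // mulr_ge0 // divr_ge0 // ltW.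
rewrite (@reindex_esum _ _ _ A _ (fun w => (wstart w, w))) /=; last first.
  split=> [w Aw|w w' _ _ [_ //]|[x w] [_ [/= Aw e]]]; first by split.
  by exists w; rewrite // e.
apply: eq_esum => w _; congr EFin; rewrite /walk_rate /r /length_pmf expr_div_n !exprS.
by field; rewrite !expf_neq0 ?gt_eqF // ltr0n; lia.
Qed.
End Intensity.

Section RealizationFacts.
Variables (R : realType) (d : nat).
Hypothesis d0 : (0 < d)%N.
Variables (u T : R).
Hypotheses (u0 : 0 <= u) (T0 : 0 < T).
Context (disp : measure_display) (Omega : measurableType disp) (P : probability Omega R).
Variable (N : Omega -> walk d -> nat).
Hypothesis FI : finitary_interlacement u T P N.
Notation W := (walk d).

Lemma poisson_prob0 (lam : R) k : 0 <= lam -> poisson_prob lam k [set 0%N] = (expR (- lam))%:E.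
Proof.
rewrite le_eqVlt /poisson_prob => /orP[/eqP <-|l0].
  by rewrite ltxx diracE mem_set // oppr0 expR0.
rewrite l0 esum_set1; last by rewrite lee_fin poisson_pmf_ge0.
by rewrite /poisson_pmf l0 expr0 mul1r fact0 invr1 mul1r.
Qed.

Lemma point_count_set1 (m : W -> nat) w : point_count R m [set w] = ((m w)%:R)%:E.
Proof. by rewrite /point_count esum_set1 // lee_fin. Qed.

Lemma FI_intensity_set1 (w : W) : FI_intensity u T [set w] = (walk_rate u T w)%:E.
Proof. by rewrite FI_intensityE // esum_set1 // lee_fin walk_rate_ge0 // ltW. Qed.

Lemma measurable_count_pred (w : W) (p : pred nat) : measurable [set t | p (N t w)].
Proof.
case: FI => mN _ _ _; rewrite -[X in measurable X]setTI.
by apply: (mN w measurableT [set n | p n]).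
Qed.

Lemma FI_no_walk (w : W) : P [set t | N t w = 0%N] = (expR (- walk_rate u T w))%:E.
Proof.
case: FI => _ H _ _; rewrite -(poisson_prob0 0) ?walk_rate_ge0 ?(ltW T0) //.
rewrite -(H [set w]) ?FI_intensity_set1 //; congr (P _); apply/seteqP; split=> t /=.
  by rewrite point_count_set1 => ->.
by rewrite point_count_set1 => -[] /eqP; rewrite eqr_nat => /eqP.
Qed.

Lemma FI_walk (w : W) : P [set t | (0 < N t w)%N] = (1 - expR (- walk_rate u T w))%:E.
Proof.
rewrite (_ : [set t | _] = ~` [set t | N t w = 0%N]).
  rewrite probability_setC ?FI_no_walk //.
  rewrite (_ : [set t | _] = [set t | N t w == 0%N]); first exact: (measurable_count_pred w (fun n => n == 0%N)).
  by apply/seteqP; split=> t /= /eqP.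
by apply/seteqP; split=> t /=; case: (N t w).
Qed.

Definition occupation_prob (w : W) : R :=
  if (0 < wlength w)%N then 1 - expR (- walk_rate u T w) else 0.

Lemma FI_bernoulli_field : bernoulli_field P (fun t => occupied (N t)) occupation_prob.
Proof.
split=> [w|s us].
  rewrite /occupied; case: (0 < wlength w)%N.
    rewrite (_ : [set t | _] = [set t | (0 < N t w)%N]); first exact: (measurable_count_pred w (fun n => 0 < n)%N).
    by apply/seteqP; split=> t /=; rewrite andbT.
  by rewrite (_ : [set t | _] = set0) //; apply/seteqP; split=> t /=; rewrite ?andbF.
have [/allP ls|/allPn[w ws]] := boolP (all (fun w : W => 0 < wlength w)%N s); last first.
  move=> lw; rewrite (_ : [set t | _] = set0) ?measure0.
    by rewrite (big_rem w) //= /occupation_prob (negbTE lw) mul0r.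
  by apply/seteqP; split=> t // /allP/(_ _ ws); rewrite /occupied (negbTE lw) andbF.
case: (FI) => _ _ _ H.
pose A (i : 'I_(size s)) : set W := [set tnth (in_tuple s) i].
have tA : trivIset setT A.
  move=> i j _ _ [w [/= wi wj]]; apply/ord_inj/eqP.
  rewrite -(nth_uniq w _ _ us) //; apply/eqP.
  by rewrite -[LHS](tnth_nth w (in_tuple s) i) -[RHS](tnth_nth w (in_tuple s) j) -wi -wj.
have mB : measurable [set x : \bar R | (0 < x)%E].
  rewrite (_ : [set x | _] = [set` `]0%E, +oo[%O]); first exact: emeasurable_itv.
  by apply/seteqP; split=> x /=; rewrite in_itv /= andbT.
have := H (size s) A (fun=> [set x | 0 < x]%E) tA (fun=> mB).
rewrite (_ : [set t | forall i, _] = [set t | cylinder s (occupied (N t))]); last first.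
  apply/seteqP; split=> t /=.
    move=> h; apply/allP => w ws; rewrite /occupied ls // andbT.
    have iw : (index w s < size s)%N by rewrite index_mem.
    have := h (Ordinal iw); rewrite point_count_set1 lte_fin ltr0n (tnth_nth w) /= nth_index //.
  move=> /allP h i; rewrite point_count_set1 lte_fin ltr0n.
  by have := h _ (mem_tnth i (in_tuple s)); rewrite /occupied => /andP[].
move=> ->.
rewrite [in RHS]big_tnth -prodEFin; apply: eq_bigr => i _.
rewrite /occupation_prob ls ?mem_tnth // -FI_walk; congr (P _).
by apply/seteqP; split=> t /=; rewrite point_count_set1 lte_fin ltr0n.
Qed.

Lemma measurable_percolates : measurable [set t | percolates (N t)].
Proof.
rewrite (set_percolates N).
by apply: measurable_event; [case: FI_bernoulli_field|exact: percolation_event_measurable].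
Qed.

Lemma percolates_01 : P [set t | percolates (N t)] = 0%E \/ P [set t | percolates (N t)] = 1%E.
Proof.
rewrite (set_percolates N).
apply: bernoulli_field_01 FI_bernoulli_field _ _; first exact: percolation_event_measurable.
exact: percolation_event_tail.
Qed.

Lemma ae_percolates : {ae P, forall t, percolates (N t)} <-> P [set t | percolates (N t)] = 1%E.
Proof.
have mp := measurable_percolates.
have C : P (~` [set t | percolates (N t)]) = (1 - P [set t | percolates (N t)])%E.
  exact: probability_setC.
split=> [h|h].
  have h' : P (~` [set t | percolates (N t)]) = 0%E by exact: (negligibleP _ (measurableC mp)).1 h.
  case: percolates_01 => // p0; move/eqP: h'; rewrite [X in X == _]C p0 sube0.
  by rewrite eqe oner_eq0.
apply/(negligibleP _ (measurableC mp)).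
have h' : P (~` [set t | percolates (N t)]) = 0%E by rewrite C h subee.
exact: h'.
Qed.

Lemma ae_not_percolates : {ae P, forall t, ~ percolates (N t)} <-> P [set t | percolates (N t)] = 0%E.
Proof.
have mp := measurable_percolates.
have e : ~` [set t | ~ percolates (N t)] = [set t | percolates (N t)].
  by apply/seteqP; split=> t /= => [/contrapT|h].
split=> [h|h].
  have : P.-negligible (~` [set t | ~ percolates (N t)]) := h.
  by rewrite e => /(negligibleP _ mp).
have : P.-negligible (~` [set t | ~ percolates (N t)]) by rewrite e; apply/(negligibleP _ mp).
by [].
Qed.

Lemma FI_avoid (s : seq W) : uniq s ->
  P [set t | forall w, w \in s -> N t w = 0%N] = (expR (- \sum_(w <- s) walk_rate u T w))%:E.
Proof.
move=> us; case: (FI) => _ H _ _.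
have r0 w : 0 <= walk_rate u T w by rewrite walk_rate_ge0 // ltW.
rewrite -(poisson_prob0 0) ?sumr_ge0 //.
rewrite -(H [set` s]); last first.
  rewrite FI_intensityE // esum_fset //; last by move=> w _; rewrite lee_fin.
  by rewrite -fsbig_seq // -sumEFin.
  exact: finite_seq.
congr (P _); apply/seteqP; split=> t /= h.
  by rewrite /point_count esum1 // => w /= /h ->.
move=> w ws; have : (((N t w)%:R)%:E <= (0%:R)%:E :> \bar R)%E.
  rewrite -h; apply: esum_ge; exists [set w]; last by rewrite fsbig_set1.
  by split => // v /= ->.
by rewrite lee_fin ler_nat leqn0 => /eqP.
Qed.

End RealizationFacts.

(** * Percolation for T >= 1/2 and large u *)

Section QuadrantEmbedding.
Variable d : nat.
Hypothesis d3 : (3 <= d)%N.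

Definition qpoint (p : nat * nat) : lattice d :=
  \row_(j < d) (if val j == 0%N then p.1%:Z else if val j == 1%N then p.2%:Z else 0).

Definition qsource (e : qedge) : nat * nat := e.2.
Definition qtarget (e : qedge) : nat * nat :=
  if e.1 then (e.2.1.+1, e.2.2) else (e.2.1, e.2.2.+1).

Definition qembed (e : qedge) : lattice d * lattice d := (qpoint (qsource e), qpoint (qtarget e)).

Let j0 : 'I_d := Ordinal (leq_trans (isT : 0 < 3)%N d3).
Let j1 : 'I_d := Ordinal (leq_trans (isT : 1 < 3)%N d3).

Lemma qpoint0 p : qpoint p ord0 j0 = p.1%:Z. Proof. by rewrite mxE. Qed.
Lemma qpoint1 p : qpoint p ord0 j1 = p.2%:Z. Proof. by rewrite mxE. Qed.

Lemma qpoint_inj : injective qpoint.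
Proof.
move=> [a b] [a' b'] e; have := congr1 (fun z : lattice d => z ord0 j0) e.
by have := congr1 (fun z : lattice d => z ord0 j1) e; rewrite !qpoint0 !qpoint1 /= => -[->] [->].
Qed.

Lemma qembed_inj : injective qembed.
Proof.
by move=> [[] [a b]] [[] [a' b']] [/qpoint_inj /= [-> ->] /qpoint_inj //= []]; lia.
Qed.

Lemma adj_qembed e : adj (qembed e).1 (qembed e).2.
Proof.
case: e => [[] [a b]]; rewrite /adj /=; [rewrite (bigD1 j0)|rewrite (bigD1 j1)] => //=; rewrite !mxE /=;
  (rewrite big1 ?addr0 => [|j]; [by apply/eqP; lia|]).
  by rewrite -val_eqE !mxE /= => /negbTE ->; case: ifP => _; rewrite subrr.
by rewrite -val_eqE !mxE /= => /negbTE ->; case: ifP => _; rewrite subrr.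
Qed.

Section PairWeight.
Variable R : realType.

Definition pair_const : R := 1 + 2 * green_const R d.

Lemma pair_const_ge1 : 1 <= pair_const.
Proof. by rewrite lerDl !mulr_ge0 // ltW // heat_const_gt0. Qed.

Lemma pair_weight_le k (e f : lattice d * lattice d) : pair_weight R k e f <= pair_const.
Proof.
rewrite /pair_weight /pair_const (_ : 2 = 1 + 1) // mulrDl mul1r addrA.
by rewrite !lerD ?green_bound // lern1 leq_b1.
Qed.

(** Endpoints lie within 1 of the base points, so some coordinate differs by at least
    [12 * 16 ^ n - 2 >= 16 ^ n], and [sqrt (16 ^ n) = 4 ^ n]. *)
Lemma green_far k e f n : (12 * 16 ^ n <= qdist e f)%N -> forall p q,
  p \in [:: qsource e; qtarget e] -> q \in [:: qsource f; qtarget f] ->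
  \sum_(0 <= l < k) srw_pmf R l (qpoint p - qpoint q) <= green_const R d / 4 ^+ n.
Proof.
move=> far p q pe qf; have n0 : (0 < 16 ^ n)%N by rewrite expn_gt0.
have s4 : Num.sqrt ((16 ^ n)%N%:R : R) = 4 ^+ n.
  rewrite natrX (_ : 16%:R = 4 ^+ 2 :> R) -?exprM 1?mulnC ?exprM ?sqrtr_sqr ?ger0_norm ?exprn_ge0 //.
  by rewrite -natrX.
have [i hi] : exists i, (16 ^ n <= `|(qpoint p - qpoint q)%R ord0 i|)%N.
  have pe' : (`|p.1%:Z - e.2.1%:Z| <= 1)%N /\ (`|p.2%:Z - e.2.2%:Z| <= 1)%N.
    by move: pe; rewrite !inE /qsource /qtarget => /orP[]/eqP->; case: (e.1) => /=; lia.
  have qf' : (`|q.1%:Z - f.2.1%:Z| <= 1)%N /\ (`|q.2%:Z - f.2.2%:Z| <= 1)%N.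
    by move: qf; rewrite !inE /qsource /qtarget => /orP[]/eqP->; case: (f.1) => /=; lia.
  have : (12 * 16 ^ n <= nat_dist e.2.1 f.2.1)%N \/ (12 * 16 ^ n <= nat_dist e.2.2 f.2.2)%N.
    by move: far; rewrite /qdist leq_max => /orP[]; [left|right].
  case=> h; [exists j0|exists j1]; rewrite !mxE /=; move: h; rewrite /nat_dist;
    by move: (16 ^ n)%N n0 pe' qf'; clear; move: (p.1) (p.2) (q.1) (q.2) (e.2.1) (e.2.2) (f.2.1) (f.2.2); lia.
by rewrite -s4; exact: green_decay hi.
Qed.

Lemma pair_weight_far k n e f : (12 * 16 ^ n <= qdist e f)%N ->
  pair_weight R k (qembed e) (qembed f) <= pair_const / 4 ^+ n.
Proof.
move=> far; have fe : (12 * 16 ^ n <= qdist f e)%N by rewrite qdist_sym.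
have ne : (qembed e == qembed f) = false.
  apply/eqP => /qembed_inj ef; move: far; rewrite ef qdistxx leqn0 muln_eq0 /= expn_eq0.
  by [].
rewrite /pair_weight ne add0r /pair_const mulrDl -[leLHS]add0r lerD ?divr_ge0 ?exprn_ge0 //.
rewrite (_ : 2 = 1 + 1) // mulrDl mul1r mulrDl.
by rewrite lerD // (green_far _ fe) // ?inE ?eqxx ?orbT.
Qed.
End PairWeight.

Section FiniteCluster.
Variable m : walk d -> nat.

Definition qclosed (e : qedge) : Prop := ~ open_edge m (qembed e).1 (qembed e).2.

Lemma open_edge_sym x y : open_edge m x y -> open_edge m y x.
Proof. by move=> [w mw [i iw h]]; exists w => //; exists i => //; case: h => -[]; [right|left]. Qed.

(** Take for [C] the quadrant vertices linked to the origin by edges that are open or lie in the box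
    of side [N]. It is finite, being covered by the clusters of the finitely many vertices of the
    box, and a boundary edge of [C] cannot be open. *)
Lemma closed_contour (N : nat) : ~ percolates m ->
  exists a t, (N <= a)%N /\ closed_chain qclosed (true, (a, 0%N)) (false, (0%N, t)).
Proof.
move=> np; pose inbox (p : nat * nat) := (p.1 <= N)%N && (p.2 <= N)%N.
pose good e := ~ qclosed e \/ (inbox (qsource e) && inbox (qtarget e)).
pose lnk (p q : nat * nat) := exists2 e, good e &
  (p = qsource e /\ q = qtarget e) \/ (p = qtarget e /\ q = qsource e).
pose Q p := clos_refl_trans _ lnk (0%N, 0%N) p.
pose C a b : bool := `[< Q (a, b) >].
have Clnk p q : Q p -> lnk p q -> Q q by move=> hp hpq; apply: rt_trans hp _; exact: rt_step.
have box : forall a b, (a <= N)%N -> (b <= N)%N -> C a b.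
  move=> a b aN bN; apply/asboolP; elim: b bN => [_|b IH bN].
    elim: a aN => [_|a IH aN]; first exact: rt_refl.
    apply: Clnk (IH (ltnW aN)) _; exists (true, (a, 0%N)); last by left.
    by right; rewrite /inbox /= aN (ltnW aN).
  apply: Clnk (IH (ltnW bN)) _; exists (false, (a, b)); last by left.
  by right; rewrite /inbox /= aN bN (ltnW bN).
have finQ : finite_set [set x | exists2 p, Q p & x = qpoint p].
  pose B := [seq qpoint (a, b) | a <- iota 0 N.+1, b <- iota 0 N.+1].
  have inB p : inbox p -> qpoint p \in B.
    case: p => a b /andP[/= aN bN]; apply/allpairsP; exists (a, b).
    by rewrite !mem_iota !add0n !ltnS [(a, b).1]/= [(a, b).2]/=; split.
  apply: (@sub_finite_set _ _ (\bigcup_(v in [set` B]) cluster m v)); last first.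
    apply: bigcup_finite; first exact: finite_seq.
    by move=> v _; apply: contrapT => hv; apply: np; exists v.
  move=> _ [p /(clos_rt_rtn1 _ _ _ _) qp ->].
  elim: qp => [|a b [e ge ab] _ [v vB va]].
    by exists (qpoint (0%N, 0%N)); [exact: inB|exact: rt_refl].
  have [oe|/andP[b1 b2]] := ge.
    exists v => //; apply: rt_trans va _; apply: rt_step; move/contrapT: oe.
    by case: ab => -[-> ->] //; exact: open_edge_sym.
  exists (qpoint b); last exact: rt_refl.
  by apply: inB; case: ab => -[_ ->].
have [M CM] : exists M, forall a b, C a b -> (a < M)%N && (b < M)%N.
  have /finite_seqP[s es] := finQ.
  exists (\max_(x <- s) maxn `|x ord0 j0|%N `|x ord0 j1|%N).+1 => a b /asboolP qab.
  have xs : qpoint (a, b) \in s.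
    have : [set x | exists2 p, Q p & x = qpoint p] (qpoint (a, b)) by exists (a, b).
    by rewrite es.
  have := @leq_bigmax_seq _ s predT (fun x : lattice d => maxn `|x ord0 j0|%N `|x ord0 j1|%N) _ xs isT.
  by rewrite qpoint0 qpoint1 geq_max /= !ltnS.
have Cconn (phi : nat -> nat -> bool) :
   (forall a b, C a b -> C a.+1 b -> phi a b = phi a.+1 b) ->
   (forall a b, C a b -> C a b.+1 -> phi a b = phi a b.+1) ->
   forall a b, C a b -> phi a b = phi 0%N 0%N.
  move=> h1 h2 a b /asboolP/(clos_rt_rtn1 _ _ _ _).
  suff H p : clos_refl_trans_n1 _ lnk (0%N, 0%N) p -> phi p.1 p.2 = phi 0%N 0%N by move/H.
  elim=> // y z yz hy <-.
  have Qy : Q y by apply: clos_rtn1_rt.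
  have Qz : Q z by apply: Clnk Qy yz.
  have {}Qy : C y.1 y.2 by apply/asboolP; case: (y) Qy.
  have {}Qz : C z.1 z.2 by apply/asboolP; case: (z) Qz.
  move: yz Qy Qz => [[[] [i j]] _ [] [-> ->]] /= Cp Cq.
  - by rewrite -h1.
  - by rewrite h1.
  - by rewrite -h2.
  - by rewrite h2.
have [a [t [Na ch]]] := contour_chain CM box Cconn.
exists a, t; split=> //.
have bcl e : qboundary C e -> qclosed e.
  move=> be oe; have ge : good e by left => h; exact: h oe.
  have e12 : Q (qsource e) <-> Q (qtarget e).
    by split=> h; apply: Clnk h _; exists e => //; [left|right].
  move: be; rewrite /qboundary; case: e {oe ge} e12 => -[] [i j] /= [h1 h2];
    rewrite /C; case: asboolP => [/h1|]; case: asboolP => //; by move=> /h2 ? ?.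
elim: ch => [x y [bx b_y xy]|x|x y z _ h1 _ h2].
- by apply: rt_step; split => //; exact: bcl.
- exact: rt_refl.
- exact: rt_trans h1 h2.
Qed.
End FiniteCluster.
End QuadrantEmbedding.

Lemma probability_union_seq (R : realType) (disp : measure_display) (T : measurableType disp)
    (P : probability T R) (I : eqType) (s : seq I) (A : I -> set T) (c : R) :
  (forall i, i \in s -> measurable (A i)) -> (forall i, i \in s -> P (A i) <= c%:E)%E ->
  measurable [set t | exists2 i, i \in s & A i t] /\
  (P [set t | exists2 i, i \in s & A i t] <= ((size s)%:R * c)%:E)%E.
Proof.
elim: s => [|x s IH] mA Pc.
  by rewrite (_ : mkset _ = set0) ?measure0 ?mul0r //; apply/seteqP; split=> // t [].
have [mB PB] : measurable [set t | exists2 i, i \in s & A i t] /\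
    (P [set t | exists2 i, i \in s & A i t] <= ((size s)%:R * c)%:E)%E.
  by apply: IH => i si; [apply: mA|apply: Pc]; rewrite inE si orbT.
have mx : measurable (A x) by apply: mA; rewrite inE eqxx.
rewrite (_ : [set t | _] = A x `|` [set t | exists2 i, i \in s & A i t]); last first.
  apply/seteqP; split=> t.
    by move=> [i]; rewrite inE => /orP[/eqP->|si Ai]; [left|right; exists i].
  by move=> [Ax|[i si Ai]]; [exists x|exists i] => //; rewrite inE ?eqxx ?si ?orbT.
split; first exact: measurableU.
apply: le_trans (measureU2 _ mx mB) _.
by rewrite /= -natr1 mulrDl mul1r addrC EFinD leeD // Pc // inE eqxx.
Qed.

(** The full series is [T / (T + 1)]; a finite part is kept so that finitely many walks suffice. For
    [k] up to [m], about [(T + 1) / 2], Bernoulli's inequality gives [(T / (T + 1)) ^+ k >= 1/2], so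
    the sum is at least [m (m+1) / (4 (T+1)^2)], where [m >= (T+1)/4] and [m+1 >= (T+1)/2]. For
    [T < 1] the term [k = 1] is enough. *)
Lemma length_mass_bound (R : realType) (T : R) : 2^-1 <= T ->
  exists m, 32^-1 <= \sum_(1 <= k < m.+1) k%:R * T ^+ k / (T + 1) ^+ k.+2.
Proof.
move=> T2; have T1 : 0 < T + 1 by lra.
have T0 : 0 < T by lra.
set f := fun k : nat => k%:R * T ^+ k / (T + 1) ^+ k.+2.
have [T1'|T1'] := ltP T 1.
  exists 1%N; rewrite big_nat1 /f expr1 mul1r ler_pdivlMr ?exprn_gt0 //.
  rewrite !exprS expr0 mulr1; nra.
set m := Num.truncn ((T + 1) / 2).
have /andP[m1 m2] : m%:R <= (T + 1) / 2 < m.+1%:R by apply: truncn_itv; lra.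
have m0 : (1 : R) <= m%:R by rewrite ler1n /m truncn_ge_nat //; lra.
rewrite -[m.+1%:R]natr1 in m2; exists m.
have low k : (k <= m)%N -> k%:R / 2 / (T + 1) ^+ 2 <= f k.
  move=> km; have : (k%:R : R) <= m%:R by rewrite ler_nat.
  have bern : 1 - k%:R / (T + 1) <= (T / (T + 1)) ^+ k.
    elim: k {km} => [|k IH]; first by rewrite mul0r subr0 expr0.
    have r0 : 0 <= T / (T + 1) by rewrite divr_ge0 // ltW.
    have r1 : T / (T + 1) = 1 - (T + 1)^-1 by field; rewrite gt_eqF.
    have k0 : (0 : R) <= k%:R by rewrite ler0n.
    have i0 : 0 < (T + 1)^-1 by rewrite invr_gt0.
    have i1 : (T + 1)^-1 <= 1 by rewrite invf_le1 //; lra.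
    rewrite exprSr -natr1; apply: le_trans (ler_wpM2r r0 IH).
    rewrite r1; nra.
  move=> km'; have -> : f k = k%:R * (T / (T + 1)) ^+ k / (T + 1) ^+ 2.
    rewrite /f expr_div_n !exprS; field; rewrite ?expf_neq0 ?gt_eqF //.
  rewrite ler_wpM2r ?invr_ge0 ?exprn_ge0 ?(ltW T1) // ler_wpM2l //.
  apply: le_trans bern; suff : k%:R / (T + 1) <= 2^-1 by lra.
  rewrite ler_pdivrMr //; lra.
have : \sum_(1 <= k < m.+1) k%:R / 2 / (T + 1) ^+ 2 <= \sum_(1 <= k < m.+1) f k.
  by rewrite !big_nat; apply: ler_sum => k /andP[_]; rewrite ltnS => /low.
apply: le_trans.
have -> : \sum_(1 <= k < m.+1) k%:R / 2 / (T + 1) ^+ 2 = m%:R * (m%:R + 1) / (4 * (T + 1) ^+ 2) :> R.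
  elim: (m) => [|n IH]; first by rewrite big_geq ?mul0r.
  by rewrite big_nat_recr //= IH -natr1; field; rewrite gt_eqF.
rewrite ler_pdivlMr ?mulr_gt0 ?exprn_gt0 //.
have h : (T + 1) / 4 * ((T + 1) / 2) <= m%:R * (m%:R + 1) by apply: ler_pM; lra.
by apply: le_trans h; rewrite le_eqVlt; apply/orP; left; apply/eqP; field.
Qed.

Section LargeT.
Variables (R : realType) (d : nat).
Hypothesis d3 : (3 <= d)%N.
Notation W := (walk d).
(* Kept opaque: powers of 16 must not be computed in unary. *)
Variable ell : nat.
Hypothesis ellE : ell = 16%N.

(** Here 96 is 32 from [length_mass_bound] times 3 from [sum_spread]. *)
Definition closing_const : R := (96 * pair_const d R)^-1.

Lemma closing_const_gt0 : 0 < closing_const.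
Proof. by rewrite invr_gt0 mulr_gt0 // (lt_le_trans _ (pair_const_ge1 _ _)). Qed.

Section Realization.
Variables (u T : R).
Hypotheses (u0 : 0 < u) (T2 : 2^-1 <= T).
Context (disp : measure_display) (Omega : measurableType disp) (P : probability Omega R).
Variable (N : Omega -> W -> nat).
Hypothesis FI : finitary_interlacement u T P N.

Let d0 : (0 < d)%N. Proof. exact: leq_trans d3. Qed.
Let T0 : 0 < T. Proof. by apply: lt_le_trans T2; rewrite invr_gt0. Qed.

(** For every [k >= 1] at least [2^n k (2d)^(k-1) / c] walks of length [k] cross an edge of [K],
    each of intensity [u T^k (2d)^(1-k) / (T+1)^(k+2)]. The powers of [2d] cancel, and summing over
    [k] gives a total of at least [2^n u / (32 c)]. The event [A] is that finitely many such walks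
    are all absent. *)
Lemma closed_edges_bound n e K : K \in spread ell n e ->
  exists A : set Omega, [/\ measurable A,
    forall t, (forall f, f \in K -> qclosed (N t) f) -> A t &
    (P A <= (expR (- (closing_const * u)) ^+ (2 ^ n))%:E)%E].
Proof.
move=> Ke; have l16 : (16 <= ell)%N by rewrite ellE.
have sK := spread_size l16 Ke.
have T1 : 0 < T + 1 by rewrite addr_gt0.
pose c := 3 * pair_const d R.
have c0 : 0 < c by rewrite mulr_gt0 // (lt_le_trans _ (pair_const_ge1 _ _)).
pose K' := [seq qembed d f | f <- K].
have many k : exists s : seq W, [/\ uniq s,
    forall w, w \in s -> wlength w = k /\ exists2 f, f \in K & traverses w (qembed d f).1 (qembed d f).2 &
    (2 ^+ n) * k%:R * (2 * d)%:R ^+ k.-1 / c <= (size s)%:R].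
  have hW : \sum_(e <- K') \sum_(f <- K') pair_weight R k e f <= c * (size K')%:R.
    rewrite size_map sK natrX big_map; under eq_bigr do rewrite big_map.
    apply: (sum_spread _ (W := fun e f => pair_weight R k (qembed d e) (qembed d f)) _ _ _ Ke).
    - by rewrite ellE.
    - by rewrite (le_trans _ (pair_const_ge1 _ _)).
    - by move=> f g; exact: pair_weight_le.
    - by move=> i f g; rewrite ellE; exact: pair_weight_far.
  have aK e' : e' \in K' -> adj e'.1 e'.2 by move=> /mapP[f _ ->]; exact: adj_qembed.
  have [s [us hs szs]] := many_crossing_walks d0 c0 aK hW.
  exists s; split => //; last by move: szs; rewrite size_map sK natrX.
  by move=> w /hs[wk [_ /mapP[f fK ->] tr]]; split => //; exists f.
have [s hs] := choice many.
have [m hm] := length_mass_bound T2.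
pose S := flatten [seq s k | k <- iota 1 m].
have uS : uniq S.
  suff H j i : uniq (flatten [seq s k | k <- iota i j]) by exact: H.
  elim: j i => //= j IH i; rewrite cat_uniq IH andbT; case: (hs i) => -> hi _ /=.
  apply/hasPn => w /flatten_mapP[k]; rewrite mem_iota => /andP[ik _] wk.
  apply/negP => /hi[wi _]; case: (hs k) => _ /(_ w wk)[wk' _] _.
  by move: ik; rewrite -wk' wi ltnn.
exists [set t | forall w, w \in S -> N t w = 0%N]; split.
- rewrite (_ : mkset _ = [set t | forall w, w \in S -> N t w == 0%N]); last first.
    by apply/seteqP; split=> t h w wS; apply/eqP; exact: h.
  apply: measurable_forall => w; have [wS|wS] := boolP (w \in S).
    rewrite (_ : mkset _ = [set t | N t w == 0%N]).
      exact: (measurable_count_pred FI w (fun n => n == 0%N)).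
    by apply/seteqP; split=> t /=; [apply|].
  rewrite (_ : mkset _ = setT) //; apply/seteqP; split=> t //= _ h.
- move=> t cl w /flatten_mapP[k _ wk]; apply/eqP; rewrite -leqn0 leqNgt; apply/negP => Nw.
  case: (hs k) => _ /(_ w wk)[_ [f fK tr]] _; apply: (cl f fK); by exists w.
rewrite (FI_avoid d0 (ltW u0) T0 FI uS) lee_fin -expRM_natl ler_expR mulrN lerN2.
rewrite /S big_flatten /= big_map natrX.
apply: (@le_trans _ _ (\sum_(1 <= k < m.+1) 2 ^+ n * u / c * (k%:R * T ^+ k / (T + 1) ^+ k.+2))).
  rewrite -mulr_sumr; apply: le_trans (ler_wpM2l _ hm); last first.
    by rewrite divr_ge0 ?(ltW c0) // mulr_ge0 ?exprn_ge0 ?(ltW u0).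
  rewrite le_eqVlt; apply/orP; left; apply/eqP; rewrite /closing_const /c; field.
  by rewrite gt_eqF // (lt_le_trans _ (pair_const_ge1 _ _)).
rewrite /index_iota subSS subn0 big_seq [leRHS]big_seq; apply: ler_sum => k; rewrite mem_iota => /andP[k1 _].
case: (hs k) => _ hk szk.
pose r := u * (2 * d)%:R * T ^+ k / (T + 1) ^+ k.+2 / (2 * d)%:R ^+ k.
have r0 : 0 <= r by rewrite !mulr_ge0 ?invr_ge0 ?exprn_ge0 // ltW.
have -> : \sum_(w <- s k) walk_rate u T w = (size (s k))%:R * r.
  rewrite big_seq (eq_bigr (fun=> r)); last by move=> w /hk[wk _]; rewrite /walk_rate wk.
  by rewrite -big_seq big_const_seq count_predT iter_addr_0 mulr_natl.
apply: le_trans (ler_wpM2r r0 szk); rewrite le_eqVlt; apply/orP; left; apply/eqP.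
rewrite /r; case: k k1 {hk szk r r0} => // k _ /=; rewrite [(2 * d)%:R ^+ k.+1]exprS; field.
rewrite !expf_neq0 ?gt_eqF ?ltr0n ?muln_gt0 //.
Qed.

Definition family_const : R := (18 * ell ^ 4)%N%:R.

Hypothesis large_u : expR (- (closing_const * u)) <= family_const^-1.

(** Borel-Cantelli over the scales. Under [large_u] the factor [(18 ell^4)^(2^n)] in the number of
    families is offset by the probability bound, and the prefactor in [size_spread] leaves a
    summable sequence. *)
Lemma percolates_large : {ae P, forall t, percolates (N t)}.
Proof.
have l16 : (16 <= ell)%N by rewrite ellE.
have l0 : (0 < ell)%N by exact: leq_trans l16.
have ex (x : nat * (qedge * seq qedge)) : exists S : set Omega, x.2.2 \in spread ell x.1 x.2.1 ->
    [/\ measurable S, forall t, (forall f, f \in x.2.2 -> qclosed (N t) f) -> S t &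
    (P S <= (expR (- (closing_const * u)) ^+ (2 ^ x.1))%:E)%E].
  case: x => n [e K].
  have [h|h] := boolP (K \in spread ell n e); last by exists set0 => h'; case/negP: h.
  by have [A hA] := closed_edges_bound h; exists A.
have [F hF] := choice ex.
pose idx n := [seq (true, (a, 0%N)) | a <- iota (ell ^ n) (ell ^ n.+1 - ell ^ n)] : seq qedge.
pose fam n := [seq (e, K) | e <- idx n, K <- spread ell n e].
pose E n := [set t | exists2 x, x \in fam n & F (n, x) t].
have famP n x : x \in fam n -> x.2 \in spread ell n x.1.
  by move=> /allpairsPdep[e [K [_ hK ->]]].
have size_fam n : (18 * ell ^ (2 * n.+2) * size (fam n) <= ell ^ n.+1 * (18 * ell ^ 4) ^ (2 ^ n))%N.
  rewrite size_allpairs_dep sumnE big_map big_distrr /=.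
  apply: (@leq_trans (\sum_(e <- idx n) (18 * ell ^ 4) ^ (2 ^ n))).
    by apply: leq_sum => e _; exact: size_spread.
  rewrite big_const_seq count_predT iter_addn_0 mulnC leq_mul2r size_map size_iota leq_subr.
  by rewrite orbT.
have A0 : 0 < family_const by rewrite ltr0n muln_gt0 expn_gt0 l0.
(* The form [2 / 2^(n+1)] is the one that [epsilon_trick0] sums. *)
have EP n : measurable (E n) /\ (P (E n) <= (2 / (2 ^ n.+1)%:R)%:E)%E.
  have [] := @probability_union_seq R _ _ P _ (fam n) (fun x => F (n, x))
    (expR (- (closing_const * u)) ^+ (2 ^ n)).
  - by move=> x /famP xs; case: (hF (n, x) xs).
  - by move=> x /famP xs; case: (hF (n, x) xs).
  move=> mE PE; split; first exact: mE.
  apply: le_trans PE _; rewrite lee_fin.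
  apply: (@le_trans _ _ ((size (fam n))%:R / family_const ^+ (2 ^ n))).
    by rewrite ler_wpM2l // -exprVn lerXn2r ?nnegrE ?expR_ge0 ?invr_ge0 // ltW.
  rewrite ler_pdivrMr ?exprn_gt0 // mulrAC ler_pdivlMr ?ltr0n ?expn_gt0 // /family_const.
  rewrite -!natrX -!natrM ler_nat.
  set Z := ((18 * ell ^ 4) ^ 2 ^ n)%N in size_fam *.
  have e1 : (18 * ell ^ (2 * n.+2) = ell ^ n.+1 * (18 * ell ^ n.+3))%N.
    by rewrite mulnCA -expnD; congr (_ * ell ^ _)%N; lia.
  have h1 := size_fam n; rewrite e1 -mulnA leq_pmul2l ?expn_gt0 ?l0 // in h1.
  have h2 : (2 ^ n.+1 <= 18 * ell ^ n.+3)%N.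
    apply: (@leq_trans (ell ^ n.+1)); first by rewrite leq_exp2r // (leq_trans _ l16).
    by apply: leq_trans (leq_pexp2l l0 (_ : n.+1 <= n.+3)%N) _; rewrite ?leq_pmull //; lia.
  have h3 := leq_mul h2 (leqnn (size (fam n))).
  have h4 := leq_trans h3 h1.
  by rewrite mulnC (leq_trans h4) // leq_pmull.
have sumE : (\sum_(n <oo) P (E n) < +oo)%E.
  apply: (@le_lt_trans _ _ (\sum_(n <oo) (2 / (2 ^ n.+1)%:R)%:E)%E).
    apply: lee_nneseries => [n _ _|n _]; [exact: measure_ge0|exact: (EP n).2].
  by apply: le_lt_trans (epsilon_trick0 _ _) (ltry _).
have := lim_sup_set_cvg0 (fun n => (EP n).1) sumE.
move=> null; apply/(ae_percolates d0 (ltW u0) T0 FI).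
have mp := measurable_percolates d0 (ltW u0) T0 FI.
have mE n : measurable (E n) by case: (EP n).
have mL : measurable (lim_sup_set E).
  by apply: bigcap_measurableType => n _; apply: bigcup_measurable => k _.
have sub : ~` [set t | percolates (N t)] `<=` lim_sup_set E.
  move=> t np n _; have [a [b [na ch]]] := closed_contour d3 (ell ^ n) np.
  have a0 : (0 < a)%N by apply: leq_trans na; rewrite expn_gt0 l0.
  have l1 : (1 < ell)%N by exact: leq_trans l16.
  (* The contour may start farther out than scale [n]; [k] is its actual scale. *)
  pose k := trunc_log ell a.
  have /andP[ka ak] := trunc_log_bounds l1 a0.
  have nk : (n <= k)%N by rewrite /k trunc_log_max.
  (* An empty chain would say nothing about its end, but here the two ends are at positive
     distance. *)
  have cl : qclosed (N t) (true, (a, 0%N)).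
    have H e f : clos_refl_trans_1n _ (closed_adj (qclosed (N t))) e f ->
        (0 < qdist e f)%N -> qclosed (N t) e.
      by case=> [|y z [cy _ _] _ _ //]; rewrite qdistxx.
    apply: H (clos_rt_rt1n _ _ _ _ ch) _; rewrite /qdist /nat_dist /=; lia.
  have far : (ell ^ k <= qdist (true, (a, 0%N)) (false, (0%N, b)))%N.
    by apply: leq_trans ka _; rewrite /qdist /nat_dist /=; lia.
  have [K Ke cK] := spread_chain l16 cl ch far.
  exists k => //; exists ((true, (a, 0%N)), K); last first.
    by case: (hF (k, ((true, (a, 0%N)), K)) Ke) => _ h _; exact: h.
  apply/allpairsPdep; exists (true, (a, 0%N)), K; split=> //.
  by apply/mapP; exists a => //; rewrite mem_iota ka subnKC ?ak // leq_exp2l.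
have /eqP : P (~` [set t | percolates (N t)]) = 0%E.
  apply/eqP; rewrite eq_le measure_ge0 andbT -null.
  by apply: le_measure; rewrite ?inE //; exact: measurableC.
case: (percolates_01 d0 (ltW u0) T0 FI) => // p0.
by rewrite probability_setC // p0 sube0 eqe oner_eq0.
Qed.

End Realization.

Lemma large_u_percolates : exists U : R, forall u T : R, 0 < u -> U <= u -> 2^-1 <= T ->
  FI_as_percolates d u T.
Proof.
have A0 : 0 < family_const by rewrite ltr0n muln_gt0 expn_gt0 ellE.
have k0 := closing_const_gt0.
exists (ln family_const / closing_const) => u T u0 Uu T2 disp Omega P N FI.
apply: (percolates_large u0 T2 FI).
rewrite -[leRHS]lnK ?posrE ?invr_gt0 // ler_expR lnV ?posrE // lerN2.
by rewrite mulrC -ler_pdivrMr.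
Qed.
End LargeT.

(** * Absence of percolation for small T *)

Section WalksThrough.
Variable d : nat.
Notation W := (walk d).

Lemma nth_scanl (x : lattice d) s j : (j <= size s)%N ->
  nth 0 (x :: scanl +%R x s) j = x + nth 0 (0 :: scanl +%R 0 s) j.
Proof.
elim: s x j => [|a s IH] x [|j] //= js; rewrite ?addr0 //.
have := IH (x + a) j js; have := IH (0 + a) j js; rewrite /= => -> ->.
by rewrite add0r addrA.
Qed.

(** The word [s] is translated so that its [j]-th vertex is [v]. *)
Definition walks_through (k : nat) (v : lattice d) : seq W :=
  pmap insub [seq (let x := v - nth 0 (0 :: scanl +%R 0 s) j in (x, scanl +%R x s)) |
    j <- iota 0 k.+1, s <- words d k].

Lemma size_walks_through k v : (size (walks_through k v) <= k.+1 * (2 * d) ^ k)%N.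
Proof.
by rewrite size_pmap (leq_trans (count_size _ _)) // size_allpairs size_iota size_words.
Qed.

Lemma walks_through_length k v (w : W) : w \in walks_through k v -> wlength w = k.
Proof.
rewrite mem_pmap_sub => /allpairsP[[j s] [/= _ hs]]; case: w => [[x p] hp] /= [_ ep].
by rewrite /wlength /= ep size_scanl (words_size hs).
Qed.

Lemma path_words (x : lattice d) p : path (@adj d) x p ->
  exists2 s, s \in words d (size p) & p = scanl +%R x s.
Proof.
elim: p x => [|y p IH] x /=; first by exists [::].
move=> /andP[xy /IH[s hs ep]]; exists (y - x :: s).
  by apply/allpairsP; exists (y - x, s); split=> //=; rewrite -adj_steps.
by rewrite /= subrKC {1}ep.
Qed.

Lemma walks_throughP (w : W) v : v \in wvertices w -> w \in walks_through (wlength w) v.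
Proof.
case: w => [[x p] hp] vw; rewrite mem_pmap_sub.
have [s hs ep] : exists2 s, s \in words d (size p) & p = scanl +%R x s by exact: path_words hp.
have sp : size s = size p by exact: words_size hs.
have [j jp ev] : exists2 j, (j <= size p)%N & v = nth 0 (x :: p) j.
  by exists (index v (x :: p)); [rewrite -ltnS -[(size p).+1]/(size (x :: p)) index_mem|rewrite nth_index].
apply/allpairsP; exists (j, s); split; rewrite ?mem_iota //.
have e : v - nth 0 (0 :: scanl +%R 0 s) j = x by rewrite ev ep nth_scanl ?sp // addrK.
by rewrite /= e -ep.
Qed.

(** Connection is recorded at the level of whole walks rather than edges, because the presences of
    distinct walks are independent. *)
Fixpoint linked (v : lattice d) (c : seq W) (y : lattice d) : Prop :=
  if c is w :: c' then
    [/\ v \in wvertices w, (0 < wlength w)%N & exists2 z, z \in wvertices w & linked z c' y]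
  else v = y.

Lemma linked_cat v c c' y : linked v (c ++ c') y <-> exists2 z, linked v c z & linked z c' y.
Proof.
elim: c v => [|w c IH] v /=; first by split=> [h|[z -> //]]; exists v.
split=> [[vw w0 [z zw /IH[z' h1 h2]]]|[z [vw w0 [z' h1 h2]] h3]].
  by exists z' => //; split=> //; exists z.
by split=> //; exists z' => //; apply/IH; exists z.
Qed.

(* Cutting out the part of a chain between two visits to the same walk. *)
Lemma linked_uniq v c y : linked v c y -> exists c', [/\ uniq c', {subset c' <= c} & linked v c' y].
Proof.
elim: c v => [|w c IH] v /=; first by exists [::].
move=> [vw w0 [z zw /IH[c' [uc sc lc]]]]; have [wc|wc] := boolP (w \in c'); last first.
  exists (w :: c'); split=> /=; rewrite ?wc //; last by split=> //; exists z.
  by move=> w'; rewrite !inE => /orP[->//|/sc ->]; rewrite orbT.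
case/splitPr: wc uc sc lc => c1 c2; rewrite cat_uniq => /and3P[_ _ u2] sc.
move=> /linked_cat[z' _ [_ _ h]]; exists (w :: c2); split=> //.
  by move=> w'; rewrite !inE => /orP[->//|h']; rewrite sc ?orbT // mem_cat inE h' !orbT.
Qed.

Lemma cluster_linked (m : W -> nat) x y : cluster m x y ->
  exists c, [/\ uniq c, forall w, w \in c -> (0 < m w)%N && (0 < wlength w)%N & linked x c y].
Proof.
move=> /(clos_rt_rt1n _ _ _ _) h.
suff [c mc lc] : exists2 c, forall w, w \in c -> (0 < m w)%N && (0 < wlength w)%N & linked x c y.
  by have [c' [uc sc lc']] := linked_uniq lc; exists c'; split => // w /sc/mc.
elim: h => [z|a b e [w mw tw] _ [c mc lc]]; first by exists [::].
have w0 := traverses_wlength tw.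
exists (w :: c); first by move=> w'; rewrite inE => /orP[/eqP->|/mc //]; rewrite mw.
case: tw => i iw h; split=> //.
  by case: h => [[<- _]|[_ <-]]; apply: wvertex_mem => //; exact: ltnW.
exists b => //.
by case: h => [[_ <-]|[<- _]]; apply: wvertex_mem => //; exact: ltnW.
Qed.

Definition total_length (c : seq W) : nat := sumn [seq wlength w | w <- c].

(** Induction on the first walk, of length [k+1]. There are at most [(k+2) (2d)^(k+1)] such walks
    through [v], with [k+2] exit vertices each, in all at most [(8d)^(k+1)] choices since
    [(k+2)^2 <= 4^(k+1)]. Passing from 8 to 16 makes room for the sum over [k]: [(8d)^(n+1)] times
    the sum of the [2^(n-k)] is less than [(16d)^(n+1)]. *)
Lemma linked_list n v : (0 < d)%N -> exists L : seq (seq W * lattice d),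
  (size L <= (16 * d) ^ n)%N /\ forall c y, linked v c y -> total_length c = n -> (c, y) \in L.
Proof.
move=> d0; elim/ltn_ind: n v => n IH v.
case: n IH => [|n] IH.
  exists [:: ([::], v)]; split=> // -[|w c] y /=; first by move=> ->; rewrite inE.
  by move=> [_ w0 _]; rewrite /total_length /=; lia.
have {}IH (kz : nat * lattice d) : exists L : seq (seq W * lattice d), (size L <= (16 * d) ^ (n - kz.1))%N /\
    forall c y, linked kz.2 c y -> total_length c = (n - kz.1)%N -> (c, y) \in L.
  by apply: IH; rewrite ltnS leq_subr.
have [L hL] := choice IH.
pose G k w := [seq (w :: cy.1, cy.2) | cy <- flatten [seq L (k, z) | z <- wvertices w]].
exists (flatten [seq flatten [seq G k w | w <- walks_through k.+1 v] | k <- iota 0 n.+1]).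
split; last first.
  move=> [|w c] y; first by [].
  move=> [vw w0 [z zw lc]] tot.
  have [k wk] : exists k, wlength w = k.+1 by exists (wlength w).-1; rewrite prednK.
  have kn : (k <= n)%N by move: tot; rewrite /total_length /= wk; lia.
  apply/flatten_mapP; exists k; first by rewrite mem_iota.
  apply/flatten_mapP; exists w; first by rewrite -wk; exact: walks_throughP.
  apply/mapP; exists (c, y) => //; apply/flatten_mapP; exists z => //.
  apply: (hL (k, z)).2 => //; move: tot; rewrite /total_length /= wk; lia.
have sG k w : w \in walks_through k.+1 v -> (size (G k w) <= k.+2 * (16 * d) ^ (n - k))%N.
  move=> /walks_through_length wk; rewrite size_map size_flatten sumnE !big_map.
  apply: (@leq_trans (\sum_(z <- wvertices w) (16 * d) ^ (n - k))).
    by apply: leq_sum => z _; case: (hL (k, z)).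
  rewrite big_const_seq count_predT iter_addn_0 mulnC leq_mul2r.
  by rewrite /= -[size _]/(wlength w) wk leqnn orbT.
rewrite size_flatten sumnE !big_map.
apply: (@leq_trans (\sum_(k <- iota 0 n.+1) (8 * d) ^ n.+1 * 2 ^ (n - k))).
  rewrite big_seq [leqRHS]big_seq; apply: leq_sum => k; rewrite mem_iota add0n ltnS => kn.
  rewrite size_flatten sumnE !big_map.
  apply: (@leq_trans (\sum_(w <- walks_through k.+1 v) k.+2 * (16 * d) ^ (n - k))).
    by rewrite big_seq [leqRHS]big_seq; apply: leq_sum => w; exact: sG.
  rewrite big_const_seq count_predT iter_addn_0 mulnC.
  apply: leq_trans (leq_mul (size_walks_through _ _) (leqnn _)) _.
  have sq j : (j.+2 * j.+2 <= 4 ^ j.+1)%N by elim: j => // j IHj; rewrite expnS; nia.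
  have -> : (k.+2 * (2 * d) ^ k.+1 * (k.+2 * (16 * d) ^ (n - k)) =
     (k.+2 * k.+2) * ((2 * d) ^ k.+1 * (16 * d) ^ (n - k)))%N by ring.
  apply: leq_trans (leq_mul (sq k) (leqnn _)) _.
  have -> : (n.+1 = k.+1 + (n - k))%N by lia.
  rewrite expnD -(mulnA (_ ^ k.+1)%N) -(expnMn (8 * d)%N 2%N) mulnA -(expnMn 4%N (2 * d)%N).
  by rewrite (_ : 4 * (2 * d) = 8 * d)%N 1?(_ : 8 * d * 2 = 16 * d)%N //; ring.
rewrite -big_distrr /= (_ : 16 * d = 8 * d * 2)%N; last by ring.
rewrite [leqRHS]expnMn leq_mul2l; apply/orP; right.
suff : (\sum_(k <- iota 0 n.+1) 2 ^ (n - k) < 2 ^ n.+1)%N by move/ltnW.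
rewrite -[iota 0 n.+1]/(index_iota 0 n.+1) big_nat_rev /= add0n.
rewrite (eq_big_nat _ _ (F2 := fun k => 2 ^ k)%N); last by move=> k /andP[_ kn]; congr (_ ^ _)%N; lia.
elim: (n.+1) => [|j IHj]; first by rewrite big_geq.
by rewrite big_nat_recr //= expnS; lia.
Qed.
End WalksThrough.

Section SmallT.
Variables (R : realType) (d : nat).
Hypothesis d0 : (0 < d)%N.
Notation W := (walk d).
Variables (u T : R).
Hypotheses (u0 : 0 < u) (T0 : 0 < T) (T_small : (32 * d)%:R * (1 + u * (2 * d)%:R) * T <= 1).
Context (disp : measure_display) (Omega : measurableType disp) (P : probability Omega R).
Variable (N : Omega -> W -> nat).
Hypothesis FI : finitary_interlacement u T P N.

Let c0 : R := 1 + u * (2 * d)%:R.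

(** For [k >= 1] one has [1 - exp (- r) <= r <= 2 d u T^k], and [c0] is at least 1 and at least
    [2 d u], so that [2 d u <= c0^k]. *)
Lemma occupation_prob_le (w : W) : occupation_prob u T w <= (c0 * T) ^+ wlength w.
Proof.
have c1 : 1 <= c0 by rewrite lerDl mulr_ge0 // ltW.
rewrite /occupation_prob; case: ifP => [w0|_]; last by rewrite exprn_ge0 // mulr_ge0 ?(ltW T0) // (le_trans _ c1).
apply: (@le_trans _ _ (walk_rate u T w)).
  by have := expR_ge1Dx (- walk_rate u T w); lra.
have -> : walk_rate u T w = u * (2 * d)%:R * (T ^+ wlength w / (T + 1) ^+ (wlength w).+2 /
    (2 * d)%:R ^+ wlength w) by rewrite /walk_rate !mulrA.
rewrite exprMn.
case: (wlength w) w0 => // k _.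
have key (a x y : R) : 0 <= a -> 1 <= x -> 1 <= y -> a / x / y <= a.
  move=> a0 x1 y1; rewrite ler_pdivrMr ?(lt_le_trans _ y1) // ler_pdivrMr ?(lt_le_trans _ x1) //.
  by rewrite -mulrA ler_peMr // -[leLHS]mulr1 ler_pM.
have h1 : T ^+ k.+1 / (T + 1) ^+ k.+3 / (2 * d)%:R ^+ k.+1 <= T ^+ k.+1.
  apply: key; first by rewrite exprn_ge0 // ltW.
    by rewrite exprn_ege1 // lerDr ltW.
  by rewrite exprn_ege1 // ler1n muln_gt0.
have h2 : u * (2 * d)%:R <= c0 ^+ k.+1.
  apply: (@le_trans _ _ c0); first by rewrite /c0 lerDr.
  by rewrite exprS ler_peMr ?(le_trans _ c1) // exprn_ege1.
apply: ler_pM => //; first by rewrite mulr_ge0 // ltW.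
by rewrite !mulr_ge0 ?invr_ge0 ?exprn_ge0 ?addr_ge0 // ltW.
Qed.

Lemma prob_occupied (c : seq W) : uniq c ->
  (P [set t | cylinder c (occupied (N t))] <= ((c0 * T) ^+ total_length c)%:E)%E.
Proof.
move=> uc; case: (FI_bernoulli_field d0 (ltW u0) T0 FI) => _ /(_ c uc) ->; rewrite lee_fin.
elim: c {uc} => [|w c IH]; first by rewrite big_nil expr0.
rewrite big_cons /total_length /= exprD ler_pM //.
- rewrite /occupation_prob; case: ifP => // _; rewrite subr_ge0 expR_le1 oppr_le0.
  by rewrite walk_rate_ge0 // ltW.
- apply: prodr_ge0 => w' _; rewrite /occupation_prob; case: ifP => // _.
  by rewrite subr_ge0 expR_le1 oppr_le0 walk_rate_ge0 // ltW.
- exact: occupation_prob_le.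
Qed.

(** At most [(16d)^n] chains of total length [n] start from [x], each present with probability at
    most [(c0 T)^n]. By [T_small] the product is at most [2^(-n)], and Borel-Cantelli applies. *)
Lemma not_percolates_small : {ae P, forall t, ~ percolates (N t)}.
Proof.
have mp := measurable_percolates d0 (ltW u0) T0 FI.
apply/(ae_not_percolates d0 (ltW u0) T0 FI).
have mcyl c : measurable [set t | cylinder c (occupied (N t))].
  by case: (FI_bernoulli_field d0 (ltW u0) T0 FI) => mo _; exact: measurable_cylinder.
have [L hL] := choice (fun xn : lattice d * nat => linked_list xn.2 xn.1 d0).
pose chains x n := [seq cy <- L (x, n) | uniq cy.1 && (total_length cy.1 == n)].
pose E x n := [set t | exists2 cy, cy \in chains x n & cylinder cy.1 (occupied (N t))].
have EP x n : measurable (E x n) /\ (P (E x n) <= (2 / (2 ^ n.+1)%:R)%:E)%E.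
  have [] := @probability_union_seq R _ _ P _ (chains x n)
    (fun cy => [set t | cylinder cy.1 (occupied (N t))]) ((c0 * T) ^+ n).
  - by [].
  - move=> cy; rewrite mem_filter => /andP[/andP[uc /eqP <-] _]; exact: prob_occupied.
  move=> mE PE; split=> //; apply: le_trans PE _; rewrite lee_fin.
  have c00 : 0 <= c0 * T by rewrite mulr_ge0 ?(ltW T0) // addr_ge0 // mulr_ge0 // ltW.
  apply: (@le_trans _ _ (((16 * d) ^ n)%N%:R * (c0 * T) ^+ n)).
    rewrite ler_wpM2r ?exprn_ge0 // ler_nat size_filter (leq_trans (count_size _ _)) //.
    by case: (hL (x, n)).
  rewrite natrX -exprMn.
  have -> : 2 / (2 ^ n.+1)%:R = 2^-1 ^+ n :> R.
    by rewrite natrX exprS exprVn; field; rewrite expf_neq0.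
  have c16 : 0 <= (16 * d)%:R * (c0 * T) by rewrite mulr_ge0.
  rewrite lerXn2r ?nnegrE ?invr_ge0 //.
  have e : (32 * d)%:R * (1 + u * (2 * d)%:R) * T = 2 * ((16 * d)%:R * (c0 * T)).
    by rewrite -/c0 !natrM; ring.
  by have := T_small; rewrite e; move: (_ * (c0 * T)) => X; lra.
have null x : P (lim_sup_set (E x)) = 0%E.
  apply: lim_sup_set_cvg0; first by move=> n; case: (EP x n).
  apply: (@le_lt_trans _ _ (\sum_(n <oo) (2 / (2 ^ n.+1)%:R)%:E)%E).
    by apply: lee_nneseries => [n _ _|n _]; [exact: measure_ge0|exact: (EP x n).2].
  by apply: le_lt_trans (epsilon_trick0 _ _) (ltry _).
have mL x : measurable (lim_sup_set (E x)).
  by apply: bigcap_measurableType => n _; apply: bigcup_measurable => k _; case: (EP x k).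
have neg : P.-negligible [set t | exists x, lim_sup_set (E x) t].
  pose F n := if unpickle n is Some x then lim_sup_set (E x) else set0.
  apply: (@negligibleS _ _ _ _ (\bigcup_n F n)).
    by move=> t [x hx]; exists (pickle x) => //; rewrite /F pickleK.
  apply: negligible_bigcup => n; rewrite /F; case: unpickle => [x|]; last exact: negligible_set0.
  by apply/(negligibleP _ (mL x)); exact: null.
have sub : [set t | percolates (N t)] `<=` [set t | exists x, lim_sup_set (E x) t].
  move=> t [x inf]; exists x => n _.
  (* Only finitely many vertices end a chain of total length below [n]; an infinite cluster contains
     another one. *)
  have [y [xy yn]] := (infinite_set_seq _).1 inf (flatten [seq [seq cy.2 | cy <- L (x, k)] | k <- iota 0 n]).
  have [c [uc oc lc]] := cluster_linked xy.
  exists (total_length c); last first.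
    exists (c, y); last by apply/allP => w /oc.
    by rewrite mem_filter /= uc eqxx; exact: (hL (x, _)).2.
  rewrite /= leqNgt; apply: contra yn => cn; apply/flatten_mapP; exists (total_length c).
    by rewrite mem_iota.
  by apply/mapP; exists (c, y) => //; exact: (hL (x, _)).2.
by have /(negligibleP _ mp) := negligibleS sub neg.
Qed.
End SmallT.

(** * Existence of Poisson point processes and couplings *)

Section IndependentSequence.
Variable R : realType.

(** Total mass 1 is put in the form that [quantile] uses: the partial sums exceed every [x < 1]. *)
Definition is_pmf (p : nat -> R) : Prop :=
  [/\ forall k, 0 <= p k, forall k, \sum_(j < k) p j <= 1 &
      forall x, x < 1 -> exists k, x < \sum_(j < k) p j].

(* The n-th value is the quantile, for the n-th law, of a uniform variable; what remains of the
   latter, rescaled to [0, 1), is again uniform and independent of that value. *)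
Section NestedIntervals.
Variable p : nat -> nat -> R.
Hypothesis pP : forall i, is_pmf (p i).

Definition cdf_below (i k : nat) : R := \sum_(j < k) p i j.

Lemma cdf_belowS i k : cdf_below i k.+1 = cdf_below i k + p i k.
Proof. by rewrite /cdf_below big_ord_recr. Qed.

Lemma cdf_below_homo i j k : (j <= k)%N -> cdf_below i j <= cdf_below i k.
Proof.
move=> /subnK <-; elim: (k - j)%N => [|n IH]; first by rewrite add0n.
by rewrite addSn cdf_belowS (le_trans IH) // lerDl; case: (pP i).
Qed.

Definition in_unit (u : R) : bool := (0 <= u) && (u < 1).

Lemma quantile_subproof i u : exists k, ~~ in_unit u || (cdf_below i k <= u < cdf_below i k.+1).
Proof.
have [/andP[u0 u1]|_] := boolP (in_unit u); last by exists 0%N.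
have [_ _ /(_ u u1)[k uk]] := pP i.
have ex : exists k, u < cdf_below i k by exists k.
case: (ex_minnP ex) => -[|m] um mmin.
  by move: um; rewrite /cdf_below big_ord0 ltNge u0.
exists m; rewrite um andbT /=; rewrite leNgt; apply/negP => /mmin; by rewrite ltnn.
Qed.

Definition quantile i u : nat := xchoose (quantile_subproof i u).
Definition rescale i u : R := (u - cdf_below i (quantile i u)) / p i (quantile i u).

Lemma quantileP i u k : in_unit u -> (quantile i u == k) = (cdf_below i k <= u < cdf_below i k.+1).
Proof.
move=> uu; have /orP[|/andP[h1 h2]] := xchooseP (quantile_subproof i u); first by rewrite uu.
rewrite -/(quantile i u) in h1 h2.
apply/eqP/idP => [<-|/andP[h3 h4]]; first by rewrite h1 h2.
apply/eqP; rewrite eqn_leq; apply/andP; split; rewrite leqNgt; apply/negP => /(cdf_below_homo i) h.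
  by have := lt_le_trans h4 (le_trans h h1); rewrite ltxx.
by have := lt_le_trans h2 (le_trans h h3); rewrite ltxx.
Qed.

Lemma rescale_unit i u : in_unit u -> in_unit (rescale i u).
Proof.
move=> uu; have := quantileP i (quantile i u) uu; rewrite eqxx => /esym/andP[h1 h2].
rewrite cdf_belowS in h2; have p0 : 0 < p i (quantile i u).
  by rewrite -(ltrD2l (cdf_below i (quantile i u))) addr0 (le_lt_trans h1).
by rewrite /in_unit /rescale divr_ge0 ?subr_ge0 ?(ltW p0) //= ltr_pdivrMr // mul1r ltrBlDl.
Qed.

Fixpoint remainder (i : nat) (u : R) (n : nat) : R :=
  if n is n'.+1 then rescale (i + n') (remainder i u n') else u.

Fixpoint digits_match (i : nat) (u : R) (s : seq nat) : Prop :=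
  if s is k :: s' then quantile i u = k /\ digits_match i.+1 (rescale i u) s' else True.

(** The first digit [k] confines [u] to an interval of length [p i k], which [rescale] maps affinely
    onto the unit interval; the other digits cut out a subinterval there. *)
Lemma digits_match_itv i s : exists a, [/\ 0 <= a,
  a + \prod_(j < size s) p (i + j) (nth 0%N s j) <= 1 &
  forall u, in_unit u -> digits_match i u s <->
    a <= u < a + \prod_(j < size s) p (i + j) (nth 0%N s j)].
Proof.
elim: s i => [|k s IH] i.
  by exists 0; rewrite /= big_ord0 add0r; split=> // u /andP[-> ->].
have [a [a0 a1 ha]] := IH i.+1.
rewrite /= big_ord_recl /= addn0.
have -> : \prod_(j < size s) p (i + lift ord0 j) (nth 0%N s j) =
    \prod_(j < size s) p (i.+1 + j) (nth 0%N s j).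
  by apply: eq_bigr => j _; rewrite /= /bump /= addnS.
set q := \prod_(j < size s) _ in a1 ha *; have [pi0 pi1 _] := pP i.
have q0 : 0 <= q by apply: prodr_ge0 => j _; case: (pP (i.+1 + j)).
have c0 : 0 <= cdf_below i k by apply: sumr_ge0.
have c1 : cdf_below i k + p i k <= 1 by rewrite -cdf_belowS; exact: pi1.
exists (cdf_below i k + p i k * a); split.
- by rewrite addr_ge0 // mulr_ge0.
- rewrite -addrA -mulrDr; apply: le_trans c1; rewrite lerD2l -[leRHS]mulr1 ler_wpM2l //.
(* A value of probability 0 is never taken, and the interval is empty. *)
move=> u uu; have [pk|pk] := eqVneq (p i k) 0.
  rewrite pk !mul0r !addr0; split=> [[/eqP]|/andP[h1 h2]].
    by rewrite quantileP // cdf_belowS pk addr0 => /andP[h1 h2]; have := le_lt_trans h1 h2; rewrite ltxx.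
  by have := le_lt_trans h1 h2; rewrite ltxx.
have pk0 : 0 < p i k by rewrite lt0r pk pi0.
have key : quantile i u = k -> digits_match i.+1 (rescale i u) s <->
    cdf_below i k + p i k * a <= u < cdf_below i k + p i k * a + p i k * q.
  move=> qk; have -> : (cdf_below i k + p i k * a <= u < cdf_below i k + p i k * a + p i k * q) =
     (a <= rescale i u < a + q).
    rewrite /rescale qk ler_pdivlMr // ltr_pdivrMr // -addrA -mulrDr.
    by rewrite ![p i k * _]mulrC lerBrDl ltrBlDl.
  by apply: ha; exact: rescale_unit.
split=> [[qk h]|h]; first by apply/(key qk).
have qk : quantile i u = k.
  apply/eqP; rewrite quantileP // cdf_belowS; case/andP: h => h1 h2.
  rewrite (le_trans _ h1) ?lerDl ?mulr_ge0 //=; apply: lt_le_trans h2 _.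
  by rewrite -addrA -mulrDr lerD2l -[leRHS]mulr1 ler_wpM2l.
by split=> //; apply/(key qk).
Qed.

(** The sample space is the whole real line; the points outside [[0, 1)] have probability 0 and are
    sent to 0. *)
Definition clip (u : R) : R := if in_unit u then u else 0.

Definition digit (u : R) (n : nat) : nat := quantile n (remainder 0 (clip u) n).

Lemma digits_matchE i u s : digits_match i u s <->
  forall j, (j < size s)%N -> quantile (i + j) (remainder i u j) = nth 0%N s j.
Proof.
elim: s i u => [|k s IH] i u /=; first by split.
have rem n : remainder i.+1 (rescale i u) n = remainder i u n.+1.
  elim: n => [|n IHn]; first by rewrite /= addn0.
  by rewrite [LHS]/= IHn addSnnS.
split=> [[qk /IH h] [|j] js|h].
- by rewrite addn0.
- by rewrite -addSnnS -rem h.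
split; first by have := h 0%N isT; rewrite addn0.
by apply/IH => j js; rewrite rem addSnnS; exact: (h j.+1).
Qed.

Definition unit_prob : probability _ R := uniform_prob (@ltr01 R).

Lemma measurable_digits s : measurable [set u | digits_match 0 (clip u) s].
Proof.
have [a [a0 a1 ha]] := digits_match_itv 0 s.
set q := \prod_(j < size s) _ in a1 ha.
rewrite (_ : mkset _ = ([set` `[0, 1[%R] `&` [set` `[a, (a + q)[%R]) `|`
    (~` [set` `[0, 1[%R] `&` [set _ | digits_match 0 0 s])); last first.
  apply/seteqP; split=> u /=; rewrite /clip !in_itv /= -/(in_unit u); case: ifP => uu.
  - by move=> /(ha _ uu); left.
  - by right.
  - by case=> [[_ h]|[]] //; apply/(ha _ uu).
  - by case=> [[]|[]].
apply: measurableU; apply: measurableI => //; first exact: measurableC.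
exact: measurable_const.
Qed.

Lemma unit_prob_itv (x y : R) : 0 <= x -> x <= y -> y <= 1 ->
  unit_prob [set` `[x, y[%R] = (y - x)%:E.
Proof.
move=> x0 xy y1; rewrite -[LHS]/(\int[lebesgue_measure]_(u in [set` `[x, y[%R]) (uniform_pdf 0 1 u)%:E)%E.
rewrite (eq_integral (fun=> 1%E)); last first.
  move=> u; rewrite inE /= in_itv /= => /andP[xu uy]; rewrite /uniform_pdf.
  by rewrite (le_trans x0 xu) (le_trans (ltW uy) y1) /= subr0 invr1.
rewrite integral_cst //= mul1e lebesgue_measure_itv /= lte_fin.
by move: xy; rewrite le_eqVlt => /orP[/eqP->|->]; rewrite ?ltxx ?subrr // EFinB.
Qed.

Lemma digits_prob s :
  unit_prob [set u | digits_match 0 (clip u) s] = (\prod_(j < size s) p j (nth 0%N s j))%:E.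
Proof.
have [a [a0 a1 ha]] := digits_match_itv 0 s.
set q := \prod_(j < size s) _ in a1 ha *.
have q0 : 0 <= q by apply: prodr_ge0 => j _; case: (pP j).
have m1 : measurable [set u | digits_match 0 (clip u) s] := measurable_digits s.
have itv : unit_prob [set` `[a, (a + q)[%R] = q%:E.
  by rewrite unit_prob_itv ?lerDl // addrC addKr.
have unit1 : unit_prob [set` `[0, 1[%R] = 1%E by rewrite unit_prob_itv // subr0.
have null : unit_prob ([set u | digits_match 0 (clip u) s] `\` [set` `[0, 1[%R]) = 0%E.
  apply/eqP; rewrite eq_le measure_ge0 andbT.
  have c0 : unit_prob (~` [set` `[0, 1[%R]) = 0%E.
    have := probability_setC unit_prob (measurable_itv `[(0 : R), 1[).
    by move=> ->; rewrite [X in (_ - X)%E]unit1 subee.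
  rewrite -c0; apply: le_measure; rewrite ?inE; [exact: measurableD|exact: measurableC|].
  by move=> u [].
rewrite (measureDI unit_prob m1 (measurable_itv `[(0 : R), 1[)) [X in (X + _)%E]null add0e.
rewrite (_ : _ `&` _ = [set` `[a, (a + q)[%R]).
  exact: itv.
apply/seteqP; split=> u /=; rewrite /clip !in_itv /= -/(in_unit u).
  by move=> [h uu]; move: h; rewrite uu => /(ha _ uu).
move=> h; have uu : in_unit u.
  by case/andP: h => h1 h2; rewrite /in_unit (le_trans a0 h1) (lt_le_trans h2 a1).
by rewrite uu; split=> //; apply/(ha _ uu).
Qed.

Lemma independent_sequence : exists X : R -> nat -> nat,
  (forall n, measurable_fun setT (fun u => X u n)) /\
  forall s, unit_prob [set u | forall j, (j < size s)%N -> X u j = nth 0%N s j] =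
    (\prod_(j < size s) p j (nth 0%N s j))%:E.
Proof.
have E s : [set u | forall j, (j < size s)%N -> digit u j = nth 0%N s j] =
    [set u | digits_match 0 (clip u) s].
  by apply/seteqP; split=> u; [move=> h; apply/digits_matchE|move/digits_matchE].
exists digit; split=> [n|s]; last by rewrite E digits_prob.
have mp (m : nat) (t : seq nat) : size t = m -> measurable [set u | mkseq (digit u) m = t].
  move=> tm; rewrite (_ : mkset _ = [set u | forall j, (j < size t)%N -> digit u j = nth 0%N t j]).
    by rewrite E; exact: measurable_digits.
  apply/seteqP; split=> u /=.
    by move=> <- j; rewrite size_mkseq => jm; rewrite nth_mkseq.
  move=> h; apply: (@eq_from_nth _ 0%N); first by rewrite size_mkseq.
  by move=> j; rewrite size_mkseq => jm; rewrite nth_mkseq // h // tm.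
move=> _ B _; rewrite setTI.
rewrite (_ : _ @^-1` B = [set u | exists t : seq nat, mkseq (digit u) n.+1 = t /\
    (size t = n.+1 /\ B (nth 0%N t n))]).
  apply: measurable_exists => t; have [tn|tn] := eqVneq (size t) n.+1.
    by apply: measurable_conj; [exact: mp|exact: measurable_const].
  rewrite (_ : mkset _ = set0) //; apply/seteqP; split=> // u [_ [e _]].
  by rewrite e eqxx in tn.
apply/seteqP; split=> u /=.
  by move=> Bu; exists (mkseq (digit u) n.+1); rewrite size_mkseq nth_mkseq.
by move=> [t [<- [_]]]; rewrite nth_mkseq.
Qed.

End NestedIntervals.
End IndependentSequence.

(** * Sums of independent Poisson variables *)

Section PoissonMass.
Variable R : realType.

(** With [0 ^+ 0 = 1] this is the Dirac mass at 0 for [lam = 0], without a case distinction. *)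
Definition pois (lam : R) (k : nat) : R := lam ^+ k / k`!%:R * expR (- lam).

Lemma pois_ge0 lam k : 0 <= lam -> 0 <= pois lam k.
Proof. by move=> l0; rewrite mulr_ge0 ?expR_ge0 // divr_ge0 // exprn_ge0. Qed.

Lemma poisE (lam : R) j k : 0 <= lam -> poisson_prob lam j [set k] = (pois lam k)%:E.
Proof.
rewrite le_eqVlt /poisson_prob /pois => /orP[/eqP <-|l0].
  rewrite ltxx diracE oppr0 expR0 mulr1; case: k => [|k].
    by rewrite mem_set // expr0 fact0 divr1.
  by rewrite memNset // expr0n mul0r.
rewrite l0 esum_set1; last by rewrite lee_fin poisson_pmf_ge0.
by rewrite /poisson_pmf l0.
Qed.

Lemma poisD (a b : R) k : \sum_(x < k.+1) pois a (k - x) * pois b x = pois (a + b) k.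
Proof.
rewrite /pois exprDn opprD expRD !mulr_suml; apply: eq_bigr => x _.
have xk : (x <= k)%N by rewrite -ltnS.
have -> : (k`!%:R : R) = 'C(k, x)%:R * (x`!%:R * (k - x)`!%:R) by rewrite -!natrM bin_fact.
rewrite -[_ *+ _]mulr_natr; field.
by rewrite !pnatr_eq0 -!lt0n !fact_gt0 bin_gt0 xk.
Qed.

Lemma pois_is_pmf lam : 0 <= lam -> is_pmf (pois lam).
Proof.
move=> l0; have S : \esum_(k in [set: nat]) (pois lam k)%:E = 1%E.
  have <- : poisson_prob lam 0 [set: nat] = 1%E.
    by have := @probability_setT _ _ R (poisson_prob lam 0).
  rewrite /poisson_prob; case: ltP => [l1|l1].
    by apply: eq_esum => k _; rewrite /poisson_pmf l1.
  have -> : lam = 0 by apply/eqP; rewrite eq_le l1 l0.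
  rewrite diracT (esumID [set 0%N]); last by move=> k _; rewrite lee_fin pois_ge0.
  rewrite setTI esum_set1 ?lee_fin ?pois_ge0 // esum1.
    by rewrite /pois expr0 fact0 divr1 oppr0 expR0 mulr1 adde0.
  by move=> k [_ /eqP]; case: k => // k _; rewrite /pois expr0n mul0r mul0r.
have ser : (\sum_(k <oo) (pois lam k)%:E = 1)%E.
  by rewrite nneseries_esumT // => k; rewrite lee_fin pois_ge0.
have par k : ((\sum_(j < k) pois lam j)%:E = \sum_(0 <= j < k) (pois lam j)%:E)%E.
  by rewrite -sumEFin big_mkord.
split=> [k|k|x x1]; first exact: pois_ge0.
  rewrite -lee_fin par -[leRHS]ser; apply: nneseries_lim_ge => j _.
  by rewrite lee_fin pois_ge0.
apply: contrapT => /forallNP h; move: x1; apply/negP; rewrite -leNgt -lee_fin -ser.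
apply: lime_le; first by apply: is_cvg_nneseries => k _; rewrite lee_fin pois_ge0.
by apply: nearW => k; rewrite -par lee_fin leNgt; apply/negP/h.
Qed.
End PoissonMass.

Section IndependentNatSequence.
Variable R : realType.
Context (disp : measure_display) (T : measurableType disp) (P : probability T R).
Variables (X : T -> nat -> nat) (p : nat -> nat -> R).
Hypothesis mX : forall n, measurable_fun setT (fun t => X t n).
Hypothesis pX : forall s, P [set t | forall j, (j < size s)%N -> X t j = nth 0%N s j] =
    (\prod_(j < size s) p j (nth 0%N s j))%:E.

Lemma measurable_coord n (b : pred nat) : measurable [set t | b (X t n)].
Proof.
have h := mX n measurableT (I : measurable [set k | b k]).
by rewrite setTI in h.
Qed.

Lemma prefix_eqE m s : size s = m ->
  [set t | mkseq (X t) m = s] = [set t | forall j, (j < size s)%N -> X t j = nth 0%N s j].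
Proof.
move=> sm; apply/seteqP; split=> t /=.
  by move=> <- j; rewrite size_mkseq => jm; rewrite nth_mkseq.
move=> h; apply: (@eq_from_nth _ 0%N); first by rewrite size_mkseq.
by move=> j; rewrite size_mkseq => jm; rewrite nth_mkseq // h // sm.
Qed.

Lemma prefix_prob m s : size s = m ->
  P [set t | mkseq (X t) m = s] = (\prod_(j < m) p j (nth 0%N s j))%:E.
Proof. by move=> sm; rewrite prefix_eqE // pX sm. Qed.

Lemma measurable_prefix m (Q : pred (seq nat)) : measurable [set t | Q (mkseq (X t) m)].
Proof.
have mp s : measurable [set t | mkseq (X t) m = s].
  have [sm|sm] := eqVneq (size s) m; last first.
    rewrite (_ : mkset _ = set0) //; apply/seteqP; split=> // t /= e.
    by rewrite -e size_mkseq eqxx in sm.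
  rewrite prefix_eqE //; apply: measurable_forall => j.
  have [js|js] := ltnP j (size s).
    rewrite (_ : mkset _ = [set t | X t j == nth 0%N s j]).
      exact: (measurable_coord j (fun k => k == nth 0%N s j)).
    by apply/seteqP; split=> t /=; [move/(_ isT)/eqP|move/eqP].
  by rewrite (_ : mkset _ = setT) //; apply/seteqP; split.
rewrite (_ : mkset _ = [set t | exists s : seq nat, mkseq (X t) m = s /\ Q s]).
  by apply: measurable_exists => s; apply: measurable_conj; [exact: mp|exact: measurable_const].
by apply/seteqP; split=> t /=; [exists (mkseq (X t) m)|case=> s [<-]].
Qed.

(** The prefix takes countably many values; on each of them the identity is [pX] for a list with one
    more entry. *)
Lemma prefix_next m (Q : pred (seq nat)) x :
  P [set t | Q (mkseq (X t) m) && (X t m == x)] = (P [set t | Q (mkseq (X t) m)] * (p m x)%:E)%E.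
Proof.
set G := [set t | X t m == x]; have mG : measurable G by exact: (measurable_coord m (fun k => k == x)).
pose F n := [set t | (if @pickle_inv (seq nat) n is Some s then Q s && (mkseq (X t) m == s) else false)].
have mF n : measurable (F n).
  rewrite /F; case: (pickle_inv n) => [s|]; last exact: measurable_const.
  exact: (measurable_prefix m (fun l => Q s && (l == s))).
have tF : trivIset setT F.
  move=> i j _ _ [t []]; rewrite /F /=; have := @pickle_invK (seq nat) i; have := @pickle_invK (seq nat) j.
  case: (pickle_inv i) => [s|//] /=; case: (pickle_inv j) => [s'|//] /= <- <-.
  by move=> /andP[_ /eqP <-] /andP[_ /eqP <-].
have UF : [set t | Q (mkseq (X t) m)] = \bigcup_n F n.
  apply/seteqP; split=> t /=.
    by move=> Qt; exists (pickle (mkseq (X t) m)) => //; rewrite /F /= pickleK_inv Qt eqxx.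
  by move=> [n _]; rewrite /F /=; case: (pickle_inv n) => // s /andP[Qs /eqP ->].
have FG n : P (F n `&` G) = (P (F n) * (p m x)%:E)%E.
  rewrite /F; case: (pickle_inv n) => [s|]; last first.
    by rewrite (_ : mkset _ = set0) ?set0I ?measure0 ?mul0e //; apply/seteqP; split.
  have [/andP[Qs /eqP sm]|nQ] := boolP (Q s && (size s == m)); last first.
    rewrite (_ : mkset _ = set0) ?set0I ?measure0 ?mul0e //.
    apply/seteqP; split=> // t /andP[Qs /eqP e]; case/negP: nQ.
    by rewrite Qs -e size_mkseq eqxx.
  have -> : [set t | Q s && (mkseq (X t) m == s)] = [set t | mkseq (X t) m = s].
    by apply/seteqP; split=> t /=; rewrite Qs => /eqP.
  have -> : [set t | mkseq (X t) m = s] `&` G = [set t | mkseq (X t) m.+1 = rcons s x].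
    apply/seteqP; split=> t; rewrite /G /= /mkseq -addn1 iotaD map_cat /= add0n cats1.
      by move=> [-> /eqP ->].
    by move=> /rcons_inj[-> ->].
  rewrite (prefix_prob (s := rcons s x)) ?size_rcons ?sm // (prefix_prob sm) -EFinM; congr EFin.
  rewrite big_ord_recr /= nth_rcons sm ltnn eqxx; congr (_ * _).
  by apply: eq_bigr => j _; rewrite nth_rcons sm ltn_ord.
rewrite (_ : [set t | Q (mkseq (X t) m) && (X t m == x)] = \bigcup_n (F n `&` G)); last first.
  by rewrite -setI_bigcupl -UF; apply/seteqP; split=> t /= /andP.
rewrite UF !measure_semi_bigcup //; first last.
- by apply: bigcupT_measurable => n; exact: measurableI.
- by apply: trivIset_setIr.
- by move=> n; exact: measurableI.
- exact: bigcupT_measurable.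
rewrite muleC -nneseriesZl //.
apply: eq_eseriesr => n _.
rewrite muleC.
exact: FG.
Qed.

Lemma prefix_next_neq m (Q : pred (seq nat)) x :
  P [set t | Q (mkseq (X t) m) && (X t m != x)] = (P [set t | Q (mkseq (X t) m)] * (1 - p m x)%:E)%E.
Proof.
have mQ := measurable_prefix m Q.
have mx := measurable_coord m (fun k => k == x).
have finQ : P [set t | Q (mkseq (X t) m)] \is a fin_num by exact: fin_num_measure.
rewrite (_ : [set t | _ && _] = [set t | Q (mkseq (X t) m)] `\` [set t | X t m == x]); last first.
  by apply/seteqP; split=> t; rewrite /setD /=; [case/andP => -> /negP|case=> -> /negP].
rewrite measureD //; last by rewrite ltey_eq finQ.
rewrite (_ : _ `&` _ = [set t | Q (mkseq (X t) m) && (X t m == x)]); last first.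
  by apply/seteqP; split=> t /=; [case=> -> ->|case/andP].
rewrite [X in (_ - X)%E]prefix_next EFinB; rewrite muleBr ?mule1 //.
Qed.

(** Indices up to the largest one in [s] are treated in order; those outside [s] carry a void
    condition of the form [J j ==> _]. *)
Lemma independent_all (b : nat -> pred nat) (c : nat -> R) :
  (forall m (Q : pred (seq nat)), P [set t | Q (mkseq (X t) m) && b m (X t m)] =
     (P [set t | Q (mkseq (X t) m)] * (c m)%:E)%E) ->
  forall s, uniq s -> P [set t | all (fun j => b j (X t j)) s] = (\prod_(j <- s) c j)%:E.
Proof.
move=> H s us.
have pre (J : pred nat) m : P [set t | all (fun j => J j ==> b j (X t j)) (iota 0 m)] =
    (\prod_(0 <= j < m | J j) c j)%:E.
  elim: m => [|m IH].
    rewrite big_geq // (_ : mkset _ = setT) ?probability_setT //.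
    by apply/seteqP; split.
  pose Q (l : seq nat) := all (fun j => J j ==> b j (nth 0%N l j)) (iota 0 m).
  have EQ : [set t | all (fun j => J j ==> b j (X t j)) (iota 0 m)] = [set t | Q (mkseq (X t) m)].
    have e t : all (fun j => J j ==> b j (X t j)) (iota 0 m) = Q (mkseq (X t) m).
      by apply: eq_in_all => j; rewrite mem_iota add0n => /andP[_ jm]; rewrite nth_mkseq.
    by apply/seteqP; split=> t /=; rewrite e.
  have e t : all (fun j => J j ==> b j (X t j)) (iota 0 m.+1) =
      all (fun j => J j ==> b j (X t j)) (iota 0 m) && (J m ==> b m (X t m)).
    by rewrite -addn1 iotaD all_cat /= andbT.
  have -> : [set t | all (fun j => J j ==> b j (X t j)) (iota 0 m.+1)] =
      [set t | all (fun j => J j ==> b j (X t j)) (iota 0 m) && (J m ==> b m (X t m))].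
    by apply/seteqP; split=> t; rewrite /mkset e.
  rewrite big_mkcond big_nat_recr //= -big_mkcond EFinM -IH.
  case: (J m) => /=; last by rewrite mule1; congr (P _); apply/seteqP; split=> t /=; rewrite andbT.
  rewrite EQ -H; congr (P _); apply/seteqP; split=> t /=;
    by rewrite (_ : all _ _ = Q (mkseq (X t) m)) //; apply: eq_in_all => j;
      rewrite mem_iota add0n => /andP[_ jm]; rewrite nth_mkseq.
have [m sm] : exists m, forall j, j \in s -> (j < m)%N.
  exists (\max_(j <- s) j).+1 => j js; rewrite ltnS.
  exact: (@leq_bigmax_seq _ s predT id j js isT).
have -> : \prod_(j <- s) c j = \prod_(0 <= j < m | j \in s) c j.
  rewrite -[RHS]big_filter; apply: perm_big; apply: uniq_perm => //.
    by rewrite filter_uniq // iota_uniq.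
  move=> j; rewrite mem_filter mem_index_iota /=; case js : (j \in s) => //=.
  by rewrite sm.
rewrite -pre; congr (P _); apply/seteqP; split=> t /= /allP h; apply/allP => j.
  by move=> _; apply/implyP; exact: h.
by move=> js; have := h j; rewrite mem_iota js /= => -> //; exact: sm.
Qed.

Section Superposition.
Variables (G : pred nat) (lam : nat -> R).
Hypothesis lam0 : forall j, 0 <= lam j.
Hypothesis pG : forall j, G j -> p j = pois (lam j).

Definition partial_count m t : nat := \sum_(0 <= j < m | G j) X t j.
Definition partial_rate m : R := \sum_(0 <= j < m | G j) lam j.

Lemma partial_countE m t : partial_count m t = (\sum_(0 <= j < m | G j) nth 0 (mkseq (X t) m) j)%N.
Proof.
rewrite /partial_count big_nat_cond [RHS]big_nat_cond.
by apply: eq_bigr => j /andP[/andP[_ jm] _]; rewrite nth_mkseq.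
Qed.

Lemma measurable_partial_count m (b : pred nat) : measurable [set t | b (partial_count m t)].
Proof.
rewrite (_ : mkset _ = [set t | (fun l => b (\sum_(0 <= j < m | G j) nth 0 l j)%N) (mkseq (X t) m)]).
  exact: (measurable_prefix m (fun l => b (\sum_(0 <= j < m | G j) nth 0 l j)%N)).
by apply/seteqP; split=> t /=; rewrite partial_countE.
Qed.

Lemma partial_count_law m k : P [set t | partial_count m t == k] = (pois (partial_rate m) k)%:E.
Proof.
elim: m k => [|m IH] k.
  rewrite /partial_rate big_geq // /pois oppr0 expR0 mulr1 expr0n.
  have e t : partial_count 0 t = 0%N by rewrite /partial_count big_geq.
  case: k => [|k]; rewrite ?fact0 ?divr1 ?mul0r.
    by rewrite (_ : mkset _ = setT) ?probability_setT //; apply/seteqP; split=> t //= _; rewrite e.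
  by rewrite (_ : mkset _ = set0) ?measure0 //; apply/seteqP; split=> t //=; rewrite e.
rewrite /partial_rate big_mkcond big_nat_recr //= -big_mkcond -/(partial_rate m).
have e t : partial_count m.+1 t = (partial_count m t + if G m then X t m else 0)%N.
  by rewrite /partial_count big_mkcond big_nat_recr //= -big_mkcond.
case Gm : (G m) e => e; last first.
  rewrite addr0 -IH; congr (P _); apply/seteqP; split=> t /=; by rewrite e addn0.
pose F x := [set t | (partial_count m t == k - x)%N && (X t m == x)].
have PF x : P (F x) = (pois (partial_rate m) (k - x) * pois (lam m) x)%:E.
  rewrite EFinM -IH -pG //; have := prefix_next m (fun l => (\sum_(0 <= j < m | G j) nth 0 l j == k - x)%N) x.
  rewrite (_ : [set t | _] = F x); last by apply/seteqP; split=> t; rewrite /F /= partial_countE.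
  move=> ->; congr (P _ * _)%E; by apply/seteqP; split=> t /=; rewrite partial_countE.
rewrite (_ : [set t | _] = \big[setU/set0]_(x < k.+1) F x); last first.
  rewrite -bigcup_mkord; apply/seteqP; split=> t; rewrite /F /= e.
    move=> /eqP h; exists (X t m); first by rewrite /= ltnS -h leq_addl.
    by rewrite /= -h addnK !eqxx.
  by move=> [x /= xk /andP[/eqP -> /eqP ->]]; rewrite subnK.
rewrite measure_bigsetU.
- by rewrite -poisD -sumEFin; apply: eq_bigr => x _; exact: PF.
- move=> x; have := measurableI _ _ (measurable_partial_count m (fun n => n == k - x)%N)
    (measurable_coord m (fun n => n == x)).
  by rewrite (_ : _ `&` _ = F x) //; apply/seteqP; split=> t; rewrite /F /=; [case=> -> ->|case/andP].
- by move=> i j _ _ [t [/andP[_ /eqP <-] /andP[_ /eqP <-]]].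
Qed.

Definition total_count t : \bar R := (\sum_(j <oo | G j) ((X t j)%:R)%:E)%E.
Definition pois_cdf (l : R) k : R := \sum_(i < k.+1) pois l i.

Lemma partial_countEFin m t :
  (((partial_count m t)%:R)%:E = \sum_(0 <= j < m | G j) ((X t j)%:R)%:E :> \bar R)%E.
Proof. by rewrite natr_sum -sumEFin. Qed.

Lemma partial_le_total m t : (((partial_count m t)%:R)%:E <= total_count t)%E.
Proof. by rewrite partial_countEFin; apply: nneseries_lim_ge => j _; rewrite lee_fin. Qed.

Lemma total_leP k t : (total_count t <= (k%:R)%:E)%E <-> forall m, (partial_count m t <= k)%N.
Proof.
split=> [h m|h].
  by rewrite -(ler_nat R) -lee_fin; apply: le_trans h; exact: partial_le_total.
apply: lime_le; first by apply: is_cvg_nneseries => j _; rewrite lee_fin.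
by apply: nearW => m; rewrite -partial_countEFin lee_fin ler_nat.
Qed.

Lemma partial_count_cdf m k :
  P [set t | (partial_count m t <= k)%N] = (pois_cdf (partial_rate m) k)%:E.
Proof.
pose F i := [set t | partial_count m t == i].
rewrite (_ : [set t | _] = \big[setU/set0]_(i < k.+1) F i); last first.
  rewrite -bigcup_mkord; apply/seteqP; split=> t; rewrite /F /=.
    by move=> h; exists (partial_count m t); rewrite /= ?ltnS ?eqxx.
  by move=> [i /= ik /eqP ->].
rewrite measure_bigsetU.
- by rewrite -sumEFin; apply: eq_bigr => i _; exact: partial_count_law.
- by move=> i; exact: (measurable_partial_count m (fun n => n == i)).
- by move=> i j _ _ [t [/eqP <- /eqP <-]].
Qed.

Lemma total_le_cap k : [set t | (total_count t <= (k%:R)%:E)%E] =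
  \bigcap_m [set t | (partial_count m t <= k)%N].
Proof.
apply/seteqP; split=> t /=; first by move/total_leP => h m _; exact: h.
by move=> h; apply/total_leP => m; exact: (h m I).
Qed.

Lemma measurable_total_le k : measurable [set t | (total_count t <= (k%:R)%:E)%E].
Proof.
rewrite total_le_cap; apply: bigcapT_measurable => m.
exact: (measurable_partial_count m (fun n => n <= k)%N).
Qed.

(** The partial counts increase to the total, so these events decrease to their intersection. *)
Lemma total_le_cvg k :
  (fun m => (pois_cdf (partial_rate m) k)%:E) @ \oo --> P [set t | (total_count t <= (k%:R)%:E)%E].
Proof.
rewrite total_le_cap.
rewrite (_ : (fun m => _) = P \o (fun m => [set t | (partial_count m t <= k)%N])); last first.
  by apply/funext => m /=; rewrite partial_count_cdf.
apply: nonincreasing_cvg_mu.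
- by rewrite ltey_eq fin_num_measure //; exact: (measurable_partial_count 0 (fun n => n <= k)%N).
- by move=> m; exact: (measurable_partial_count m (fun n => n <= k)%N).
- by apply: bigcapT_measurable => m; exact: (measurable_partial_count m (fun n => n <= k)%N).
move=> m n mn; apply/subsetPset => t /=; apply: leq_trans.
rewrite /partial_count -(subnK mn) addnC; elim: (n - m)%N => [|i IH]; first by rewrite addn0.
by rewrite addnS [leqRHS]big_mkcond big_nat_recr //= -big_mkcond (leq_trans IH) // leq_addr.
Qed.

Lemma pois_cdf_cvg (f : nat -> R) (l : R) k : f @ \oo --> l ->
  (fun m => pois_cdf (f m) k) @ \oo --> pois_cdf l k.
Proof.
move=> fl; have H i : (fun m => pois (f m) i) @ \oo --> pois l i.
  rewrite /pois; apply: cvgM.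
    apply: cvgM; last exact: cvg_cst.
    by apply: (@cvg_comp _ _ _ f (fun x => x ^+ i) _ _ _ fl); exact: exprn_continuous.
  apply: (@cvg_comp _ _ _ (fun m => - f m) (@expR R) _ _ _ (cvgN fl)); exact: continuous_expR.
elim: k => [|k IH].
  rewrite /pois_cdf; under eq_fun do rewrite big_ord1; rewrite big_ord1; exact: H.
rewrite /pois_cdf; under eq_fun do rewrite big_ord_recr /=; rewrite big_ord_recr /=.
by apply: cvgD; [exact: IH|exact: H].
Qed.

Lemma total_le_fin l k : (\sum_(j <oo | G j) (lam j)%:E = l%:E)%E ->
  P [set t | (total_count t <= (k%:R)%:E)%E] = (pois_cdf l k)%:E.
Proof.
move=> hl; have cl : (fun m => (partial_rate m)%:E) @ \oo --> l%:E.
  rewrite -hl (_ : (fun m => _) = (fun m => \sum_(0 <= j < m | G j) (lam j)%:E)%E).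
    by apply: is_cvg_nneseries => j _; rewrite lee_fin.
  by apply/funext => m; rewrite -sumEFin.
have h : (fun m => (pois_cdf (partial_rate m) k)%:E) @ \oo --> (pois_cdf l k)%:E.
  have h1 : (fun m => pois_cdf (partial_rate m) k) @ \oo --> pois_cdf l k.
    by apply: pois_cdf_cvg; exact: (fine_cvg cl).
  by apply: cvg_EFin; [exact: nearW|exact: h1].
exact: (cvg_unique _ (@total_le_cvg k) h).
Qed.

(** Since [expR l >= l^(i+1) / (i+1)!], each mass [pois l i] is at most [(i+1) / l]. *)
Lemma pois_cdf_decay k l : 0 < l -> pois_cdf l k <= (\sum_(i < k.+1) i.+1%:R) / l.
Proof.
move=> l0; rewrite mulr_suml; apply: ler_sum => i _.
have := expR_ge1Dxn i (ltW l0); set e := expR l => h.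
have e0 : 0 < e by exact: expR_gt0.
have f0 : (0 : R) < i`!%:R by rewrite ltr0n fact_gt0.
have i0 : (0 : R) < i.+1%:R by rewrite ltr0n.
have le : l ^+ i.+1 / i.+1`!%:R <= e by apply: le_trans h; rewrite lerDr.
rewrite /pois expRN -/e ler_pdivrMr // mulrAC ler_pdivlMr //.
move: le; rewrite factS natrM invfM exprS => le.
have -> : l ^+ i / i`!%:R * l = (l * l ^+ i * (i.+1%:R^-1 * i`!%:R^-1)) * i.+1%:R.
  by field; rewrite !gt_eqF.
by rewrite mulrC ler_wpM2l // ltW.
Qed.

Lemma total_le_infinite k : (\sum_(j <oo | G j) (lam j)%:E = +oo)%E ->
  P [set t | (total_count t <= (k%:R)%:E)%E] = 0%E.
Proof.
move=> hl; have mk := measurable_total_le k.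
have finP : P [set t | (total_count t <= (k%:R)%:E)%E] \is a fin_num by exact: fin_num_measure.
apply/eqP; rewrite eq_le measure_ge0 andbT leNgt; apply/negP.
rewrite -(fineK finP) lte_fin; set r := fine _ => r0.
set C : R := \sum_(i < k.+1) i.+1%:R.
have C0 : 0 < C by rewrite /C big_ord_recl ltr_pwDl // sumr_ge0.
have [m hm] : exists m, 2 * C / r < partial_rate m.
  apply: contrapT => /forallNP H; have : (\sum_(j <oo | G j) (lam j)%:E <= (2 * C / r)%:E)%E.
    apply: lime_le; first by apply: is_cvg_nneseries => j _; rewrite lee_fin.
    by apply: nearW => m; rewrite sumEFin lee_fin leNgt; apply/negP/H.
  by rewrite hl leye_eq.
have : r <= C / partial_rate m.
  apply: le_trans (pois_cdf_decay k (lt_trans _ hm)); last by rewrite divr_gt0 // mulr_gt0.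
  rewrite -lee_fin -partial_count_cdf /r fineK //; apply: le_measure; rewrite ?inE //.
    exact: (measurable_partial_count m (fun n => n <= k)%N).
  by move=> t /total_leP; apply.
have rm : 0 < partial_rate m by apply: lt_trans hm; rewrite divr_gt0 // mulr_gt0.
move: hm; rewrite ltr_pdivrMr // ler_pdivlMr // => h1 h2.
by move: h1 h2; rewrite [r * _]mulrC; move: (_ * r) => z; lra.
Qed.

Lemma total_count_law l k : (\sum_(j <oo | G j) (lam j)%:E = l%:E)%E ->
  P [set t | total_count t = (k%:R)%:E] = (pois l k)%:E.
Proof.
move=> hl; case: k => [|k].
  rewrite (_ : [set t | _] = [set t | (total_count t <= (0%:R)%:E)%E]).
    by rewrite (total_le_fin 0 hl) /pois_cdf big_ord1.
  apply/seteqP; split=> t /= => [->//|h]; apply/eqP; rewrite eq_le h /=.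
  by apply: le_trans (partial_le_total 0 t); rewrite lee_fin.
rewrite (_ : [set t | _] = [set t | (total_count t <= (k.+1%:R)%:E)%E] `\`
    [set t | (total_count t <= (k%:R)%:E)%E]).
  rewrite measureD; [|exact: measurable_total_le|exact: measurable_total_le|]; last first.
    by rewrite ltey_eq fin_num_measure //; exact: measurable_total_le.
  rewrite (_ : _ `&` _ = [set t | (total_count t <= (k%:R)%:E)%E]); last first.
    apply/seteqP; split=> t /= => [[]//|h]; split=> //.
    by apply: le_trans h _; rewrite lee_fin ler_nat.
  rewrite [X in (X - _)%E](total_le_fin k.+1 hl) [X in (_ - X)%E](total_le_fin k hl) -EFinB; congr EFin.
  by rewrite /pois_cdf [X in X - _]big_ord_recr /= addrAC subrr add0r.
apply/seteqP; split=> t /=.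
  by move=> e; rewrite /setD /= e; split => //; rewrite lee_fin ler_nat ltnn.
rewrite /setD /= => -[h1 h2]; apply/eqP; rewrite eq_le h1 /=.
have [m hm] : exists m, (k < partial_count m t)%N.
  by apply: contrapT => /forallNP H; apply: h2; apply/total_leP => m; rewrite leqNgt; apply/negP/H.
by apply: le_trans (partial_le_total m t); rewrite lee_fin ler_nat.
Qed.

Lemma total_count_infinite : (\sum_(j <oo | G j) (lam j)%:E = +oo)%E ->
  P [set t | total_count t = +oo%E] = 1%E.
Proof.
move=> hl; pose B := \bigcup_k [set t | (total_count t <= (k%:R)%:E)%E].
have mB : measurable B by apply: bigcupT_measurable => k; exact: measurable_total_le.
have B0 : P B = 0%E.
  apply/(negligibleP _ mB); apply: negligible_bigcup => k.
  by apply/(negligibleP _ (measurable_total_le k)); exact: total_le_infinite.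
rewrite (_ : [set t | _] = ~` B).
  by rewrite probability_setC // B0 sube0.
apply/seteqP; split=> t /=.
  by move=> e [k _] /=; rewrite e leye_eq.
move=> nB; have t0 : (0 <= total_count t)%E by apply: nneseries_ge0 => j _ _; rewrite lee_fin.
move: nB; rewrite /B; case E : (total_count t) => [x| |] //; last by move: t0; rewrite E.
case; exists (Num.truncn x).+1 => //=; rewrite E lee_fin ltW //.
exact: truncnS_gt.
Qed.

End Superposition.
End IndependentNatSequence.

(** Two applications of [occupancy_law_unique]: first [F] replaces a cylinder of [o], then [F']
    replaces one of [o'], each time with [P] restricted to the other event. *)
Lemma independent_events (R : realType) (W : countType) (disp : measure_display)
    (T : measurableType disp) (P : probability T R) (o o' : T -> W -> bool) :
  (forall w, measurable [set t | o t w]) -> (forall w, measurable [set t | o' t w]) ->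
  (forall s s', P ([set t | cylinder s (o t)] `&` [set t | cylinder s' (o' t)]) =
     (P [set t | cylinder s (o t)] * P [set t | cylinder s' (o' t)])%E) ->
  forall F F', <<s @cylinders W >> F -> <<s @cylinders W >> F' ->
  P ([set t | F (o t)] `&` [set t | F' (o' t)]) = (P [set t | F (o t)] * P [set t | F' (o' t)])%E.
Proof.
move=> mo mo' H F F' eF eF'.
have mC s : measurable [set t | cylinder s (o' t)] by exact: measurable_cylinder.
have step1 s : P ([set t | F (o t)] `&` [set t | cylinder s (o' t)]) =
    (P [set t | F (o t)] * P [set t | cylinder s (o' t)])%E.
  have fC : P [set t | cylinder s (o' t)] = (fine (P [set t | cylinder s (o' t)]))%:E.
    by rewrite fineK // fin_num_measure.
  have C0 : 0 <= fine (P [set t | cylinder s (o' t)]) by rewrite fine_ge0.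
  suff : P ([set t | F (o t)] `&` [set t | cylinder s (o' t)]) =
    ((fine (P [set t | cylinder s (o' t)]))%:E * P [set t | F (o t)])%E by rewrite -fC muleC.
  apply: (@occupancy_law_unique _ _ _ _ _ _ (mrestr P (mC s)) (mscale (NngNum C0) P) o o _ mo mo _ F eF).
    by apply: le_lt_trans (probability_le1 P (measurableI _ _ measurableT (mC s))) (ltry _).
  move=> s'.
  suff : P ([set t | cylinder s' (o t)] `&` [set t | cylinder s (o' t)]) =
    ((fine (P [set t | cylinder s (o' t)]))%:E * P [set t | cylinder s' (o t)])%E by [].
  by rewrite -fC H muleC.
have mF : measurable [set t | F (o t)] by exact: measurable_event.
have fF : P [set t | F (o t)] = (fine (P [set t | F (o t)]))%:E by rewrite fineK // fin_num_measure.
have F0 : 0 <= fine (P [set t | F (o t)]) by rewrite fine_ge0.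
suff : P ([set t | F' (o' t)] `&` [set t | F (o t)]) =
    ((fine (P [set t | F (o t)]))%:E * P [set t | F' (o' t)])%E by rewrite -fF setIC.
apply: (@occupancy_law_unique _ _ _ _ _ _ (mrestr P mF) (mscale (NngNum F0) P) o' o' _ mo' mo' _ F' eF').
  by apply: le_lt_trans (probability_le1 P (measurableI _ _ measurableT mF)) (ltry _).
move=> s.
suff : P ([set t | cylinder s (o' t)] `&` [set t | F (o t)]) =
    ((fine (P [set t | F (o t)]))%:E * P [set t | cylinder s (o' t)])%E by [].
by rewrite -fF setIC step1.
Qed.

Lemma esum_pickle (R : realType) (E : countType) (f : E -> R) :
  \esum_(j in [set: nat]) (if pickle_inv j is Some e then f e else 0)%:E =
  \esum_(e in [set: E]) (f e)%:E.
Proof.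
transitivity (\esum_(j in pickle @` [set: E]) (if @pickle_inv E j is Some e then f e else 0)%:E).
  rewrite [RHS]esum_mkcond; apply: eq_esum => j _; case: ifPn => // jn.
  have := @pickle_invK E j; case: pickle_inv => [e|//] /= ej; case/negP: jn.
  by rewrite inE; exists e.
rewrite esum_image; first by apply: eq_esum => e _; rewrite pickleK_inv.
by move=> e e' _ _; exact: (pcan_inj pickleK).
Qed.

(** * Independence of the counts on disjoint sets *)

Section IndependentFamily.
Variables (R : realType) (E : countType).
Context (disp : measure_display) (T : measurableType disp) (P : probability T R).
Variables (N : T -> E -> nat) (q : E -> nat -> R).
Hypothesis mN : forall e, measurable_fun setT (fun t => N t e).
Hypothesis qN : forall (s : seq E) (x : E -> nat), uniq s ->
  P [set t | all (fun e => N t e == x e) s] = (\prod_(e <- s) q e (x e))%:E.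

(** Encodes integer-valued variables as an occupancy field indexed by pairs of a point and a value,
    so that [independent_events] applies to them. *)
Definition values_on (A : set E) (t : T) (ek : E * nat) : bool :=
  (ek.1 \in A) && (N t ek.1 == ek.2).

Lemma measurable_values_on A ek : measurable [set t | values_on A t ek].
Proof.
rewrite /values_on; case: (ek.1 \in A) => /=; last exact: measurable_const.
have h := mN ek.1 measurableT (I : measurable [set k | k == ek.2]).
by rewrite setTI in h.
Qed.

(** A cylinder that requests two values at one point, or a point outside [A], is empty; any other
    prescribes values on finitely many points. *)
Lemma values_on_cylinder A (s : seq (E * nat)) :
  [set t | cylinder s (values_on A t)] = set0 \/ exists (es : seq E) (x : E -> nat),
    [/\ uniq es, forall e, e \in es -> e \in A &
     [set t | cylinder s (values_on A t)] = [set t | all (fun e => N t e == x e) es]].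
Proof.
pose es := undup (map fst s); pose x e := (nth (e, 0%N) s (index e (map fst s))).2.
have [ok|nok] := boolP (all (fun ek => (ek.1 \in A) && (x ek.1 == ek.2)) s); [right|left].
  exists es, x; split; first exact: undup_uniq.
    by move=> e; rewrite mem_undup => /mapP[ek eks ->]; case/andP: (allP ok ek eks).
  apply/seteqP; split=> t /= /allP h; apply/allP.
    move=> e; rewrite mem_undup => /mapP[ek eks ->]; have := h ek eks; rewrite /values_on.
    by case/andP: (allP ok ek eks) => _ /eqP ->; case/andP.
  move=> ek eks; case/andP: (allP ok ek eks) => ea /eqP xe; rewrite /values_on ea /= -xe.
  by apply: h; rewrite mem_undup; apply: map_f.
apply/seteqP; split=> // t /= /allP h; case/negP: nok; apply/allP => ek eks.
have := h ek eks; rewrite /values_on => /andP[-> /eqP <-] /=.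
have ixs : (index ek.1 (map fst s) < size s)%N by rewrite -(size_map fst) index_mem map_f.
have ms : nth (ek.1, 0%N) s (index ek.1 (map fst s)) \in s by exact: mem_nth.
have := h _ ms; rewrite /values_on => /andP[_ /eqP e]; rewrite /x -e; apply/eqP; congr (N t _).
have := nth_index ek.1 (map_f fst eks); rewrite (nth_map (ek.1, 0%N)) //.
Qed.

Lemma values_on_independent (A B : set E) s s' : A `&` B = set0 ->
  P ([set t | cylinder s (values_on A t)] `&` [set t | cylinder s' (values_on B t)]) =
  (P [set t | cylinder s (values_on A t)] * P [set t | cylinder s' (values_on B t)])%E.
Proof.
move=> AB; have [->|[es [x [us sA ->]]]] := values_on_cylinder A s.
  by rewrite set0I !measure0 mul0e.
have [->|[es' [x' [us' sB ->]]]] := values_on_cylinder B s'.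
  by rewrite setI0 !measure0 mule0.
pose y e := if e \in es then x e else x' e.
have dis e : e \in es' -> (e \in es) = false.
  move=> e'; apply/negP => ee; have := sA e ee; have := sB e e'; rewrite !inE => b a.
  by have : set0 e by rewrite -AB.
rewrite (_ : _ `&` _ = [set t | all (fun e => N t e == y e) (es ++ es')]); last first.
  have e1 t : all (fun e => N t e == y e) es = all (fun e => N t e == x e) es.
    by apply: eq_in_all => e ee; rewrite /y ee.
  have e2 t : all (fun e => N t e == y e) es' = all (fun e => N t e == x' e) es'.
    by apply: eq_in_all => e ee; rewrite /y dis.
  by apply/seteqP; split=> t; rewrite /= all_cat e1 e2; [case=> -> ->|case/andP].
rewrite !qN // ?cat_uniq ?us ?us' ?andbT /=; last by apply/hasPn => e /dis ->.
rewrite big_cat EFinM; congr ((_ * _)%:E)%E.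
- by rewrite big_seq [RHS]big_seq; apply: eq_bigr => e ee; rewrite /y ee.
- by rewrite big_seq [RHS]big_seq; apply: eq_bigr => e ee; rewrite /y dis.
Qed.

(* The number of points in [A], read off the indicators of the events [N e = k]. *)
Definition count_values (A : set E) (o : E * nat -> bool) : \bar R :=
  (\sum_(j <oo) (if @pickle_inv (E * nat)%type j is Some ek then
     if (ek.1 \in A) && o ek then ek.2%:R else 0 else 0)%:E)%E.

Lemma count_valuesE (A U : set E) t : A `<=` U ->
  count_values A (values_on U t) = point_count R (N t) A.
Proof.
move=> AU; rewrite /count_values nneseries_esumT; last first.
  by move=> j; case: pickle_inv => [ek|]; rewrite lee_fin //; case: ifP.
transitivity (\esum_(ek in A `*`` (fun=> [set: nat])) (if N t ek.1 == ek.2 then ek.2%:R else 0 : R)%:E).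
  rewrite [RHS]esum_mkcond esum_pickle; apply: eq_esum => -[e k] _ /=.
  have [eA|eA] := boolP (e \in A).
    have -> : (e, k) \in A `*`` (fun=> [set: nat]) by rewrite inE; split=> //=; rewrite inE in eA.
    by rewrite /values_on /= mem_set //; apply: AU; rewrite inE in eA.
  by rewrite (_ : _ \in _ `*`` _ = false) //; apply/negbTE; apply: contra eA; rewrite !inE => -[].
rewrite -(esum_esum (a := fun e k => (if N t e == k then k%:R else 0 : R)%:E)); last first.
  by move=> e k _ _; rewrite lee_fin; case: ifP.
rewrite /point_count; apply: eq_esum => e _.
rewrite -[RHS](esum_set1 (t := N t e) (a := fun k => (k%:R : R)%:E)) ?lee_fin // [RHS]esum_mkcond.
apply: eq_esum => k _; rewrite eq_sym; case: eqVneq => [->|ne]; first by rewrite mem_set.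
by rewrite memNset //= => e'; rewrite e' eqxx in ne.
Qed.

Lemma count_values_event (A : set E) (B : set (\bar R)) : measurable B ->
  <<s @cylinders (E * nat)%type >> [set o | B (count_values A o)].
Proof.
move=> mB; set G := @cylinders (E * nat)%type.
suff m : measurable_fun setT (count_values A : g_sigma_algebraType G -> \bar R).
  have h := m measurableT _ mB; rewrite setTI in h; exact: h.
apply: ge0_emeasurable_sum => [j o _ _|j _].
  by case: pickle_inv => [ek|]; rewrite lee_fin //; case: ifP.
case: pickle_inv => [ek|]; last exact: measurable_cst.
apply/measurable_EFinP; case: (ek.1 \in A) => /=; last exact: measurable_cst.
apply: measurable_fun_ifT => //.
move=> _ C mC; rewrite setTI.
have mo : measurable ([set o | o ek] : set (g_sigma_algebraType G)).
  apply: sub_sigma_algebra; exists [:: ek] => //.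
  by apply/seteqP; split=> o; rewrite /cylinder /= andbT.
have mo' : measurable (~` [set o | o ek] : set (g_sigma_algebraType G)) by exact: measurableC.
have mC' (b : bool) := @measurable_const _ (g_sigma_algebraType G) (C b).
have := measurableU _ _ (measurableI _ _ mo (mC' true)) (measurableI _ _ mo' (mC' false)).
rewrite (_ : _ `|` _ = (fun o : g_sigma_algebraType G => o ek) @^-1` C) //.
apply/seteqP; split=> o /=.
  by case=> -[]; [move=> ->|move=> /negP/negbTE ->].
by move=> h; case e : (o ek) h => h; [left|right]; split => //; rewrite /setC /= ?e.
Qed.

(** Induction on [n]: the first [n] counts depend only on the points of the union [U] of their sets,
    which is disjoint from [A n]. *)
Lemma point_counts_independent (A : nat -> set E) (B : nat -> set (\bar R)) n :
  trivIset setT A -> (forall i, measurable (B i)) ->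
  P [set t | forall i, (i < n)%N -> B i (point_count R (N t) (A i))] =
  (\prod_(i < n) P [set t | B i (point_count R (N t) (A i))])%E.
Proof.
move=> tA mB; elim: n => [|n IH].
  rewrite big_ord0 (_ : mkset _ = setT) ?probability_setT //.
  by apply/seteqP; split.
rewrite big_ord_recr /= -IH.
pose U := \bigcup_(i in [set i | (i < n)%N]) A i.
have UA : U `&` A n = set0.
  apply/seteqP; split=> // e [[i /= i_n Aie] Ane].
  have : i = n by apply: (tA i n) => //; exists e.
  by move=> eq_in; rewrite eq_in ltnn in i_n.
pose F := [set o : E * nat -> bool | forall i, (i < n)%N -> B i (count_values (A i) o)].
have eF : <<s @cylinders (E * nat)%type >> F.
  pose Y := g_sigma_algebraType (@cylinders (E * nat)%type).
  apply: (@measurable_forall _ Y _ (fun i o => (i < n)%N -> B i (count_values (A i) o))) => i.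
  have [i_n|ni] := ltnP i n.
    have h : measurable ([set o | B i (count_values (A i) o)] : set Y) := count_values_event (A i) (mB i).
    rewrite (_ : [set _ | _] = [set o | B i (count_values (A i) o)]) //.
    by apply/seteqP; split=> o /=; [apply|move=> ? ?].
  rewrite (_ : [set _ | _] = setT) //; apply/seteqP; split=> o //=.
have := independent_events (measurable_values_on U) (measurable_values_on (A n))
  (fun s s' => values_on_independent s s' UA) eF (count_values_event (A n) (mB n)).
have e1 : [set t | F (values_on U t)] =
    [set t | forall i, (i < n)%N -> B i (point_count R (N t) (A i))].
  apply/seteqP; split=> t h i i_n; have := h i i_n;
    by rewrite count_valuesE // => e Ae; exists i.
have e2 : [set t | [set o | B n (count_values (A n) o)] (values_on (A n) t)] =
    [set t | B n (point_count R (N t) (A n))].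
  by apply/seteqP; split=> t /=; rewrite count_valuesE.
rewrite e1 e2 => <-; congr (P _); apply/seteqP; split=> t /=.
  by move=> h; split=> [i i_n|]; apply: h => //; exact: ltnW.
by move=> [h1 h2] i; rewrite ltnS leq_eqVlt => /orP[/eqP ->|/h1].
Qed.
End IndependentFamily.

Section Existence.
Variables (R : realType) (E : countType).

(** Integers that code no element of [E] receive the Dirac mass at 0. *)
Definition pickled_pmf (q : E -> nat -> R) (j k : nat) : R :=
  if @pickle_inv E j is Some e then q e k else pois 0 k.

Lemma pickled_pmfP q : (forall e, is_pmf (q e)) -> forall j, is_pmf (pickled_pmf q j).
Proof.
by move=> hq j; rewrite /pickled_pmf; case: pickle_inv => [e|]; [exact: hq|exact: pois_is_pmf].
Qed.

Lemma independent_family (q : E -> nat -> R) : (forall e, is_pmf (q e)) ->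
  exists X : R -> nat -> nat, (forall n, measurable_fun setT (fun u => X u n)) /\
  forall s, unit_prob R [set u | forall j, (j < size s)%N -> X u j = nth 0%N s j] =
    (\prod_(j < size s) pickled_pmf q j (nth 0%N s j))%:E.
Proof. by move=> hq; apply: independent_sequence; exact: pickled_pmfP. Qed.

Lemma pickled_all (T : Type) (X : T -> nat -> nat) (b : E -> pred nat) (bb : nat -> pred nat) s :
  (forall e, bb (pickle e) = b e) ->
  [set t | all (fun e => b e (X t (pickle e))) s] =
  [set t | all (fun j => bb j (X t j)) (map pickle s)].
Proof.
move=> h; have e t : all (fun e => b e (X t (pickle e))) s = all (fun j => bb j (X t j)) (map pickle s).
  by rewrite all_map; apply: eq_all => e /=; rewrite h.
by apply/seteqP; split=> t; rewrite /mkset e.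
Qed.

Lemma poisson_point_process_exists (r : E -> R) (mu : set E -> \bar R) : (forall e, 0 <= r e) ->
  (forall A, mu A = \esum_(e in A) (r e)%:E) ->
  exists N : R -> E -> nat, poisson_point_process mu (unit_prob R) N.
Proof.
move=> r0 hmu.
have [X [mX pX]] := independent_family (fun e => pois_is_pmf (r0 e)).
set p := pickled_pmf _ in pX.
pose N (u : R) (e : E) := X u (pickle e); exists N.
have mN e : measurable_fun setT (fun u => N u e) by exact: mX.
have qN (s : seq E) (x : E -> nat) : uniq s ->
    unit_prob R [set t | all (fun e => N t e == x e) s] = (\prod_(e <- s) pois (r e) (x e))%:E.
  move=> us; pose y j := if @pickle_inv E j is Some e then x e else 0%N.
  rewrite (pickled_all X s (b := fun e k => k == x e) (bb := fun j k => k == y j)); last first.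
    by move=> e; rewrite /y pickleK_inv.
  rewrite (independent_all (P := unit_prob R) (X := X) (b := fun j k => k == y j) (c := fun j => p j (y j))).
  - by rewrite big_map; congr EFin; apply: eq_bigr => e _; rewrite /p /pickled_pmf /y pickleK_inv.
  - by move=> m Q; exact: (prefix_next (P := unit_prob R) mX pX).
  - by rewrite map_inj_uniq //; exact: (pcan_inj pickleK).
pose lam j := if @pickle_inv E j is Some e then r e else 0.
have lam0 j : 0 <= lam j by rewrite /lam; case: pickle_inv.
have pG j : p j = pois (lam j) by rewrite /p /pickled_pmf /lam; case: pickle_inv.
pose G (A : set E) (j : nat) := if @pickle_inv E j is Some e then e \in A else false.
have series (A : set E) (f : E -> R) (g : nat -> R) : (forall e, 0 <= f e) -> (forall e, g (pickle e) = f e) ->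
    \esum_(e in A) (f e)%:E = (\sum_(j <oo | G A j) (g j)%:E)%E.
  move=> f0 gf; rewrite nneseries_esum; last first.
    move=> j; rewrite /G; have := @pickle_invK E j; case: pickle_inv => [e|//] /= <- _.
    by rewrite lee_fin gf.
  rewrite (_ : [set j | G A j] = pickle @` A).
    rewrite esum_image; first by apply: eq_esum => e _; rewrite gf.
    by move=> e e' _ _; exact: (pcan_inj pickleK).
  apply/seteqP; split=> j; rewrite /G /=.
    have := @pickle_invK E j; case: pickle_inv => [e|//] /= <- eA.
    by exists e; rewrite // inE in eA.
  by move=> [e Ae <-]; rewrite pickleK_inv inE.
have cnt A t : point_count R (N t) A = total_count R X (G A) t.
  by rewrite /point_count /total_count; apply: series.
have rate A : mu A = (\sum_(j <oo | G A j) (lam j)%:E)%E.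
  by rewrite hmu; apply: series => // e; rewrite /lam pickleK_inv.
split.
- by [].
- move=> A l hl k; have l0 : 0 <= l.
    by rewrite -lee_fin -hl hmu; apply: esum_ge0 => e _; rewrite lee_fin.
  rewrite poisE // -(total_count_law (P := unit_prob R) mX pX (G := G A) lam0 (fun j _ => pG j) k (l := l));
    last by rewrite -rate.
  by congr (unit_prob R _); apply/seteqP; split=> t /=; rewrite cnt.
- move=> A hl; rewrite -(total_count_infinite (P := unit_prob R) mX pX (G := G A) lam0 (fun j _ => pG j));
    last by rewrite -rate.
  by congr (unit_prob R _); apply/seteqP; split=> t /=; rewrite cnt.
- move=> n A B tA mB.
  (* The family is extended to a sequence by empty sets; only indices below [n] enter the event. *)
  pose A' i := if @insub nat (fun i => i < n)%N _ i is Some j then A j else set0.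
  pose B' i := if @insub nat (fun i => i < n)%N _ i is Some j then B j else set0.
  have A'E (i : 'I_n) : A' i = A i by rewrite /A' valK.
  have B'E (i : 'I_n) : B' i = B i by rewrite /B' valK.
  have tA' : trivIset setT A'.
    move=> i j _ _ [e []]; rewrite /A'; case: insubP => [i' _ <-|_ []]; case: insubP => [j' _ <-|_ _ []] //.
    by move=> h1 h2; congr (nat_of_ord _); apply: (tA i' j') => //; exists e.
  have mB' i : measurable (B' i) by rewrite /B'; case: insub.
  have := point_counts_independent (P := unit_prob R) (q := fun e => pois (r e)) mN qN n tA' mB'.
  rewrite (_ : [set t | _] = [set omega | forall i, B i (point_count R (N omega) (A i))]); last first.
    apply/seteqP; split=> t /= h i.
      by have := h i (ltn_ord i); rewrite A'E B'E.
    by move=> i_n; have := h (Ordinal i_n); rewrite -A'E -B'E.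
  by move=> ->; apply: eq_bigr => i _; rewrite A'E B'E.
Qed.

(* Values 2, 1, 0: occupied in both fields, only in the second, in none. *)
Definition coupling_pmf (a b : R) (k : nat) : R :=
  match k with 0 => 1 - b | 1 => b - a | 2 => a | _ => 0 end.

Lemma coupling_is_pmf a b : 0 <= a -> a <= b -> b <= 1 -> is_pmf (coupling_pmf a b).
Proof.
move=> a0 ab b1; have S k : \sum_(j < k.+3) coupling_pmf a b j = 1.
  elim: k => [|k IH]; first by rewrite !big_ord_recr big_ord0 /=; lra.
  by rewrite big_ord_recr /= IH addr0.
split=> [[|[|[|k]]] /=|[|[|[|k]]]|x x1]; try lra.
- by rewrite big_ord0.
- by rewrite big_ord1 /=; lra.
- by rewrite !big_ord_recr big_ord0 /=; lra.
- by rewrite S.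
- by exists 3%N; rewrite S.
Qed.

Lemma bernoulli_coupling (a b : E -> R) : (forall e, 0 <= a e) -> (forall e, a e <= b e) ->
  (forall e, b e <= 1) -> exists o o' : R -> E -> bool,
  [/\ bernoulli_field (unit_prob R) o a, bernoulli_field (unit_prob R) o' b &
      forall t e, o t e -> o' t e].
Proof.
move=> a0 ab b1; have pm e := coupling_is_pmf (a0 e) (ab e) (b1 e).
have [X [mX pX]] := independent_family pm; set p := pickled_pmf _ in pX.
have inj := pcan_inj (@pickleK E).
exists (fun t e => X t (pickle e) == 2%N), (fun t e => X t (pickle e) != 0%N); split.
- split=> [e|s us]; first exact: (measurable_coord mX (pickle e) (fun k => k == 2%N)).
  rewrite /cylinder /= (pickled_all X s (b := fun _ k => k == 2%N) (bb := fun _ k => k == 2%N)) //.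
  rewrite (independent_all (P := unit_prob R) (X := X) (b := fun _ k => k == 2%N) (c := fun j => p j 2%N)).
  + by rewrite big_map; congr EFin; apply: eq_bigr => e _; rewrite /p /pickled_pmf pickleK_inv.
  + by move=> m Q; exact: (prefix_next (P := unit_prob R) mX pX).
  + by rewrite map_inj_uniq.
- split=> [e|s us]; first exact: (measurable_coord mX (pickle e) (fun k => k != 0%N)).
  rewrite /cylinder /= (pickled_all X s (b := fun _ k => k != 0%N) (bb := fun _ k => k != 0%N)) //.
  rewrite (independent_all (P := unit_prob R) (X := X) (b := fun _ k => k != 0%N) (c := fun j => 1 - p j 0%N)).
  + rewrite big_map; congr EFin; apply: eq_bigr => e _; rewrite /p /pickled_pmf pickleK_inv /=.
    by rewrite opprB addrC subrK.
  + by move=> m Q; exact: (prefix_next_neq (P := unit_prob R) mX pX).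
  + by rewrite map_inj_uniq.
- by move=> t e /eqP ->.
Qed.
End Existence.

(** * Monotonicity for T <= 1/2 and the critical value *)

Section Dichotomy.
Variables (R : realType) (d : nat).
Hypothesis d0 : (0 < d)%N.
Variable (u : R).
Hypothesis u0 : 0 < u.
Notation W := (walk d).

Lemma FI_exists (T : R) : 0 < T ->
  exists N : R -> W -> nat, finitary_interlacement u T (unit_prob R) N.
Proof.
move=> T0; apply: (@poisson_point_process_exists _ _ (walk_rate u T)) => [w|A].
  by apply: walk_rate_ge0; exact: ltW.
by apply: FI_intensityE => //; exact: ltW.
Qed.

Lemma percolation_probability (T : R) (disp disp' : measure_display)
    (Omega : measurableType disp) (Omega' : measurableType disp')
    (P : probability Omega R) (P' : probability Omega' R)
    (N : Omega -> W -> nat) (g : Omega' -> W -> bool) :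
  0 < T -> finitary_interlacement u T P N -> bernoulli_field P' g (occupation_prob u T) ->
  P [set t | percolates (N t)] = P' [set t | percolation_event (g t)].
Proof.
move=> T0 FI bg; rewrite (set_percolates N).
apply: (bernoulli_field_law (FI_bernoulli_field d0 (ltW u0) T0 FI) bg).
exact: percolation_event_measurable.
Qed.

Lemma percolation_probability_law (T : R) (disp disp' : measure_display)
    (Omega : measurableType disp) (Omega' : measurableType disp')
    (P : probability Omega R) (P' : probability Omega' R)
    (N : Omega -> W -> nat) (N' : Omega' -> W -> nat) :
  0 < T -> finitary_interlacement u T P N -> finitary_interlacement u T P' N' ->
  P [set t | percolates (N t)] = P' [set t | percolates (N' t)].
Proof.
move=> T0 FI FI'; rewrite (set_percolates N').
exact: percolation_probability (FI_bernoulli_field d0 (ltW u0) T0 FI').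
Qed.

(** The 0-1 law is applied to one realization, and all realizations give percolation the same
    probability. *)
Lemma FI_dichotomy (T : R) : 0 < T -> FI_as_percolates d u T \/ FI_as_not_percolates d u T.
Proof.
move=> T0; have [N FI] := FI_exists T0.
have [p|p] := percolates_01 d0 (ltW u0) T0 FI; [right|left] => disp Omega P' N' FI'.
  apply/(ae_not_percolates d0 (ltW u0) T0 FI').
  by rewrite (percolation_probability_law T0 FI' FI).
apply/(ae_percolates d0 (ltW u0) T0 FI').
by rewrite (percolation_probability_law T0 FI' FI).
Qed.

Lemma FI_not_both (T : R) : 0 < T -> FI_as_percolates d u T -> ~ FI_as_not_percolates d u T.
Proof.
move=> T0 h1 h2; have [N FI] := FI_exists T0.
have /(ae_percolates d0 (ltW u0) T0 FI) p1 := h1 _ _ _ _ FI.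
have /(ae_not_percolates d0 (ltW u0) T0 FI) := h2 _ _ _ _ FI.
by rewrite p1 => /eqP; rewrite eqe oner_eq0.
Qed.

(* Only the walks of length k >= 1 matter, and T^k / (T+1)^(k+2) increases up to T = k/2. *)
Lemma walk_rate_mono (T T' : R) (w : W) : (0 < wlength w)%N -> 0 < T -> T <= T' -> T' <= 2^-1 ->
  walk_rate u T w <= walk_rate u T' w.
Proof.
move=> w0 T0 TT T2; have T'0 := lt_le_trans T0 TT.
rewrite /walk_rate; case: (wlength w) w0 => // k _.
rewrite ler_wpM2r ?invr_ge0 ?exprn_ge0 // -!mulrA !ler_wpM2l ?ler0n ?(ltW u0) //.
(* Both factors increase: the first for all positive arguments, the second up to [1/2]. *)
have split (x : R) : 0 < x -> x ^+ k.+1 / (x + 1) ^+ k.+3 = (x / (x + 1)) ^+ k * (x / (x + 1) ^+ 3).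
  move=> x0; rewrite -[k.+3]addn3 (exprD (x + 1)) (exprSr x) expr_div_n invfM.
  by rewrite mulrACA.
rewrite !split //; have a0 : 0 < T + 1 by lra.
have b0 : 0 < T' + 1 by lra.
have [T0' T'0' a0' b0'] := And4 (ltW T0) (ltW T'0) (ltW a0) (ltW b0).
apply: ler_pM; rewrite ?exprn_ge0 ?divr_ge0 ?exprn_ge0 //.
  apply: lerXn2r; rewrite ?nnegrE ?divr_ge0 //.
  by rewrite ler_pdivrMr // mulrAC ler_pdivlMr //; nra.
rewrite ler_pdivrMr ?exprn_gt0 // mulrAC ler_pdivlMr ?exprn_gt0 //.
rewrite -subr_ge0; have -> : T' * (T + 1) ^+ 3 - T * (T' + 1) ^+ 3 =
  (T' - T) * (1 - 3 * (T * T') - (T * T') * (T + T')) by ring.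
apply: mulr_ge0; first by rewrite subr_ge0.
(* The remaining factor is at least [1 - 3/4 - 1/4 = 0]. *)
have h : T * T' <= 4^-1.
  by apply: le_trans (_ : 2^-1 * 2^-1 <= _); [apply: ler_pM => //; lra|lra].
have h' : (T * T') * (T + T') <= 4^-1 * 1.
  by apply: ler_pM => //; [apply: mulr_ge0; lra|lra|lra].
lra.
Qed.

Lemma FI_percolates_mono (T T' : R) : 0 < T -> T <= T' -> T' <= 2^-1 ->
  FI_as_percolates d u T -> FI_as_percolates d u T'.
Proof.
move=> T0 TT T2 hT; have T'0 := lt_le_trans T0 TT.
case: (FI_dichotomy T'0) => // hn; exfalso.
have r0 x : 0 < x -> forall w : W, 0 <= walk_rate u x w.
  by move=> x0 w; apply: walk_rate_ge0; exact: ltW.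
have [w|w|w|f [f' [bf bf' ff']]] := @bernoulli_coupling R W (occupation_prob u T) (occupation_prob u T').
- by rewrite /occupation_prob; case: ifP => // _; rewrite subr_ge0 -expR0 ler_expR oppr_le0 r0.
- rewrite /occupation_prob; case: ifP => // w0.
  by rewrite lerD2l lerN2 ler_expR lerN2; exact: walk_rate_mono.
- by rewrite /occupation_prob; case: ifP => // _; rewrite lerBlDr lerDl expR_ge0.
have [N FI] := FI_exists T0; have [N' FI'] := FI_exists T'0.
have /(ae_percolates d0 (ltW u0) T0 FI) p1 := hT _ _ _ _ FI.
have /(ae_not_percolates d0 (ltW u0) T'0 FI') p0 := hn _ _ _ _ FI'.
have me (g : R -> W -> bool) p : bernoulli_field (unit_prob R) g p -> measurable [set t | percolation_event (g t)].
  by case=> mg _; apply: measurable_event => //; exact: percolation_event_measurable.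
have : (unit_prob R [set t | percolation_event (f t)] <= unit_prob R [set t | percolation_event (f' t)])%E.
  apply: le_measure; rewrite ?inE; [exact: me bf|exact: me bf'|].
  move=> t; apply: percolates_mono => w; have := ff' t w.
  by case: (f t w) => // /(_ isT) ->.
rewrite -(percolation_probability T0 FI bf) -(percolation_probability T'0 FI' bf') p1 p0.
by rewrite lee_fin ler10.
Qed.

(** If [Tc_minus < Tc_plus], let [T] lie between them. Some [T1 < T] violates absence of
    percolation, hence percolates by [FI_dichotomy]; monotonicity up to [1/2] and percolation beyond
    give percolation for every [T' > T], so that [Tc_plus <= T], a contradiction. The assumptions on
    small and large [T] keep both values finite in this argument. *)
Lemma Tc_equality (e : R) : 0 < e -> (forall T, 0 < T -> T < e -> FI_as_not_percolates d u T) ->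
  (forall T, 2^-1 <= T -> FI_as_percolates d u T) -> Tc_plus d u = Tc_minus d u.
Proof.
move=> e0 small large; apply/eqP; rewrite eq_le; apply/andP; split; last first.
  apply: ge_ereal_sup => _ [a [a0 ha] <-]; apply: le_ereal_inf_tmp => _ [b [b0 hb] <-].
  (* If [b < a], their midpoint would both percolate and not percolate. *)
  rewrite lee_fin leNgt; apply/negP => ba.
  apply: (@FI_not_both ((a + b) / 2)); first lra.
    by apply: hb; lra.
  by apply: ha; lra.
have low : (e%:E <= Tc_minus d u)%E by apply: ereal_sup_ubound; exists e.
have high : (Tc_plus d u <= (2^-1)%:E)%E.
  by apply: ereal_inf_lbound; exists 2^-1 => //; split; [lra|move=> T h; apply: large; lra].
rewrite leNgt; apply/negP => lt.
have [s sE] : exists s, Tc_minus d u = s%:E.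
  case: (Tc_minus d u) low lt => [s _ _|_|]; [by exists s| |by rewrite leeNy_eq].
  by rewrite ltNge leey.
have [i iE] : exists i, Tc_plus d u = i%:E.
  case: (Tc_plus d u) high lt => [i _ _||_]; [by exists i|by rewrite leye_eq|].
  by rewrite ltNge leNye.
rewrite sE lee_fin in low; rewrite iE lee_fin in high; rewrite sE iE lte_fin in lt.
pose T := (s + i) / 2.
have [T1 [T10 T1T hT1]] : exists T1, [/\ 0 < T1, T1 < T & ~ FI_as_not_percolates d u T1].
  apply: contrapT => h; have : (T%:E <= Tc_minus d u)%E.
    apply: ereal_sup_ubound; exists T => //; split; first by rewrite /T; lra.
    by move=> T1 T10 T1T; apply: contrapT => h1; apply: h; exists T1.
  by rewrite sE lee_fin /T; lra.
have pT1 : FI_as_percolates d u T1 by case: (FI_dichotomy T10).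
have : (Tc_plus d u <= T%:E)%E.
  apply: ereal_inf_lbound; exists T => //; split; first by rewrite /T; lra.
  move=> T' TT'; case: (leP 2^-1 T') => h; first exact: large.
  by apply: FI_percolates_mono pT1 => //; lra.
by rewrite iE lee_fin /T; lra.
Qed.
End Dichotomy.

Theorem corollary1 (R : realType) (d : nat) (hd : (3 <= d)%N) :
  exists U : R, forall u : R, 0 < u -> U <= u ->
    [/\ Tc_plus d u = Tc_minus d u,
        forall T : R, 0 < T -> (Tc_plus d u < T%:E)%E ->
          FI_as_percolates d u T
      & forall T : R, 0 < T -> (T%:E < Tc_plus d u)%E ->
          FI_as_not_percolates d u T].
Proof.
have d0 : (0 < d)%N by exact: leq_trans hd.
have [U hU] := large_u_percolates R hd (erefl 16%N).
(* The condition [c T <= 1] is the smallness assumption of [not_percolates_small], whence the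
   threshold [c^-1]. *)
exists U => u u0 Uu; pose c : R := (32 * d)%:R * (1 + u * (2 * d)%:R).
have c0 : 0 < c by rewrite mulr_gt0 ?ltr0n ?muln_gt0 // addr_gt0 // mulr_gt0 // ltr0n muln_gt0.
have E : Tc_plus d u = Tc_minus d u.
  apply: (@Tc_equality _ _ d0 u u0 c^-1); first by rewrite invr_gt0.
    move=> T T0 Tc disp Omega P N FI; apply: (not_percolates_small d0 u0 T0 _ FI).
    by rewrite -ler_pdivlMl // mulr1 ltW.
  by move=> T T2; exact: hU.
split=> // T T0.
  move=> /ereal_inf_lt[_ [a [a0 ha] <-]]; rewrite lte_fin; exact: ha.
by rewrite E => /ereal_sup_gt[_ [a [a0 ha] <-]]; rewrite lte_fin; exact: ha.
Qed.
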